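(* Let $\delta_v^{orb}$ be the valency of $v\in\mathcal{N}$ in the orbifold graph $\mathcal{T}^{orb}$. Then for any $h\in H$, $$Q_h^{red}(x)=\sum_{\overline{vw}\text{ edge of }\mathcal{T}^{orb}}Q_h^{vw}(x)-\sum_{v\in\mathcal{N}}(\delta_v^{orb}-1)Q_h^{v}(x)$$ for any $x\in\sum_{v\in\mathcal{V}}(\delta_v-2)E_v^*+\operatorname{int}(\mathcal{S}')$. In particular, $$\mathrm{pc}(Z_h(\mathbf{t}_{\mathcal{N}}))=\sum_{\overline{vw}\text{ edge of }\mathcal{T}^{orb}}\mathrm{pc}(Z_h(\mathbf{t}_{vw}))-\sum_{v\in\mathcal{N}}(\delta_v^{orb}-1)\,\mathrm{pc}(Z_h(t_v)),$$ where the periodic constants are associated with the appropriate projections of the real Lipman cone.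
   Context: $\mathcal{T}$ is a finite tree (a connected negative definite plumbing graph with all genera zero) with vertex set $\mathcal{V}$; $\delta_v$ is the valency of $v$; $\mathcal{N}=\{v\in\mathcal{V}:\delta_v\ge3\}$ is the set of nodes. The orbifold graph $\mathcal{T}^{orb}$ has vertex set $\mathcal{N}$, two nodes being joined by an edge if they are connected in $\mathcal{T}$ by a path all of whose vertices other than the two nodes have valency $2$. $L=\mathbb{Z}\langle E_v\rangle_{v\in\mathcal{V}}$ is a free lattice with a negative definite integral symmetric form $(\,,\,)$ such that, for $v\ne w$, $(E_v,E_w)=1$ if $\overline{vw}$ is an edge of $\mathcal{T}$ and $0$ otherwise. $L'\subset L\otimes\mathbb{Q}$ is the dual lattice, freely generated by the elements $E_v^*$ defined by $(E_v^*,E_w)=-1$ if $v=w$ and $0$ otherwise (all coordinates of $E_v^*$ in the basis $\{E_w\}$ are positive). $H=L'/L$ is a finite group; $[x]\in H$ is the class of $x\in L'$. $\mathcal{S}'=\mathbb{Z}_{\ge0}\langle E_v^*\rangle_{v}$, $\mathcal{S}'_{\mathbb{R}}=\mathbb{R}_{\ge0}\langle E_v^*\rangle_v$ (real Lipman cone), and $\operatorname{int}(\mathcal{S}')=\mathbb{Z}_{>0}\langle E_v^*\rangle_{v}$. For $y=\sum_v y_vE_v\in L'$ and $\emptyset\ne\mathcal{I}\subseteq\mathcal{V}$ put $\mathbf{t}^y=\prod_{v\in\mathcal V} t_v^{y_v}$, $\mathbf{t}_{\mathcal{I}}^{y}=\prod_{v\in\mathcal{I}}t_v^{y_v}$, $\mathbf{t}_{vw}=\mathbf{t}_{\{v,w\}}$.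 Let $\pi_{\mathcal{I}}:\mathbb{R}\langle E_v\rangle_{v\in\mathcal{V}}\to\mathbb{R}\langle E_v\rangle_{v\in\mathcal{I}}$ be the coordinate projection. Define $f_h$ by $\prod_{v\in\mathcal{V}}(1-[E_v^*]\mathbf{t}^{E_v^*})^{\delta_v-2}=\sum_{h\in H}f_h(\mathbf{t})\cdot h$ (coefficients in $\mathbb{Z}[H]$), and let $f_h(\mathbf{t}_{\mathcal{I}})$ be $f_h(\mathbf{t})$ with $t_v=1$ for $v\notin\mathcal{I}$. $\mathrm{T}$ is Taylor expansion at the origin. If $\sum_{l'}p_{l'}\mathbf{t}^{l'}=\mathrm{T}[\prod_v(1-\mathbf{t}^{E_v^*})^{\delta_v-2}]$, then $Z_h(\mathbf{t}_{\mathcal{I}}):=\mathrm{T}[f_h(\mathbf{t}_{\mathcal{I}})]=\sum_{[l']=h}p_{l'}\mathbf{t}_{\mathcal{I}}^{l'}$. The counting function associated with $Z_h(\mathbf{t}_{\mathcal{I}})$ is $$Q_h^{\mathcal{I}}(x)=\sum\{\,p_{l'}:[l']=h,\ \pi_{\mathcal{I}}(l')\not\ge\pi_{\mathcal{I}}(x)\,\},\qquad x\in L',$$ where $\ge$ is the coordinatewise order with respect to $\{E_v\}$ (a finite sum, depending only on $\pi_{\mathcal{I}}(x)$). Write $Q_h^{red}=Q_h^{\mathcal{N}}$, $Q_h^{v}=Q_h^{\{v\}}$, $Q_h^{vw}=Q_h^{\{v,w\}}$. A quasipolynomial on a lattice is a function whose restriction to each coset of some finite-index sublattice is a polynomial.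 Periodic constant: if there are a finite-index sublattice $\widetilde L\subset\pi_{\mathcal{I}}(L')$, an element $l'_*\in\pi_{\mathcal{I}}(\mathcal{S}'_{\mathbb{R}})$ and a quasipolynomial on $\widetilde L$ coinciding with $Q_h^{\mathcal{I}}$ on $\widetilde L\cap(l'_*+\pi_{\mathcal{I}}(\mathcal{S}'_{\mathbb{R}}))$, then $\mathrm{pc}(Z_h(\mathbf{t}_{\mathcal{I}}))=\mathrm{pc}^{\pi_{\mathcal{I}}(\mathcal{S}'_{\mathbb{R}})}(Z_h(\mathbf{t}_{\mathcal{I}}))$ is the value of this quasipolynomial at $0$ (independent of the choice of $\widetilde L$). *)

(* Defs.v *)
From HB Require Import structures.
From mathcomp Require Import all_boot all_order all_algebra.
From mathcomp Require Import boolp classical_sets functions cardinality fsbigop.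
From mathcomp Require Import reals.
From mathcomp.multinomials Require mpoly.

Set Implicit Arguments.
Unset Strict Implicit.
Unset Printing Implicit Defensive.
Import Order.TTheory GRing.Theory Num.Theory.
Local Open Scope ring_scope.

(* A tree on the vertex set 'I_n, together with the intersection matrix of a
   negative definite plumbing on it; the diagonal entries (Euler numbers) are
   otherwise free. Irreflexivity and symmetry make a cycle of a graph a simple
   cycle of length at least 3, so [edge_acyclic] only excludes those. *)
Record plumbing_tree (n : nat) := PlumbingTree {
  edge : rel 'I_n;
  edge_irrefl : irreflexive edge;
  edge_sym : symmetric edge;
  edge_nonempty : (0 < n)%N;
  edge_connected : forall u v : 'I_n, connect edge u v;
  edge_acyclic : forall c : seq 'I_n, ucycle edge c -> (size c <= 2)%N;
  intmx : 'M[int]_n;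
  intmx_sym : intmx^T = intmx;
  intmx_offdiag : forall v w : 'I_n, v != w -> intmx v w = (edge v w)%:R;
  intmx_negdef :
    forall x : 'rV[int]_n, x != 0 -> (x *m intmx *m x^T) 0 0 < 0
}.

Section Graph.
Variables (n : nat) (T : plumbing_tree n).

Definition valency (v : 'I_n) : nat := #|[set w | edge T v w]|.

Definition nodes : {set 'I_n} := [set v | (3 <= valency v)%N].

Definition orb_edge (v w : 'I_n) : bool :=
  [&& v \in nodes, w \in nodes &
   `[< exists p : seq 'I_n,
       [/\ path (edge T) v (rcons p w), uniq (v :: rcons p w) &
           all (fun u => valency u == 2) p] >]].

(* The unordered edges of the orbifold graph, as two-element sets. *)
Definition orb_edges : {set {set 'I_n}} :=
  [set I : {set 'I_n} |
    [exists v, exists w, orb_edge v w && (I == [set v; w])]].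

Definition orb_valency (v : 'I_n) : nat := #|[set w | orb_edge v w]|.

End Graph.

(* Vectors are written in the basis (E_v). The space spanned by the E_v with
   v in I is the space of vectors whose coordinates outside I vanish. *)
Definition proj (K : nmodType) (n : nat) (I : {set 'I_n}) (x : 'rV[K]_n) :
    'rV[K]_n :=
  \row_v (if v \in I then x 0 v else 0).

Definition le_coord (n : nat) (x y : 'rV[rat]_n) : Prop :=
  forall v : 'I_n, x 0 v <= y 0 v.

Section Lattice.
Variables (n : nat) (T : plumbing_tree n).

Definition Evec (v : 'I_n) : 'rV[rat]_n := delta_mx 0 v.

Definition pairing (x y : 'rV[rat]_n) : rat :=
  (x *m map_mx intr (intmx T) *m y^T) 0 0.

Definition latticeL : set 'rV[rat]_n :=
  [set x : 'rV[rat]_n | forall v : 'I_n, x 0 v \is a Num.int]%classic.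

Definition latticeL' : set 'rV[rat]_n :=
  [set x : 'rV[rat]_n |
    forall y, latticeL y -> pairing x y \is a Num.int]%classic.

(* See [pairing_Estar] for the characteristic property. *)
Definition Estar (v : 'I_n) : 'rV[rat]_n :=
  row v (- invmx (map_mx intr (intmx T))).

Definition EstarR (R : realType) (v : 'I_n) : 'rV[R]_n :=
  map_mx ratr (Estar v).

Definition int_lipman : set 'rV[rat]_n :=
  [set x : 'rV[rat]_n | exists a : 'I_n -> nat,
    (forall v, (0 < a v)%N) /\ x = \sum_v (a v)%:R *: Estar v]%classic.

Definition lipman_real (R : realType) : set 'rV[R]_n :=
  [set x : 'rV[R]_n | exists a : 'I_n -> R,
    (forall v, 0 <= a v) /\ x = \sum_v a v *: EstarR R v]%classic.

End Lattice.

Arguments EstarR {n} T R v.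
Arguments lipman_real {n} T R _.

(* The coefficient of z^k in the Taylor expansion of (1 - z)^m at 0. *)
Definition tcoef (m : int) (k : nat) : int :=
  match m with
  | Posz d => ((1 - 'X) ^+ d : {poly int})`_k
  | Negz d => 'C(d + k, k)%:Z
  end.

Section Counting.
Variables (n : nat) (T : plumbing_tree n).

(* The coefficient p_l of t^l in the Taylor expansion of
   prod_v (1 - t^(E_v^* ))^(valency v - 2). As the E_v^* are independent, the
   only contribution to t^l comes from l = sum_v a_v E_v^* with natural numbers
   a_v = - (l, E_v); see [pcoef_Estar]. *)
Definition pcoef (l : 'rV[rat]_n) : int :=
  if [forall v, - pairing T l (Evec v) \is a Num.nat]
  then \prod_v tcoef ((valency T v)%:Z - 2)
                     (Num.truncn (- pairing T l (Evec v)))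
  else 0.

(* An element of the discriminant group L'/L is given by a representative h in
   L'; the class of l is that of h when l - h lies in L. The sum has finite
   support, and only depends on the projection of x. *)
Definition counting (h : 'rV[rat]_n) (I : {set 'I_n}) (x : 'rV[rat]_n) : int :=
  \sum_(l \in [set l : 'rV[rat]_n | [/\ latticeL' T l, latticeL (l - h) &
                 ~ le_coord (proj I x) (proj I l)]]%classic) pcoef l.

End Counting.

Section PeriodicConstant.

Definition finite_index_sublattice (n : nat) (M L : set 'rV[rat]_n) : Prop :=
  [/\ M 0,
      forall x y, M x -> M y -> M (x - y),
      (M `<=` L)%classic &
      exists s : seq 'rV[rat]_n,
        forall x, L x -> exists2 r, r \in s & M (x - r)].

Definition quasipolynomial (R : realType) (n : nat) (L : set 'rV[rat]_n)
    (q : 'rV[rat]_n -> R) : Prop :=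
  exists M : set 'rV[rat]_n, finite_index_sublattice M L /\
    forall r, L r -> exists P : mpoly.mpoly n R,
      forall y, M y -> q (r + y) = mpoly.meval (fun v => ratr ((r + y) 0 v)) P.

Variables (R : realType) (n : nat) (T : plumbing_tree n) (h : 'rV[rat]_n).

Definition is_periodic_constant (I : {set 'I_n}) (c : R) : Prop :=
  exists (Lt : set 'rV[rat]_n) (lstar : 'rV[R]_n) (q : 'rV[rat]_n -> R),
  [/\ finite_index_sublattice Lt (proj I @` latticeL' T)%classic,
      (proj I @` lipman_real T R)%classic lstar,
      quasipolynomial Lt q,
      forall x, latticeL' T x -> Lt (proj I x) ->
        (proj I @` lipman_real T R)%classic
          (map_mx ratr (proj I x) - lstar) ->
        (counting T h I x)%:~R = q (proj I x) &
      c = q 0].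

Definition has_periodic_constant (I : {set 'I_n}) : Prop :=
  exists c : R, is_periodic_constant I c.

(* The default value 0 is only used when no periodic constant exists. *)
Definition periodic_constant (I : {set 'I_n}) : R :=
  xget 0 [set c : R | is_periodic_constant I c]%classic.

End PeriodicConstant.

Section Facts.
Variables (n : nat) (T : plumbing_tree n).

Lemma tcoefN_inv (d k : nat) :
  \sum_(i < k.+1) tcoef d.+1%:Z i * tcoef (Negz d) (k - i) = (k == 0%N)%:R.
Proof.
elim: d k => [|d IHd] k.
  rewrite /tcoef; under eq_bigr => i _.
    rewrite expr1 add0n binn mulr1 coefB coef1 coefX.
    over.
  case: k => [|k]; first by rewrite big_ord1.
  by rewrite big_ord_recl big_ord_recl /= big1 // => i _.
rewrite -{}IHd.
pose A i := tcoef d.+1%:Z i; pose C := tcoef (Negz d.+1).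
have tS i : tcoef d.+2%:Z i = A i - (if i is j.+1 then A j else 0).
  rewrite /A /tcoef exprSr mulrBr mulr1 coefB coefMX.
  by case: i.
have CS m : tcoef (Negz d) m = C m - (if m is j.+1 then C j else 0).
  rewrite /C /tcoef; case: m => [|m]; first by rewrite !bin0 subr0.
  rewrite addSn binS addnS -addSn PoszD.
  by rewrite addrK.
under eq_bigr do rewrite tS mulrBl.
under [RHS]eq_bigr do rewrite CS mulrBr.
rewrite !sumrB; congr (_ - _).
rewrite big_ord_recl mul0r add0r.
rewrite [RHS]big_ord_recr /= subnn mulr0 addr0.
apply: eq_bigr => i _; rewrite /bump /= add1n.
by rewrite -[in RHS](prednK (n := k - i)) ?subn_gt0 // -subnS.
Qed.

Lemma intmx_unit : (map_mx intr (intmx T) : 'M[rat]_n) \in unitmx.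
Proof.
rewrite -row_free_unit -kermx_eq0; apply/negPn/negP => /rowV0Pn[x].
move/sub_kermxP => xB0 xN0.
have [d [d0 [y yE]]] : exists d : int, d != 0 /\
    exists y : 'rV[int]_n, d%:~R *: x = map_mx intr y.
  exists (\prod_v denq (x 0 v)); split.
    by apply/prodf_neq0 => v _; rewrite denq_neq0.
  exists (\row_v (numq (x 0 v) * \prod_(u | u != v) denq (x 0 u))).
  apply/rowP => v; rewrite !mxE (bigD1 v) //= !rmorphM /=.
  by rewrite mulrAC mulrC [_%:~R * x 0 v]mulrC -numqE mulrC.
have yN0 : y != 0.
  apply: contraNneq xN0 => y0; move/eqP: yE.
  by rewrite y0 map_mx0 scaler_eq0 intr_eq0 (negPf d0).
have yB0 : y *m intmx T = 0.
  have : map_mx intr (y *m intmx T) = 0 :> 'rV[rat]_n.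
    by rewrite map_mxM -yE -scalemxAl xB0 scaler0.
  move/rowP => yB; apply/rowP => v; move/eqP: (yB v).
  by rewrite !mxE intr_eq0 => /eqP.
by have := intmx_negdef T yN0; rewrite yB0 mul0mx mxE ltxx.
Qed.

Lemma pairing_Estar (v w : 'I_n) :
  pairing T (Estar T v) (Evec w) = - (v == w)%:R.
Proof.
rewrite /pairing /Estar -row_mul mulNmx mulVmx ?intmx_unit //.
by rewrite /Evec trmx_delta -colE !mxE.
Qed.

Lemma pairing_sum_Estar (a : 'I_n -> rat) (w : 'I_n) :
  - pairing T (\sum_v a v *: Estar T v) (Evec w) = a w.
Proof.
have -> : pairing T (\sum_v a v *: Estar T v) (Evec w) =
          \sum_v a v * pairing T (Estar T v) (Evec w).
  rewrite /pairing !mulmx_suml summxE; apply: eq_bigr => v _.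
  by rewrite -!scalemxAl mxE.
under eq_bigr do rewrite pairing_Estar mulrN.
rewrite sumrN opprK (bigD1 w) //= eqxx mulr1 big1 ?addr0 // => v /negPf->.
by rewrite mulr0.
Qed.

Lemma pcoef_Estar (a : 'I_n -> nat) :
  pcoef T (\sum_v (a v)%:R *: Estar T v) =
  \prod_v tcoef ((valency T v)%:Z - 2) (a v).
Proof.
have aE w := pairing_sum_Estar (fun v => (a v)%:R) w.
rewrite /pcoef ifT; last by apply/forallP => w; rewrite aE natr_nat.
by apply: eq_bigr => w _; rewrite aE natrK.
Qed.

End Facts.

(* Main.v *)
From HB Require Import structures.
Require Import Defs.
From mathcomp Require Import all_boot all_order all_algebra.
From mathcomp Require Import boolp classical_sets fsbigop reals.
From mathcomp Require Import ring lra.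
From mathcomp.multinomials Require mpoly.
Import (canonicals) mpoly.

(** Write E*_u for [Estar T u]. Let l = \sum_u a_u E*_u have coefficient p_l in
    the Taylor expansion, and let s_v be 1 or 0 according to whether l_v < x_v.
    The counting function of I sums p_l times 1 - \prod_(v in I) (1 - s_v) over
    the class h. Expanding these products, the terms with one node and the
    terms with the two nodes of an orbifold edge cancel in the difference of
    the two sides of the first formula; what is left is a signed sum of \sum_l
    p_l \prod_(v in U) s_v over the other sets U of at least two nodes
    ([inclusion_exclusion]). These U are exactly those with a separator: a node
    m such that two elements of U lie in different components of the tree
    without m ([separators0_orb_edge], [separators_orb_edge]). Adding m to U,
    or removing it, does not change the separators, so U is paired with its
    symmetric difference with a separator m ([separator_pairing]). A pair
    contributes, up to sign, the sum of p_l over the l with l_u < x_u for u in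
    U and l_m >= x_m, where m is not in U.

    Each of these sums is zero ([cancellation]). The condition on l is
    invariant under E_w for w outside U and different from m. Hence, acting on
    the indicator function of the condition, the translations x_t by E*_t
    satisfy \prod_(t adjacent to w) x_t = x_w ^ k for such w, where - k is the
    Euler number of w. Let K be the component of m in the tree without U. The
    relations, used along the branches at m from the ends (vertices of valency
    1) inwards, show that the product of the 1 - x_u over the ends u in K
    divides the product of the (1 - x_u) ^ (valency u - 2) over the other
    vertices of K. A branch that does not meet U consumes one factor 1 - x_m,
    and valency m - 2 factors suffice because at least two branches meet U
    ([component_dvd]). So the K-part of the rational function acts as a Laurent
    polynomial, and the geometric series of its ends may be expanded at
    infinity instead of at 0. In the new expansion, a point l that contributes
    has (l - x, E_t) > 0 for t in K, because x is deep, and l_u < x_u for u in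
    U; the maximum principle for the negative definite form gives l_m < x_m,
    contradicting the condition ([flipped_vanish]).

    For the periodic constants, take the difference of a counting function in a
    direction c E*_v. If c E*_v and d E*_u have the same coordinates on the
    index set, for an end u, this multiplies the series by 1 - x_u ^ d and
    makes the geometric series of u finite ([box_step]). On {v} such c and d
    always exist. On an orbifold edge {v, w} every end is cut off from one of v
    and w by the other one, and is therefore proportional to E*_v or to E*_w on
    {v, w} ([Estar_cut]). Once all series are finite the count does not change
    any more deep in the cone, so iterated differences vanish there and, by the
    Newton expansion, the counting function is polynomial on the deep points
    with divisible coefficients ([vanish_single], [vanish_pair],
    [eventually_poly_newton]). Rounding lifts deep points of the projected cone
    to such points, so the value of the polynomial at 0 is a periodic constant
    ([deep_lift], [represents_periodic_constant]). The first formula carries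
    this over to the set of all nodes ([represents_nodes]), and the periodic
    constant is unique because it can be read off along one ray
    ([periodic_constant_unique]). *)

Set Implicit Arguments.
Unset Strict Implicit.
Unset Printing Implicit Defensive.
Import Order.TTheory GRing.Theory Num.Theory.
Local Open Scope ring_scope.

(** * Branches of a tree *)

Section Tree.
Variables (n : nat) (T : plumbing_tree n).
Implicit Types (u v w t : 'I_n) (A U : {set 'I_n}).

Definition avoid A : rel 'I_n :=
  [rel u v | [&& edge T u v, u \notin A & v \notin A]].

Definition conn A u v := connect (avoid A) u v.

Lemma avoid_sym A : symmetric (avoid A).
Proof. by move=> u v; rewrite /avoid /= edge_sym [(u \notin A) && _]andbC. Qed.

Lemma conn_sym A u v : conn A u v = conn A v u.
Proof. exact: (sym_connect_sym (avoid_sym A)) u v. Qed.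

Lemma conn_trans A v u w : conn A u v -> conn A v w -> conn A u w.
Proof. exact: connect_trans. Qed.

Lemma conn_edge A u v :
  edge T u v -> u \notin A -> v \notin A -> conn A u v.
Proof. by move=> uv uA vA; apply: connect1; rewrite /avoid /= uv uA. Qed.

Lemma path_conn A u p : path (edge T) u p ->
  {in u :: p, forall t, t \notin A} -> conn A u (last u p).
Proof.
elim: p u => [|v p IHp] u /=; first by rewrite /conn connect0.
move=> /andP[uv pP] pA; apply: (@conn_trans _ v).
  by apply: conn_edge => //; apply: pA; rewrite !inE eqxx ?orbT.
by apply: IHp => // t tp; apply: pA; rewrite inE tp orbT.
Qed.

Lemma conn_notin A u v : conn A u v -> u != v -> v \notin A.
Proof.
case/connectP => p; elim/last_ind: p => [|p t _] /=.
  by move=> _ ->; rewrite eqxx.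
by rewrite rcons_path last_rcons => /andP[_ /and3P[_ _ tA]] ->.
Qed.

Lemma conn_uniq_path A u v : conn A u v -> u != v ->
  exists p, [/\ path (edge T) u p, last u p = v, uniq (u :: p) &
                {in u :: p, forall t, t \notin A}].
Proof.
move=> uv neq; case/connectP: (uv) => p pP vE.
case: (shortenP pP) vE => q qP qU _ vE; exists q.
have qe : path (edge T) u q by apply: sub_path qP => a b /and3P[].
split=> // t; rewrite inE => /predU1P[->|tq].
  by move: uv; rewrite conn_sym => /conn_notin; apply; rewrite eq_sym.
case/splitPr: tq qP => q1 q2.
by rewrite cat_path /= => /and3P[_ /and3P[]].
Qed.

Lemma tree_path u v : exists p,
  [/\ path (edge T) u p, last u p = v & uniq (u :: p)].
Proof.
case/connectP: (edge_connected T u v) => p pP vE.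
by case: (shortenP pP) vE => q qP qU _ vE; exists q.
Qed.

Lemma conn_mono A A' u v : {subset A' <= A} -> conn A u v -> conn A' u v.
Proof.
move=> sA; apply: connect_sub => a b /and3P[ab aA bA].
by apply: conn_edge => //; [move: aA|move: bA]; apply/contraNN/sA.
Qed.

(** The path from u to w either avoids v or passes through v, and in the second
    case its part after v avoids u. *)
Lemma conn_exchange u v w : w != u -> w != v -> u != v ->
  conn [set v]%SET u w \/ conn [set u]%SET v w.
Proof.
move=> wu wv uv; have [p [pP pL pU]] := tree_path u w.
have [vp|vp] := boolP (v \in p).
  right; case/splitPr: vp pP pL pU => p1 p2; rewrite cat_path last_cat /=.
  move=> /and3P[_ _ p2P] pL /andP[up _]; rewrite -pL; apply: path_conn => //.
  move=> t tp; rewrite inE; apply: contraNneq up => <-.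
  by rewrite mem_cat tp orbT.
left; rewrite -pL; apply: path_conn => // t; rewrite !inE.
by case/predU1P => [->//|tp]; apply: contraNneq vp => <-.
Qed.

(** Otherwise a path joining f to g without v would close up to a cycle through
    v. *)
Lemma tree_branch v f g : edge T v f -> edge T v g -> f != g ->
  ~~ conn [set v]%SET f g.
Proof.
move=> vf vg fg; apply/negP => /conn_uniq_path /(_ fg) [p [pP pL pU pA]].
have vp : v \notin f :: p.
  by apply/negP => /pA; rewrite inE eqxx.
have := @edge_acyclic _ T (v :: f :: p).
rewrite /ucycle /= rcons_path vf pP pL edge_sym vg /= vp.
move: pU; rewrite /= => -> /(_ isT).
by case: p pL {pP pA vp} => //= fE; rewrite fE eqxx in fg.
Qed.

Lemma edge_neq u v : edge T u v -> u != v.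
Proof. by apply: contraTneq => ->; rewrite edge_irrefl. Qed.

(** The component of f in the tree without v; used for f adjacent to v. *)
Definition branch v f : {set 'I_n} := [set u | conn [set v]%SET f u]%SET.

Lemma branch_self v f : f \in branch v f.
Proof. by rewrite inE /conn connect0. Qed.

Lemma branch_root v f : edge T v f -> v \notin branch v f.
Proof.
move=> vf; rewrite inE; apply/negP => /conn_notin; rewrite inE eqxx => H.
by have := H (negbT _); rewrite eq_sym (negPf (edge_neq vf)) => /(_ erefl).
Qed.

Lemma branch_child v f g u : edge T v f -> edge T f g -> g != v ->
  u \in branch f g -> (u \in branch v f) /\ u != f.
Proof.
move=> vf fg gv; rewrite inE => gu.
have fv : edge T f v by rewrite edge_sym.
have vN : ~~ conn [set f]%SET g v by apply: tree_branch.
have uf : u != f.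
  by apply: contraTneq gu => ->; have := branch_root fg; rewrite inE.
split=> //; have [->|ug] := eqVneq u g.
  rewrite inE conn_edge // !inE //.
  by rewrite (edge_neq fv).
rewrite eq_sym in ug.
have [p [pP pL pU pA]] := conn_uniq_path gu ug.
rewrite inE -pL; apply: (@path_conn _ _ (g :: p)); first by rewrite /= fg.
move=> t; rewrite !inE; case/predU1P => [->|tp]; first by rewrite (edge_neq fv).
apply: contraNneq vN => tv; rewrite -{}tv.
case/predU1P: tp => [->|tp]; first by rewrite /conn connect0.
case/splitPr: tp pP pA {pL pU} => p1 p2 pP pA.
move: pP; rewrite -cat_rcons cat_path => /andP[p1P _].
rewrite -[t](last_rcons g p1); apply: path_conn => // z zp; apply: pA.
by move: zp; rewrite -cat_rcons -cat_cons mem_cat => ->.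
Qed.

(** Follow the path from f to u: its first step goes to g, and it never returns
    to f. *)
Lemma branch_split v f u : edge T v f -> u \in branch v f -> u != f ->
  exists g, [/\ edge T f g, g != v & u \in branch f g].
Proof.
move=> vf; rewrite inE => fu uf; rewrite eq_sym in uf.
have [p [pP pL pU pA]] := conn_uniq_path fu uf.
case: p => [|g p] /= in pP pL pU pA; first by rewrite pL eqxx in uf.
case/andP: pP => fg pP; exists g; split=> //.
  by have := pA g; rewrite !inE eqxx orbT; apply.
rewrite inE -pL; apply: path_conn => // t tp.
by rewrite inE; case/andP: pU => fN _; apply: contraNneq fN => <-.
Qed.

Lemma root_split m u : u != m -> exists2 f, edge T m f & u \in branch m f.
Proof.
move=> um; have [p [pP pL pU]] := tree_path m u.
case: p => [|g p] /= in pP pL pU; first by rewrite pL eqxx in um.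
case/andP: pP => mg pP; exists g => //.
rewrite inE -pL; apply: path_conn => // t tp.
by rewrite inE; case/andP: pU => fN _; apply: contraNneq fN => <-.
Qed.

Lemma branch_disjoint m f g u : edge T m f -> edge T m g ->
  u \in branch m f -> u \in branch m g -> f = g.
Proof.
move=> mf mg; rewrite !inE => fu gu; apply/eqP; apply/negPn/negP => fg.
have := tree_branch mf mg fg; rewrite (conn_trans fu) //.
by rewrite conn_sym.
Qed.

(** The recursive structure of a rooted tree, in the form in which products
    over branches are used. *)
Lemma big_branch (R : Type) (idx : R) (op : Monoid.com_law idx)
    (F : 'I_n -> R) v f : edge T v f ->
  \big[op/idx]_(u in branch v f) F u =
  op (F f) (\big[op/idx]_(g | edge T f g && (g != v))
              \big[op/idx]_(u in branch f g) F u).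
Proof.
move=> vf; rewrite (bigD1 f) ?branch_self //=; congr (op _ _).
pose nxt u := odflt f [pick g | edge T f g && (g != v) && (u \in branch f g)].
have nxtP u : u \in branch v f -> u != f ->
    edge T f (nxt u) && (nxt u != v) && (u \in branch f (nxt u)).
  move=> uB uf; rewrite /nxt; case: pickP => //= H.
  by have [g [fg gv ug]] := branch_split vf uB uf; have := H g; rewrite fg gv ug.
rewrite (partition_big nxt (fun g => edge T f g && (g != v))) /=; last first.
  by move=> u /andP[uB uf]; have /andP[] := nxtP u uB uf.
apply: eq_bigr => g /andP[fg gv]; apply: eq_bigl => u.
apply/idP/idP => [/andP[/andP[uB uf] /eqP <-]|ug].
  by have /andP[] := nxtP u uB uf.
have [uB uf] := branch_child vf fg gv ug; rewrite uB uf /=.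
have /andP[/andP[fn _] un] := nxtP u uB uf.
by apply/eqP; apply: branch_disjoint fn fg un ug.
Qed.

Lemma big_root (R : Type) (idx : R) (op : Monoid.com_law idx)
    (F : 'I_n -> R) m :
  \big[op/idx]_u F u =
  op (F m) (\big[op/idx]_(g | edge T m g) \big[op/idx]_(u in branch m g) F u).
Proof.
rewrite (bigD1 m) //=; congr (op _ _).
pose nxt u := odflt m [pick g | edge T m g && (u \in branch m g)].
have nxtP u : u != m -> edge T m (nxt u) && (u \in branch m (nxt u)).
  move=> um; rewrite /nxt; case: pickP => //= H.
  by have [g mg ug] := root_split um; have := H g; rewrite mg ug.
rewrite (partition_big nxt (fun g => edge T m g)) /=; last first.
  by move=> u um; have /andP[] := nxtP u um.
apply: eq_bigr => g mg; apply: eq_bigl => u.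
apply/idP/idP => [/andP[um /eqP <-]|ug]; first by have /andP[] := nxtP u um.
have um : u != m.
  by apply: contraTneq ug => ->; apply: branch_root.
rewrite um /=; have /andP[mn un] := nxtP u um.
by apply/eqP; apply: branch_disjoint mn mg un ug.
Qed.

End Tree.

(** * Separators and orbifold edges *)

Section Separation.
Variables (n : nat) (T : plumbing_tree n).
Implicit Types (u v w t m : 'I_n) (A U : {set 'I_n}).

Definition sep m u v := [&& u != m, v != m & ~~ conn T [set m]%SET u v].

Lemma sep_sym m u v : sep m u v = sep m v u.
Proof. by rewrite /sep conn_sym andbCA. Qed.

Definition separators U : {set 'I_n} :=
  [set m in nodes T | [exists u in U, exists v in U, sep m u v]]%SET.

Lemma separatorsP U m :
  reflect (m \in nodes T /\
           exists u v, [/\ u \in U, v \in U & sep m u v])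
          (m \in separators U).
Proof.
rewrite [X in reflect _ X]inE; apply: (iffP andP) => -[mN H]; split=> //.
  have /exists_inP[u uU /exists_inP[v vU uv]] := H.
  by exists u, v.
case: H => u [v [uU vU uv]].
by apply/exists_inP; exists u => //; apply/exists_inP; exists v.
Qed.

(** Let m' be another node. Since U meets two components of the tree without m,
    some j in U is not in the one of m', and then the path from m to j avoids
    m'. So j replaces m when m' is tested, and m' separates no more with m than
    without it. *)
Lemma separators_setU1 U m : m \in separators U ->
  separators (m |: U)%SET = separators U.
Proof.
case/separatorsP => mN [j1 [j2 [j1U j2U /and3P[j1m j2m j12]]]].
apply/setP => m'; apply/separatorsP/separatorsP; last first.
  case=> m'N [u [v [uU vU uv]]]; split=> //.
  by exists u, v; rewrite !inE uU vU !orbT.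
case=> m'N [u [v [uU vU /and3P[um vm uv]]]]; split=> //.
have repl t : t \in (m |: U)%SET -> t != m' ->
    exists j, [/\ j \in U, j != m' & conn T [set m']%SET t j].
  rewrite !inE; case/predU1P => [->{t} mm'|tU tm']; last first.
    by exists t; split=> //; apply: connect0.
  have [j [jU jm jm']] :
      exists j, [/\ j \in U, j != m & ~~ conn T [set m]%SET m' j].
    have [c1|c1] := boolP (conn T [set m]%SET m' j1); last by exists j1.
    exists j2; split=> //; apply: contra j12 => c2.
    by apply: conn_trans c2; rewrite conn_sym.
  have jm'0 : j != m' by apply: contraNneq jm' => ->; apply: connect0.
  exists j; split=> //.
  have [//|c] := @conn_exchange _ T m m' j jm jm'0 mm'.
  by rewrite c in jm'.
have [a [aU am ua]] := repl u uU um.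
have [b [bU bm vb]] := repl v vU vm.
exists a, b; split=> //; rewrite /sep am bm /=.
apply: contra uv => ab; apply: conn_trans ua _; apply: conn_trans ab _.
by rewrite conn_sym.
Qed.

Lemma separators_setD1 U m : m \in separators U ->
  separators (U :\ m)%SET = separators U.
Proof.
move=> mI; have [mU|mU] := boolP (m \in U); last first.
  congr separators; apply/setP => t; rewrite !inE.
  by case: eqVneq => // ->; rewrite (negPf mU).
rewrite -{2}(finset.setD1K mU) separators_setU1 //.
case/separatorsP: mI => mN [u [v [uU vU /and3P[um vm uv]]]].
apply/separatorsP; split=> //; exists u, v.
by rewrite !inE um vm uU vU /sep um vm.
Qed.

Lemma path_inner u p v m : path (edge T) u p -> uniq (u :: p) ->
  last u p = v -> m \in p -> m != v -> sep m u v /\ (2 <= valency T m)%N.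
Proof.
move=> pP pU pL mp; case/splitPr: mp pP pU pL => p1 [|b p2].
  by rewrite last_cat /= => _ _ ->; rewrite eqxx.
rewrite cat_path last_cat /= => /and4P[p1P am mb p2P] /andP[uN pU] pL mv.
have ab : last u p1 != b.
  apply/eqP => ab; move: uN pU; rewrite cat_uniq mem_cat => uN /and3P[_ H _].
  have := mem_last u p1; rewrite ab inE => /predU1P[bu|bp1].
    by move: uN; rewrite -bu !inE eqxx !orbT.
  by case/hasP: H; exists b => //; rewrite !inE eqxx orbT.
have am' : edge T m (last u p1) by rewrite edge_sym.
split; last first.
  have <- : #|[set last u p1; b]%SET| = 2%N by rewrite cards2 ab.
  by apply: subset_leq_card; apply/fintype.subsetP => t; rewrite !inE => /orP[]/eqP->.
have mN : m \notin u :: p1.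
  apply/negP; rewrite inE => /predU1P[mu|mp1].
    by move: uN; rewrite mem_cat -mu !inE eqxx orbT.
  move: pU; rewrite cat_uniq => /and3P[_ /hasP[]]; exists m => //.
  by rewrite inE eqxx.
have mN2 : m \notin b :: p2.
  by move: pU; rewrite cat_uniq => /and3P[_ _ /andP[]].
rewrite /sep (memPn mN) ?mem_head //= eq_sym mv /=.
apply: contraNN (tree_branch am' mb ab) => uv.
apply: (conn_trans (v := u)).
  rewrite conn_sym; apply: path_conn => // t tp.
  by rewrite inE; apply: contraNneq mN => <-.
apply: conn_trans uv _; rewrite conn_sym -pL; apply: path_conn => // t tp.
by rewrite inE; apply: contraNneq mN2 => <-.
Qed.

(** An inner vertex of the path from u to v separates u from v, so it can only
    be of valency 2. *)
Lemma orb_edge_of_sep u v : u \in nodes T -> v \in nodes T -> u != v ->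
  {in nodes T, forall m, ~~ sep m u v} -> orb_edge T u v.
Proof.
move=> uN vN uv H; rewrite /orb_edge uN vN /=; apply/asboolP.
have [p [pP pL pU]] := tree_path T u v.
elim/last_ind: p pP pL pU => [|p x _]; first by move=> _ /= E; rewrite E eqxx in uv.
rewrite last_rcons => pP xE pU; rewrite {}xE in pP pU.
exists p; split=> //; apply/allP => t tp.
have tv : t != v.
  move: pU; rewrite /= rcons_uniq => /and3P[_ vp _].
  by apply: contraNneq vp => <-.
have tp' : t \in rcons p v by rewrite mem_rcons inE tp orbT.
have [st v2] := path_inner pP pU (last_rcons _ _ _) tp' tv.
rewrite eqn_leq v2 andbT -ltnS ltnNge.
by apply: contraTN st => v3; apply: H; rewrite inE.
Qed.

Lemma valency2 f a b g : valency T f = 2%N -> edge T f a -> edge T f b ->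
  a != b -> edge T f g -> g != a -> g = b.
Proof.
rewrite /valency => f2 fa fb ab fg ga; apply/eqP/negPn/negP => gb.
suff : (3 <= 2)%N by [].
have c3 : #|[set g; a; b]%SET| = 3%N.
  by rewrite -finset.setUA cardsU1 cards2 ab !inE negb_or ga gb.
rewrite -[X in (_ <= X)%N]f2 -c3; apply: subset_leq_card; apply/fintype.subsetP => t.
by rewrite !inE -orbA => /or3P[]/eqP->.
Qed.

(** Along a chain of vertices of valency 2 a branch continues in only one way;
    t cannot be on the chain. *)
Lemma chain_branch p v w t : path (edge T) v (rcons p w) ->
  uniq (v :: rcons p w) -> all (fun u => valency T u == 2%N) p ->
  valency T t != 2%N ->
  t \in branch T v (head w p) -> t \in branch T (last v p) w.
Proof.
move=> + + + t2; elim: p v => [//|f p IHp] v /=.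
move=> /andP[vf pP] /andP[vN pU] /andP[f2 p2] tB; apply: IHp => //.
have tf : t != f by apply: contraNneq t2 => ->.
(* f has valency 2, so the branch continues to the next vertex of the chain. *)
have [g [fg gv tg]] := branch_split vf tB tf.
have fv : edge T f v by rewrite edge_sym.
have fh : edge T f (head w p) by case: (p) pP => [|? ?] /= /andP[].
have vh : v != head w p.
  apply: contraNneq vN => ->; rewrite inE.
  by case: (p) => [|? ?]; rewrite /= !inE eqxx ?orbT.
by rewrite -(valency2 (eqP f2) fv fh vh fg gv).
Qed.

(** If v and w both failed to cut t off from the other one, t would hang on the
    chain between v and w, which has no branching. *)
Lemma chain_sep v w t : orb_edge T v w -> t != v -> t != w ->
  valency T t != 2%N -> sep v t w \/ sep w t v.
Proof.
case/and3P => vN wN /asboolP[p [pP pU p2]] tv tw t2.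
have vw : v != w.
  by apply: contraTneq pU => ->; rewrite /= mem_rcons inE eqxx.
rewrite /sep tv tw vw eq_sym vw /=.
have [c1|] := boolP (conn T [set v]%SET t w); last by left.
have [c2|] := boolP (conn T [set w]%SET t v); last by right.
exfalso; move: pU; rewrite /= => /andP[vNp pU].
have vh : edge T v (head w p) by case: (p) pP => [|? ?] /= /andP[].
have th : t \in branch T v (head w p).
  rewrite inE conn_sym; apply: conn_trans c1 _; rewrite conn_sym.
  case: (p) pP vNp => [|f q] /=; first by rewrite /conn connect0.
  move=> /andP[_ qP] vNq; rewrite -[w in conn _ _ _ w](last_rcons f q).
  by apply: path_conn => // z zq; rewrite inE; apply: contraNneq vNq => <-.
have tl : t \in branch T (last v p) w.
  by apply: chain_branch th => //; rewrite /= vNp.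
move: pP; rewrite rcons_path => /andP[pP lw].
have wl : edge T w (last v p) by rewrite edge_sym.
have tl' : t \in branch T w (last v p).
  rewrite inE conn_sym; apply: conn_trans c2 _.
  apply: path_conn => // z zp; rewrite inE.
  move: pU; rewrite rcons_uniq => /andP[wp _].
  by move: zp; rewrite inE => /predU1P[->//|zp]; apply: contraNneq wp => <-.
have [g [wg gl tg]] := branch_split lw tl tw.
by move: gl; rewrite (branch_disjoint wg wl tg tl') eqxx.
Qed.

Lemma orb_edge_neq v w : orb_edge T v w -> v != w.
Proof.
case/and3P => _ _ /asboolP[p [_ + _]]; apply: contraTneq => ->.
by rewrite /= mem_rcons inE eqxx.
Qed.

Lemma orb_edge_nosep v w m : orb_edge T v w -> m \in nodes T -> ~~ sep m v w.
Proof.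
case/and3P => vN wN /asboolP[p [pP pU p2]] mN; apply/negP => /and3P[vm wm].
case/negP; rewrite -(last_rcons v p w); apply: path_conn => // t.
rewrite !inE mem_rcons inE => /or3P[/eqP->//|/eqP->//|tp].
apply: contraTneq mN => <-; rewrite inE -ltnNge.
by have := allP p2 t tp => /eqP->.
Qed.

Lemma orb_edgesP (I : {set 'I_n}) :
  reflect (exists v w, orb_edge T v w /\ I = [set v; w]%SET)
          (I \in orb_edges T).
Proof.
rewrite inE; apply: (iffP existsP) => -[v].
  by case/existsP => w /andP[vw /eqP->]; exists v, w.
by case=> w [vw ->]; exists v; apply/existsP; exists w; rewrite vw eqxx.
Qed.

Lemma orb_edge_sym v w : orb_edge T v w = orb_edge T w v.
Proof.
suff H a b : orb_edge T a b -> orb_edge T b a by apply/idP/idP; apply: H.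
move=> ab; case/and3P: (ab) => aN bN _.
apply: orb_edge_of_sep => //; first by rewrite eq_sym orb_edge_neq.
by move=> m mN; rewrite sep_sym; apply: orb_edge_nosep.
Qed.

Lemma separators_orb_edge I : I \in orb_edges T -> separators I = finset.set0.
Proof.
case/orb_edgesP => v [w [vw ->]]; apply/setP => m; rewrite [RHS]inE.
apply/negP => /separatorsP[mN [a [b [aI bI ab]]]].
have abN : a != b.
  by case/and3P: ab => _ _; apply: contraNneq => ->; apply: connect0.
have := orb_edge_nosep vw mN.
move: aI bI ab abN; rewrite !inE => /orP[]/eqP-> /orP[]/eqP->; rewrite ?eqxx //.
  by move=> ->.
by rewrite sep_sym => ->.
Qed.

(** Two elements u, v of U with no node between them form an orbifold edge, and
    a third element t would be cut off by u or by v, which would then be a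
    separator. *)
Lemma separators0_orb_edge (U : {set 'I_n}) : U \subset nodes T ->
  (1 < #|U|)%N -> separators U = finset.set0 -> U \in orb_edges T.
Proof.
move=> UN /card_gt1P[u [v [uU vU uv]]] I0.
have nosep m a b : m \in nodes T -> a \in U -> b \in U -> ~~ sep m a b.
  move=> mN aU bU; apply/negP => ab.
  suff : m \in separators U by rewrite I0 inE.
  by apply/separatorsP; split=> //; exists a, b.
have [uN vN] := (fintype.subsetP UN u uU, fintype.subsetP UN v vU).
have e : orb_edge T u v by apply: orb_edge_of_sep => // m mN; apply: nosep.
apply/orb_edgesP; exists u, v; split=> //; apply/eqP.
rewrite finset.eqEsubset; apply/andP; split; apply/fintype.subsetP => t; last first.
  by rewrite !inE => /orP[]/eqP->.
move=> tU; rewrite !inE; apply/negPn/negP; rewrite negb_or => /andP[tu tv].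
have t2 : valency T t != 2%N.
  by have := fintype.subsetP UN t tU; rewrite inE; apply: contraTneq => ->.
by case: (chain_sep e tu tv t2); apply/negP; apply: nosep.
Qed.

End Separation.

(** * The intersection form and the maximum principle *)

Section Form.
Variables (n : nat) (T : plumbing_tree n).
Implicit Types (u v w t s : 'I_n) (y z : 'rV[rat]_n).

Definition selfint t : rat := (intmx T t t)%:~R.

(** The coefficient of y on E*_t ([sum_cof]). It is written through the form
    because most arguments use its expression by the neighbours of t
    ([cof_edge]). *)
Definition cof y t : rat := - pairing T y (Evec t).

Lemma cof_intmx y t : cof y t = - \sum_s y 0 s * (intmx T s t)%:~R.
Proof.
rewrite /cof /pairing /Evec trmx_delta -colE !mxE; congr (- _).
by apply: eq_bigr => s _; rewrite !mxE.
Qed.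

Lemma cof_edge y t :
  cof y t = - selfint t * y 0 t - \sum_(s | edge T t s) y 0 s.
Proof.
rewrite cof_intmx (bigD1 t) //= opprD mulNr mulrC; congr (_ - _).
rewrite [RHS]big_mkcond [LHS]big_mkcond; apply: eq_bigr => s _.
case: eqVneq => [->|st] /=; first by rewrite edge_irrefl.
by rewrite intmx_offdiag // edge_sym; case: edge; rewrite ?mulr1 ?mulr0.
Qed.

Lemma cofD y z t : cof (y + z) t = cof y t + cof z t.
Proof. by rewrite /cof /pairing !mulmxDl mxE opprD. Qed.

Lemma cofN y t : cof (- y) t = - cof y t.
Proof. by rewrite /cof /pairing !mulNmx mxE. Qed.

Lemma cofB y z t : cof (y - z) t = cof y t - cof z t.
Proof. by rewrite cofD cofN. Qed.

Lemma cofZ c y t : cof (c *: y) t = c * cof y t.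
Proof.
rewrite !cof_intmx mulrN mulr_sumr; congr (- _).
by apply: eq_bigr => s _; rewrite mxE mulrA.
Qed.

Lemma cof_sum_Estar (a : 'I_n -> rat) t :
  cof (\sum_v a v *: Estar T v) t = a t.
Proof. exact: pairing_sum_Estar. Qed.

Lemma cof_Estar u t : cof (Estar T u) t = (u == t)%:R.
Proof. by rewrite /cof pairing_Estar opprK. Qed.

Lemma sum_cof y : y = \sum_t cof y t *: Estar T t.
Proof.
have E : y = - (y *m map_mx intr (intmx T)) *m - invmx (map_mx intr (intmx T)).
  by rewrite mulmxN mulNmx opprK mulmxK // intmx_unit.
rewrite {1}E mulmx_sum_row; apply: eq_bigr => t _; congr (_ *: _).
rewrite mxE cof_intmx mxE; congr (- _).
by apply: eq_bigr => s _; rewrite !mxE.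
Qed.

(** Clear denominators. *)
Lemma negdef_rat y : y != 0 -> 0 < \sum_t y 0 t * cof y t.
Proof.
move=> yN0.
pose d := \prod_v denq (y 0 v).
have d0 : d != 0 by apply/prodf_neq0 => v _; rewrite denq_neq0.
have [x xE] : exists x : 'rV[int]_n, d%:~R *: y = map_mx intr x.
  exists (\row_v (numq (y 0 v) * \prod_(u | u != v) denq (y 0 u))).
  apply/rowP => v; rewrite !mxE /d (bigD1 v) //= !rmorphM /=.
  by rewrite mulrAC mulrC [_%:~R * y 0 v]mulrC -numqE mulrC.
have xN0 : x != 0.
  apply: contraNneq yN0 => x0; move/eqP: xE.
  by rewrite x0 map_mx0 scaler_eq0 intr_eq0 (negPf d0).
have := intmx_negdef T xN0; rewrite -(ltr_int rat) -oppr_gt0 => H.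
have d2 : 0 < (d%:~R : rat) ^+ 2 by rewrite exprn_even_gt0 //= intr_eq0.
rewrite -(pmulr_rgt0 _ d2); apply: lt_le_trans H _.
rewrite le_eqVlt; apply/orP; left; apply/eqP.
rewrite !mxE rmorph_sum -sumrN mulr_sumr; apply: eq_bigr => t _.
rewrite cof_intmx !mxE rmorphM rmorph_sum /=.
have xv v : (x 0 v)%:~R = d%:~R * y 0 v :> rat.
  by have := congr1 (fun M : 'rV[rat]_n => M 0 v) xE; rewrite !mxE.
under eq_bigr do rewrite rmorphM /= xv -mulrA.
rewrite -mulr_sumr xv; ring.
Qed.

(** The negative part z of y satisfies z_t cof z t <= z_t cof y t <= 0 for all
    t, so it is zero by definiteness. *)
Lemma max_principle y :
  (forall t, y 0 t < 0 -> 0 <= cof y t) -> forall t, 0 <= y 0 t.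
Proof.
move=> H t; rewrite leNgt; apply/negP => yt.
pose z : 'rV[rat]_n := \row_s Num.min (y 0 s) 0.
have zN0 : z != 0.
  apply/eqP => /rowP/(_ t); rewrite !mxE.
  by move/eqP; rewrite minElt yt lt_eqF.
have := negdef_rat zN0; rewrite ltNge => /negP; apply.
apply: sumr_le0 => s _; rewrite [z 0 s]mxE.
case: (ltP (y 0 s) 0) => ys; last by rewrite mul0r.
apply: mulr_le0_ge0; first exact: ltW.
apply: le_trans (H s ys) _; rewrite !cof_edge lerB //.
  by rewrite mxE minElt ys.
by apply: ler_sum => r _; rewrite mxE ge_min lexx.
Qed.

Lemma cof_le0 y t : (forall s, 0 <= y 0 s) -> y 0 t = 0 -> cof y t <= 0.
Proof.
by move=> y0 yt; rewrite cof_edge yt mulr0 sub0r oppr_le0 sumr_ge0.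
Qed.

Lemma Estar_ge0 u v : 0 <= Estar T u 0 v.
Proof. by apply: max_principle => t _; rewrite cof_Estar ler0n. Qed.

(** A zero coordinate would force zero at all neighbours, hence everywhere by
    connectedness. *)
Lemma Estar_gt0 u v : 0 < Estar T u 0 v.
Proof.
rewrite lt_neqAle Estar_ge0 andbT eq_sym; apply/negP => /eqP uv0.
have H t : Estar T u 0 t = 0.
  have /connectP[p] := edge_connected T v t.
  elim: p v uv0 => [|s p IHp] v uv0 /=; first by move=> _ ->.
  case/andP => vs; apply: IHp.
  have := cof_edge (Estar T u) v; rewrite uv0 mulr0 sub0r => H.
  have /eqP : \sum_(s | edge T v s) Estar T u 0 s = 0.
    apply/eqP; rewrite eq_le sumr_ge0 ?andbT => [|i _]; last exact: Estar_ge0.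
    by rewrite -oppr_ge0 -H cof_Estar ler0n.
  rewrite psumr_eq0 => [/allP/(_ s)|i _]; last exact: Estar_ge0.
  by rewrite mem_index_enum vs /= => /(_ isT)/eqP.
have := cof_Estar u u; rewrite eqxx (_ : Estar T u = 0); last first.
  by apply/rowP => t; rewrite H mxE.
rewrite cof_intmx big1 ?oppr0 => [/eqP|i _]; last by rewrite mxE mul0r.
by rewrite eq_sym oner_eq0.
Qed.

Lemma Estar_sym u v : Estar T u 0 v = Estar T v 0 u.
Proof.
rewrite !mxE; congr (- _); set B := map_mx _ _.
have -> : invmx B u v = (invmx B)^T v u by rewrite mxE.
by rewrite trmx_inv /B map_trmx intmx_sym.
Qed.

(** Subtract from E_ww E*_u the multiple of E*_w that makes coordinate w zero.
    All coefficients of the difference other than the one on E*_w stay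
    nonnegative, and at w there is nothing to check for the maximum principle.
   *)
Lemma Estar_ineq u v w :
  Estar T u 0 w * Estar T w 0 v <= Estar T w 0 w * Estar T u 0 v.
Proof.
pose y := Estar T w 0 w *: Estar T u - Estar T u 0 w *: Estar T w.
have H : forall t, 0 <= y 0 t.
  apply: max_principle => t; have [<-|wt] := eqVneq w t.
    by rewrite /y !mxE mulrC subrr ltxx.
  move=> _; rewrite /y cofB !cofZ !cof_Estar (negPf wt) mulr0 subr0.
  by rewrite mulr_ge0 ?Estar_ge0 ?ler0n.
have := H v; have -> : y 0 v = Estar T w 0 w * Estar T u 0 v
    - Estar T u 0 w * Estar T w 0 v by rewrite !mxE.
by rewrite subr_ge0.
Qed.

(** In case of equality the nonnegative vector y below would vanish at v, and
    [cof_le0] contradicts its positive coefficient on E*_v. *)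
Lemma Estar_det v w : v != w ->
  Estar T v 0 w * Estar T w 0 v < Estar T v 0 v * Estar T w 0 w.
Proof.
move=> vw; rewrite lt_neqAle [X in _ <= X]mulrC Estar_ineq andbT.
apply/negP => /eqP E.
pose y := Estar T w 0 w *: Estar T v - Estar T v 0 w *: Estar T w.
have yE t : y 0 t = Estar T w 0 w * Estar T v 0 t - Estar T v 0 w * Estar T w 0 t.
  by rewrite /y !mxE.
have y0 t : 0 <= y 0 t by rewrite yE subr_ge0 Estar_ineq.
have := cof_le0 (t := v) y0; rewrite yE E mulrC subrr => /(_ erefl).
rewrite /y cofB !cofZ !cof_Estar eqxx eq_sym (negPf vw) mulr0 subr0 mulr1.
by rewrite leNgt Estar_gt0.
Qed.

(** E*_u minus the proportional multiple of E*_v vanishes at v, so cut to the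
    component of w it is harmonic there, and the maximum principle applies to
    it and to its opposite. *)
Lemma Estar_cut v u w : sep T v u w ->
  Estar T v 0 v * Estar T u 0 w = Estar T u 0 v * Estar T v 0 w.
Proof.
case/and3P => uv wv uw; apply/eqP; rewrite -subr_eq0.
pose y := Estar T v 0 v *: Estar T u - Estar T u 0 v *: Estar T v.
have yE t : y 0 t = Estar T v 0 v * Estar T u 0 t - Estar T u 0 v * Estar T v 0 t.
  by rewrite /y !mxE.
have yv : y 0 v = 0 by rewrite yE mulrC subrr.
(* The part of y on the component of w; since y_v = 0, its coefficients there
   are those of y. *)
pose z : 'rV[rat]_n := \row_t (if conn T [set v]%SET w t then y 0 t else 0).
have vD : ~~ conn T [set v]%SET w v.
  by apply/negP => /conn_notin /(_ wv); rewrite inE eqxx.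
have cz t : conn T [set v]%SET w t -> cof z t = 0.
  move=> wt; have tv : t != v by apply: contraTneq wt => ->.
  have -> : cof z t = cof y t.
    rewrite !cof_edge mxE wt; congr (_ - _); apply: eq_bigr => s ts.
    rewrite mxE; case: ifP => // /negbT ws.
    have [->|sv] := eqVneq s v; first by rewrite yv.
    case/negP: ws; apply: conn_trans wt _.
    by apply: conn_edge; rewrite ?inE.
  rewrite /y cofB !cofZ !cof_Estar [v == t]eq_sym (negPf tv).
  have [ut|_] := eqVneq u t; last by rewrite !mulr0 subrr.
  by case/negP: uw; rewrite conn_sym ut.
have z_out t : ~~ conn T [set v]%SET w t -> z 0 t = 0.
  by move=> /negPf wt; rewrite mxE wt.
have z0 t : 0 <= z 0 t.
  apply: max_principle => s; have [ws|/z_out->] := boolP (conn T [set v]%SET w s).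
    by rewrite cz.
  by rewrite ltxx.
have z1 t : 0 <= (- z) 0 t.
  apply: max_principle => s; have [ws|/z_out zs] := boolP (conn T [set v]%SET w s).
    by rewrite cofN cz ?oppr0.
  by rewrite mxE zs oppr0 ltxx.
rewrite -yE (_ : y 0 w = z 0 w); last by rewrite [z 0 w]mxE /conn connect0.
by rewrite eq_le z0 andbT -oppr_ge0; have := z1 w; rewrite mxE.
Qed.

(** The maximum principle gives weak negativity. At a zero, the coefficient on
    E*_t would be a sum of nonnegative terms. *)
Lemma neg_inside (K : {set 'I_n}) y :
  (forall t, t \in K -> cof y t < 0) ->
  (forall t s, t \in K -> edge T t s -> s \notin K -> y 0 s <= 0) ->
  forall t, t \in K -> y 0 t < 0.
Proof.
move=> Kc Kb.
pose z : 'rV[rat]_n := \row_t (if t \in K then - y 0 t else 0).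
have z0 : forall t, 0 <= z 0 t.
  apply: max_principle => t; rewrite mxE; case: ifP => tK; last by rewrite ltxx.
  move=> _; apply: le_trans (_ : - cof y t <= _); first by rewrite oppr_ge0 ltW ?Kc.
  rewrite !cof_edge mxE tK opprB addrC mulrN lerD2l lerNr -sumrN; apply: ler_sum.
  move=> s ts; rewrite mxE; case: ifPn => sK //.
  by rewrite oppr_ge0; apply: Kb ts sK.
have yle t : t \in K -> y 0 t <= 0.
  by move=> tK; have := z0 t; rewrite mxE tK oppr_ge0.
move=> t tK; rewrite lt_neqAle yle // andbT; apply/negP => /eqP yt.
have := Kc t tK; rewrite cof_edge yt mulr0 sub0r ltNge => /negP; apply.
rewrite oppr_ge0; apply: sumr_le0 => s ts.
by have [sK|sK] := boolP (s \in K); [apply: yle | apply: Kb ts sK].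
Qed.

Lemma selfint_neg t : exists k, intmx T t t = - (k.+1)%:Z.
Proof.
have e0 : intmx T t t < 0.
  have := @intmx_negdef _ T (delta_mx 0 t).
  rewrite trmx_delta -rowE -colE !mxE; apply.
  by apply/eqP => /rowP/(_ t); rewrite !mxE !eqxx.
by case: (intmx T t t) e0 => // k _; exists k; rewrite NegzE.
Qed.

End Form.

(** * Divisibility in a commutative ring *)

Section Dvd.
Variable A : comPzRingType.
Implicit Types a b c d r : A.

Definition dvd a b := exists c, b = c * a.

Lemma dvd_mul a b c d : dvd a b -> dvd c d -> dvd (a * c) (b * d).
Proof. by move=> [r ->] [s ->]; exists (r * s); rewrite mulrACA. Qed.

Lemma dvd_mulr a b c : dvd a b -> dvd a (c * b).
Proof. by move=> [r ->]; exists (c * r); rewrite mulrA. Qed.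

Lemma dvd_add a b c : dvd a b -> dvd a c -> dvd a (b + c).
Proof. by move=> [r ->] [s ->]; exists (r + s); rewrite mulrDl. Qed.

Lemma dvd_refl a : dvd a a.
Proof. by exists 1; rewrite mul1r. Qed.

Lemma dvd_1 a : dvd 1 a.
Proof. by exists a; rewrite mulr1. Qed.

Lemma dvd_prod (I : finType) (P : pred I) (F G : I -> A) :
  (forall i, P i -> dvd (F i) (G i)) ->
  dvd (\prod_(i | P i) F i) (\prod_(i | P i) G i).
Proof. by apply: big_ind2 => [|*]; [apply: dvd_1 | apply: dvd_mul]. Qed.

Lemma dvd_1subX d r a k : dvd d ((1 - a) * r) -> dvd d ((1 - a ^+ k) * r).
Proof.
move=> H; rewrite -opprB subrX1 -mulNr opprB mulrAC mulrC.
exact: dvd_mulr.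
Qed.

(** The elements a such that d divides (1 - a) r are closed under products,
    since 1 - a b = (1 - a) + a (1 - b). *)
Lemma dvd_1sub_prod (I : finType) (P : pred I) (F : I -> A) d r :
  (forall i, P i -> dvd d ((1 - F i) * r)) ->
  dvd d ((1 - \prod_(i | P i) F i) * r).
Proof.
move=> H; elim/big_rec: _ => [|i a Pi IH].
  by rewrite subrr mul0r; exists 0; rewrite mul0r.
rewrite (_ : _ * r = (1 - F i) * r + F i * ((1 - a) * r)); last first.
  by rewrite mulrA -mulrDl mulrBr mulr1 addrA subrK.
apply: dvd_add; first exact: H.
exact: dvd_mulr.
Qed.

End Dvd.

(** * Divisibility along the component of a separator *)

Section Divisibility.
Variables (n : nat) (T : plumbing_tree n) (A : comPzRingType).
Variables (x xi : 'I_n -> A) (U : {set 'I_n}) (m : 'I_n).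
Hypothesis xiK : forall u, xi u * x u = 1.
Hypothesis rel_x : forall w, w \notin U -> w != m ->
  exists k, \prod_(t | edge T w t) x t = x w ^+ k.
Hypothesis mU : m \notin U.

Definition component : {set 'I_n} := [set u | conn T U m u]%SET.
Local Notation K := component.

(** The factor of a vertex of valency at least 2; truncated subtraction makes
    it 1 at an end. *)
Definition num u := if u \in K then (1 - x u) ^+ (valency T u - 2) else 1.
Definition den u := if (u \in K) && (valency T u == 1%N) then 1 - x u else 1.

Lemma component_notin u : u \in K -> u \notin U.
Proof.
rewrite inE => mu; have [<-//|um] := eqVneq m u.
exact: conn_notin mu um.
Qed.

Lemma component_edge u v : u \in K -> edge T u v -> v \notin U -> v \in K.
Proof.
move=> uK uv vU; have uU := component_notin uK; move: uK; rewrite !inE => mu.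
by apply: conn_trans mu _; apply: conn_edge.
Qed.

Lemma component_root : m \in K.
Proof. by rewrite inE /conn connect0. Qed.

(** A path from m into the branch has to pass through f. *)
Lemma branch_blocked v f : edge T v f -> m \notin branch T v f -> f \in U ->
  forall u, u \in branch T v f -> u \notin K.
Proof.
move=> vf mB fU u uB; apply/negP => uK.
have [uf|uf] := eqVneq u f.
  by have := component_notin uK; rewrite uf fU.
have mu : conn T [set f]%SET m u.
  by move: uK; rewrite inE; apply: conn_mono => t; rewrite inE => /eqP->.
have [g [fg gv ug]] := branch_split vf uB uf.
have mf : m != f by apply: contraNneq mB => ->; apply: branch_self.
have fv : edge T f v by rewrite edge_sym.
have fv0 : f != v by have := edge_neq fv.
have cvm : conn T [set f]%SET v m.
  have [->|mv] := eqVneq m v; first exact: connect0.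
  rewrite eq_sym in fv0.
  have [//|c] := @conn_exchange _ T v f m mv mf fv0.
  by move: mB; rewrite inE c.
have := tree_branch fg fv gv; rewrite (conn_trans _ (_ : conn T _ m v)) //.
  move: ug; rewrite inE => ug; apply: conn_trans ug _.
  by rewrite conn_sym.
by rewrite conn_sym.
Qed.

Lemma valency_parent v f : edge T v f ->
  valency T f = #|[pred g | edge T f g && (g != v)]|.+1.
Proof.
move=> vf; rewrite /valency (cardsD1 v) inE edge_sym vf add1n; congr _.+1.
by apply: eq_card => g; rewrite !inE andbC.
Qed.

Lemma expr_prod (I : finType) (P : pred I) (a : A) (F : I -> A) :
  a ^+ #|P| * \prod_(i | P i) F i = \prod_(i | P i) (a * F i).
Proof. by rewrite big_split /= prodr_const. Qed.

(** Induction on the branch. Suppose first that it does not meet U. By the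
    relation at f, x_v times the product of the x_g over the children g of f is
    a power of x_f, so 1 - x_v is in the ideal generated by 1 - x_f and the 1 -
    x_g. The vertex f has one factor 1 - x_f less than it has children, and by
    induction each child branch is settled by one extra factor, either 1 - x_f
    or 1 - x_g: a further 1 - x_f serves all children, while 1 - x_g serves the
    child g and leaves enough factors 1 - x_f for the others.

    If the branch meets U and f is not in U, some child branch meets U and
    needs no extra factor, and the factors at f serve the others. *)
Lemma branch_dvd v f : edge T v f -> v \in K -> m \notin branch T v f ->
  let den_ := \prod_(u in branch T v f) den u in
  let num_ := \prod_(u in branch T v f) num u in
  if [disjoint branch T v f & U]
  then dvd den_ ((1 - x v) * num_) /\ dvd den_ ((1 - x f) * num_)
  else dvd den_ num_.
Proof.
have [k] := ubnP #|branch T v f|; elim: k v f => // k IHk v f lek vf vK mB /=.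
have fv : edge T f v by rewrite edge_sym.
have [fU|fU] := boolP (f \in U).
  rewrite ifF; last first.
    by apply/negbTE/pred0Pn; exists f; rewrite /= fU branch_self.
  rewrite big1 => [|u uB]; last by rewrite /den (negPf (branch_blocked vf mB fU uB)).
  exact: dvd_1.
have fK : f \in K by apply: component_edge vf fU.
pose ch := [pred g | edge T f g && (g != v)].
have chP g : ch g -> [/\ edge T f g, g != v & branch T f g \subset branch T v f].
  move=> /andP[fg gv]; split=> //; apply/fintype.subsetP => u uB.
  by have [] := branch_child vf fg gv uB.
have IHc g : ch g ->
  let den_ := \prod_(u in branch T f g) den u in
  let num_ := \prod_(u in branch T f g) num u in
  if [disjoint branch T f g & U]
  then dvd den_ ((1 - x f) * num_) /\ dvd den_ ((1 - x g) * num_)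
  else dvd den_ num_.
  move=> cg; have [fg gv sB] := chP g cg; apply: IHk => //; last first.
    by apply: contra mB => /(fintype.subsetP sB).
  rewrite -ltnS; apply: leq_trans lek; rewrite ltnS; apply: proper_card.
  apply/properP; split=> //; exists f; first exact: branch_self.
  exact: branch_root.
have dvf g : ch g -> dvd (\prod_(u in branch T f g) den u)
    ((1 - x f) * \prod_(u in branch T f g) num u).
  by move=> /IHc /=; case: ifP => _ => [[]|/(dvd_mulr (1 - x f))].
have val_f := valency_parent vf.
rewrite !big_branch //=.
set DD := \prod_(g | _) _; set NN := \prod_(g | _) _.
have dv2 : dvd DD ((1 - x f) ^+ #|ch| * NN).
  by rewrite expr_prod; apply: dvd_prod.
have [k0|k0] := posnP #|ch|.
  have ch0 g : ch g = false by exact: card0_eq k0 g.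
  have D1 : DD = 1 by rewrite /DD big_pred0.
  have N1 : NN = 1 by rewrite /NN big_pred0.
  have denf : den f = 1 - x f by rewrite /den fK val_f k0.
  have numf : num f = 1 by rewrite /num fK val_f k0 expr0.
  rewrite D1 N1 denf numf !mulr1.
  rewrite ifT; last first.
    apply/pred0P => u /=; apply/negP => /andP[uB uU].
    have uf : u != f by apply: contraNneq fU => <-.
    have [g [fg gv _]] := branch_split vf uB uf.
    by have := ch0 g; rewrite /= fg gv.
  split; last exact: dvd_refl.
  have fm : f != m by apply: contraNneq mB => <-; apply: branch_self.
  have [j] := rel_x fU fm; rewrite (bigD1 v) //= big1 => [|g]; last first.
    by move=> cg; have := ch0 g; rewrite /= cg.
  rewrite mulr1 => ->; rewrite -[1 - x f ^+ j]mulr1; apply: dvd_1subX.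
  by rewrite mulr1; apply: dvd_refl.
have denf : den f = 1.
  by rewrite /den val_f eqSS -leqn0 leqNgt k0 andbF.
have numf : num f = (1 - x f) ^+ #|ch|.-1.
  by rewrite /num fK val_f subSS subn1.
have Xs : (1 - x f) ^+ #|ch| = (1 - x f) * (1 - x f) ^+ #|ch|.-1.
  by rewrite -exprS prednK.
rewrite denf numf mul1r.
(* The factors 1 - x_f are distributed among the children other than g0. *)
have pick g0 (F : 'I_n -> A) : ch g0 ->
    (1 - x f) ^+ #|ch|.-1 * \prod_(g | ch g) F g =
    F g0 * \prod_(g | ch g && (g != g0)) ((1 - x f) * F g).
  move=> cg0; rewrite -(expr_prod [pred g | ch g && (g != g0)]).
  rewrite (bigD1 g0) //= mulrCA; congr (_ * (_ ^+ _ * _)).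
  rewrite (cardD1 g0) (_ : g0 \in ch) //=; apply: eq_card => g; rewrite !inE.
  by rewrite andbC.
have dvd_pick g0 (a : A) : ch g0 ->
    dvd (\prod_(u in branch T f g0) den u) (a * \prod_(u in branch T f g0) num u) ->
    dvd DD (a * ((1 - x f) ^+ #|ch|.-1 * NN)).
  move=> cg0 H; rewrite (pick g0) // mulrA /DD (bigD1 g0) //=.
  apply: dvd_mul => //; apply: dvd_prod => g /andP[cg _].
  exact: dvf.
case: ifPn => [dis|ndis].
  split; last by rewrite mulrA -Xs.
  have fm : f != m by apply: contraNneq mB => <-; apply: branch_self.
  have [j] := rel_x fU fm; rewrite (bigD1 v) //=.
  rewrite (eq_bigl ch) // => relf.
  set R := _ * NN.
  pose Y := \prod_(g | ch g) x g; pose Yi := \prod_(g | ch g) xi g.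
  have YK : Yi * Y = 1 by rewrite -big_split big1 // => g _; apply: xiK.
  (* A factor 1 - x_g settles the branch of g, leaving all 1 - x_f to the
     others. *)
  have dY : dvd DD ((1 - Y) * R).
    apply: dvd_1sub_prod => g cg; apply: (dvd_pick g) => //.
    have := IHc g cg => /=; rewrite ifT; first by case.
    have [_ _ sB] := chP g cg.
    by apply: disjointWl dis.
  (* With one more 1 - x_f there is one for each child. *)
  have dX : dvd DD ((1 - x f ^+ j) * R).
    by apply: dvd_1subX; rewrite /R mulrA -Xs.
  rewrite (_ : (1 - x v) * R =
      Yi * ((1 - x f ^+ j) * R + (- 1) * ((1 - Y) * R))); last first.
    have -> : 1 - x v = Yi * (Y - x f ^+ j).
      by rewrite -relf mulrBr YK mulrCA YK mulr1.
    by rewrite mulN1r -mulNr -mulrDl opprB [1 - _ + _]addrC addrA subrK -[LHS]mulrA.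
  by apply: dvd_mulr; apply: dvd_add dX _; apply: dvd_mulr.
have [u /andP[uB uU]] := pred0Pn ndis.
have uf : u != f by apply: contraNneq fU => <-.
have [g0 [fg0 g0v ug0]] := branch_split vf uB uf.
have cg0 : ch g0 by rewrite /= fg0 g0v.
have := dvd_pick g0 1 cg0; rewrite !mul1r; apply.
have := IHc g0 cg0 => /=; rewrite ifF //.
by apply/negbTE/pred0Pn; exists u; rewrite /= ug0.
Qed.

(** Two elements of U separated by m lie in two branches at m, which need no
    extra factor. The valency m - 2 factors 1 - x_m serve the other branches,
    one each. *)
Lemma component_dvd : m \in separators T U ->
  dvd (\prod_u den u) (\prod_u num u).
Proof.
case/separatorsP=> + [a [b [aU bU /and3P[am bm ab]]]]; rewrite inE => mN.
have [f0 mf0 af0] := root_split T am.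
have [f1 mf1 bf1] := root_split T bm.
have f01 : f0 != f1.
  apply: contraNneq ab => f01; rewrite -{}f01 in bf1.
  move: af0 bf1; rewrite !inE => af0; apply: conn_trans.
  by rewrite conn_sym.
have dB f : edge T m f ->
  let den_ := \prod_(u in branch T m f) den u in
  let num_ := \prod_(u in branch T m f) num u in
  if [disjoint branch T m f & U]
  then dvd den_ ((1 - x m) * num_) /\ dvd den_ ((1 - x f) * num_)
  else dvd den_ num_.
  by move=> mf; apply: branch_dvd => //; [apply: component_root|apply: branch_root].
have dm f : edge T m f -> dvd (\prod_(u in branch T m f) den u)
    ((1 - x m) * \prod_(u in branch T m f) num u).
  by move=> /dB /=; case: ifP => _ => [[]|/(dvd_mulr (1 - x m))].
have dU f u : edge T m f -> u \in U -> u \in branch T m f ->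
    dvd (\prod_(u in branch T m f) den u) (\prod_(u in branch T m f) num u).
  move=> mf uU uB; have := dB f mf => /=; rewrite ifF //.
  by apply/negbTE/pred0Pn; exists u; rewrite /= uB.
rewrite !(@big_root _ T _ _ _ _ m) /=.
have -> : den m = 1.
  by rewrite /den [valency T m == _]gtn_eqF ?andbF // ltnW.
have -> : num m = (1 - x m) ^+ (valency T m - 2)%N by rewrite /num component_root.
rewrite mul1r.
have P1 : edge T m f1 && (f1 != f0) by rewrite mf1 eq_sym.
rewrite (bigD1 f0) //= (bigD1 f1 P1) /=.
rewrite [in X in dvd _ X](bigD1 f0) //= [in X in dvd _ X](bigD1 f1 P1) /=.
pose P := [pred i | edge T m i && (i != f0) && (i != f1)].
have cP : #|P| = (valency T m - 2)%N.
  rewrite /valency (cardsD1 f0) (cardsD1 f1) !inE mf0 mf1 eq_sym f01 /=.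
  rewrite addnA addKn; apply: eq_card => g.
  by rewrite !inE /= andbC [edge _ _ _ && _]andbC.
rewrite [X in dvd _ X]mulrCA; apply: dvd_mul; first exact: (dU f0 a).
rewrite [X in dvd _ X]mulrCA; apply: dvd_mul; first exact: (dU f1 b).
rewrite -cP expr_prod; apply: dvd_prod => g /andP[/andP[mg _] _].
exact: dm.
Qed.

End Divisibility.

(** * The ring of translation operators on periodic functions *)

Section ShiftRing.
Variables (G : zmodType) (W : G -> Prop).
Implicit Types (f : G -> int) (P Q : seq (int * G)) (g l : G).

Definition periodic f := forall w, W w -> forall l, f (l + w) = f l.

(** The action of the formal sum of the c.1 [c.2]. *)
Definition lshift P f : G -> int := fun l => \sum_(c <- P) c.1 * f (l + c.2).

(** Sending non-periodic functions to 0 makes equality of operators the same as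
    equality of their actions on periodic functions. In particular translations
    by elements of W become equal to 1. *)
Definition shift_op P f : G -> int :=
  if `[< periodic f >] then lshift P f else fun=> 0.

Lemma lshift_periodic P f : periodic f -> periodic (lshift P f).
Proof.
move=> fP w Ww l; apply: eq_bigr => c _.
by rewrite addrAC (fP w Ww).
Qed.

Lemma lshift_comp P Q f :
  lshift P (lshift Q f) =
  lshift [seq (p.1 * q.1, p.2 + q.2) | p <- P, q <- Q] f.
Proof.
apply/funext => l; rewrite /lshift big_allpairs_dep /=.
apply: eq_bigr => p _; rewrite mulr_sumr; apply: eq_bigr => q _ /=.
by rewrite mulrA addrA.
Qed.

Lemma shift_op_comp P Q f :
  shift_op P (shift_op Q f) =
  shift_op [seq (p.1 * q.1, p.2 + q.2) | p <- P, q <- Q] f.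
Proof.
rewrite {2 3}/shift_op; case: asboolP => fP.
  by rewrite /shift_op asboolT ?lshift_comp //; apply: lshift_periodic.
apply/funext => l; rewrite /shift_op; case: ifP => // _.
by apply: big1 => c _; rewrite mulr0.
Qed.

(** The group ring of the quotient of G by the subgroup generated by W,
    realised by its faithful action on W-periodic functions, so that no
    quotient has to be formed. The formal sum is only asserted to exist, since
    it is not unique. *)
Record shiftring :=
  ShiftOp { sop :> (G -> int) -> G -> int; sopP : exists P, sop = shift_op P }.

Lemma shiftring_eq (a b : shiftring) : sop a = sop b -> a = b.
Proof.
case: a b => [a aP] [b bP] /= E; case: _ / E in bP *.
by rewrite (Prop_irrelevance aP bP).
Qed.

HB.instance Definition _ := gen_eqMixin shiftring.
HB.instance Definition _ := gen_choiceMixin shiftring.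

Definition mk_shift P := @ShiftOp (shift_op P) (ex_intro _ P erefl).

Lemma shift_add_subproof (a b : shiftring) :
  exists P, (fun f l => a f l + b f l) = shift_op P.
Proof.
have [[P ->] [Q ->]] := (sopP a, sopP b); exists (P ++ Q).
apply/funext => f; apply/funext => l; rewrite /shift_op.
by case: ifP => _; rewrite ?addr0 // /lshift big_cat.
Qed.

Lemma shift_opp_subproof (a : shiftring) :
  exists P, (fun f l => - a f l) = shift_op P.
Proof.
have [P ->] := sopP a; exists [seq (- c.1, c.2) | c <- P].
apply/funext => f; apply/funext => l; rewrite /shift_op.
case: ifP => _; rewrite ?oppr0 // /lshift big_map -sumrN.
by apply: eq_bigr => c _; rewrite mulNr.
Qed.

Lemma shift_mul_subproof (a b : shiftring) :
  exists P, (fun f => a (b f)) = shift_op P.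
Proof.
have [[P ->] [Q ->]] := (sopP a, sopP b).
by eexists; apply/funext => f; rewrite shift_op_comp.
Qed.

Definition shift_add a b := ShiftOp (shift_add_subproof a b).
Definition shift_opp a := ShiftOp (shift_opp_subproof a).
Definition shift_mul a b := ShiftOp (shift_mul_subproof a b).
Definition shift_zero := mk_shift [::].
Definition shift_one := mk_shift [:: (1, 0)].

Lemma shift_zeroE f l : shift_zero f l = 0.
Proof. by rewrite /= /shift_op; case: ifP; rewrite /lshift ?big_nil. Qed.

Lemma shift_addA : associative shift_add.
Proof.
move=> a b c; apply: shiftring_eq; apply/funext => f; apply/funext => l /=.
exact: addrA.
Qed.

Lemma shift_addC : commutative shift_add.
Proof.
move=> a b; apply: shiftring_eq; apply/funext => f; apply/funext => l /=.
exact: addrC.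
Qed.

Lemma shift_add0 : left_id shift_zero shift_add.
Proof.
move=> a; apply: shiftring_eq; apply/funext => f; apply/funext => l.
by have := shift_zeroE f l; rewrite /= => ->; rewrite add0r.
Qed.

Lemma shift_addN : left_inverse shift_zero shift_opp shift_add.
Proof.
move=> a; apply: shiftring_eq; apply/funext => f; apply/funext => l.
by have := shift_zeroE f l; rewrite /= => ->; rewrite addNr.
Qed.

HB.instance Definition _ := GRing.isZmodule.Build shiftring
  shift_addA shift_addC shift_add0 shift_addN.

Lemma shift_mulA : associative shift_mul.
Proof. by move=> a b c; apply: shiftring_eq. Qed.

Lemma shift_mulC : commutative shift_mul.
Proof.
move=> a b; apply: shiftring_eq; apply/funext => f /=.
have [[P ->] [Q ->]] := (sopP a, sopP b); rewrite !shift_op_comp.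
rewrite /shift_op; case: ifP => // _; apply/funext => l; rewrite /lshift.
rewrite !big_allpairs_dep exchange_big /=; apply: eq_bigr => p _.
by apply: eq_bigr => q _; rewrite /= [q.1 * _]mulrC [q.2 + _]addrC.
Qed.

Lemma shift_mul1 : left_id shift_one shift_mul.
Proof.
move=> a; apply: shiftring_eq; apply/funext => f; rewrite /shift_mul /=.
have [P ->] := sopP a; rewrite shift_op_comp /shift_op.
case: ifP => // _; apply/funext => l; rewrite /lshift big_allpairs_dep big_seq1.
by apply: eq_bigr => c _; rewrite mul1r add0r.
Qed.

Lemma shift_mulD : left_distributive shift_mul shift_add.
Proof. by move=> a b c; apply: shiftring_eq. Qed.

HB.instance Definition _ := GRing.Zmodule_isComPzRing.Build shiftring
  shift_mulA shift_mulC shift_mul1 shift_mulD.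

Definition shift g : shiftring := mk_shift [:: (1, g)].

Lemma shiftE g f l : periodic f -> shift g f l = f (l + g).
Proof. by move=> fP; rewrite /= /shift_op asboolT // /lshift big_seq1 mul1r. Qed.

Lemma shift_mulE (a b : shiftring) f : (a * b) f = a (b f).
Proof. by []. Qed.

Lemma sop_periodic (a : shiftring) f : periodic f -> periodic (a f).
Proof.
by have [P ->] := sopP a => fP; rewrite /shift_op asboolT //; apply: lshift_periodic.
Qed.

Lemma shift_mull g (a : shiftring) f l : periodic f ->
  (shift g * a) f l = a f (l + g).
Proof. by move=> fP; rewrite shift_mulE shiftE //; apply: sop_periodic. Qed.

(** All operators vanish on the other functions. *)
Lemma eq_shiftring (a b : shiftring) :
  (forall f, periodic f -> a f =1 b f) -> a = b.
Proof.
move=> H; apply: shiftring_eq; apply/funext => f; apply/funext => l.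
have [[P aE] [Q bE]] := (sopP a, sopP b).
have [fP|fP] := pselect (periodic f); first exact: H.
by rewrite aE bE /shift_op asboolF.
Qed.

Lemma shiftD g h : shift (g + h) = shift g * shift h.
Proof.
by apply: eq_shiftring => f fP l; rewrite shift_mull // !shiftE // addrA.
Qed.

Lemma shift0 : shift 0 = 1. Proof. by []. Qed.

Lemma shift_period w : W w -> shift w = 1.
Proof.
by move=> Ww; apply: eq_shiftring => f fP l; rewrite -shift0 !shiftE // addr0 (fP w Ww).
Qed.

Lemma shift_sum I (r : seq I) (Q : pred I) (F : I -> G) :
  shift (\sum_(i <- r | Q i) F i) = \prod_(i <- r | Q i) shift (F i).
Proof. exact: (big_morph shift shiftD shift0). Qed.

Lemma shiftMn g k : shift (g *+ k) = shift g ^+ k.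
Proof. by rewrite -[k]card_ord -sumr_const shift_sum prodr_const. Qed.

Lemma sopD (a b : shiftring) f l : (a + b) f l = a f l + b f l.
Proof. by []. Qed.

Lemma sopN (a : shiftring) f l : (- a) f l = - a f l.
Proof. by []. Qed.

Lemma sop0 f l : (0 : shiftring) f l = 0.
Proof. exact: shift_zeroE. Qed.

Lemma sop_sum I (r : seq I) (Q : pred I) (F : I -> shiftring) f l :
  (\sum_(i <- r | Q i) F i) f l = \sum_(i <- r | Q i) F i f l.
Proof. by apply: (big_morph (fun a : shiftring => a f l)) => //; apply: sop0. Qed.

Lemma sopMz (a : shiftring) (c : int) f l : (a *~ c) f l = c * a f l.
Proof.
have H (k : nat) : (a *+ k) f l = k%:Z * a f l.
  elim: k => [|k IHk]; first by rewrite mulr0n sop0 mul0r.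
  by rewrite mulrS sopD IHk intS mulrDl mul1r.
case: c => k; first exact: H.
by rewrite NegzE mulrNz sopN mulNr -H.
Qed.

(** An operator is a finite sum of translations, so finitely many translation
    vectors have to be kept under control when a truncation bound is chosen. *)
Lemma sop_finite (a : shiftring) : exists P,
  forall f, periodic f -> forall l, a f l = \sum_(c <- P) c.1 * f (l + c.2).
Proof.
by have [P ->] := sopP a; exists P => f fP l; rewrite /shift_op asboolT.
Qed.

End ShiftRing.

(** * Properties of all large natural numbers *)

Section Eventually.

Definition eventually (P : nat -> Prop) := exists N0, forall N, (N0 <= N)%N -> P N.

Lemma eventually_and (P Q : nat -> Prop) : eventually P -> eventually Q -> eventually (fun N => P N /\ Q N).
Proof.
move=> [N0 H0] [N1 H1]; exists (maxn N0 N1) => N.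
by rewrite geq_max => /andP[/H0 ? /H1 ?].
Qed.

Lemma eventually_imp (P Q : nat -> Prop) : (forall N, P N -> Q N) -> eventually P -> eventually Q.
Proof. by move=> PQ [N0 H]; exists N0 => N /H/PQ. Qed.

Lemma eventually_seq (I : eqType) (s : seq I) (P : I -> nat -> Prop) :
  (forall i, i \in s -> eventually (P i)) -> eventually (fun N => forall i, i \in s -> P i N).
Proof.
elim: s => [|i s IHs] H; first by exists 0%N.
have H1 := H i (mem_head _ _).
have H2 := IHs (fun j js => H j (@mem_behead _ (i :: s) j js)).
apply: eventually_imp (eventually_and H1 H2) => N [Pi Ps] j.
by rewrite inE => /predU1P[->|/Ps].
Qed.

Lemma eventually_fin (I : finType) (P : I -> nat -> Prop) :
  (forall i, eventually (P i)) -> eventually (fun N => forall i, P i N).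
Proof.
move=> H; apply: eventually_imp (@eventually_seq _ (enum I) P (fun i _ => H i)) => N HN i.
by apply: HN; rewrite mem_enum.
Qed.

Lemma eventually_ge M : eventually (fun N => M <= N)%N.
Proof. by exists M. Qed.

Lemma eventually_arch (F : archiRealFieldType) (q e : F) : 0 < e -> eventually (fun N => q <= N%:R * e).
Proof.
move=> e0; exists (Num.bound `|q / e|) => N leN.
rewrite -ler_pdivrMr //; apply: le_trans (_ : (Num.bound `|q / e|)%:R <= _).
  by apply: ltW; apply: le_lt_trans (ler_norm _) _; apply: archi_boundP.
by rewrite ler_nat.
Qed.

End Eventually.

(** * Taylor coefficients of powers of 1 - z *)

Section TCoef.

Arguments tcoef : simpl never.

Lemma tcoefE d k : tcoef (Posz d) k = (-1) ^+ k *+ 'C(d, k).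
Proof.
rewrite /tcoef exprBn coef_sum.
have E (i : 'I_d.+1) : ((-1) ^+ i * 1 ^+ (d - i) * 'X ^+ i *+ 'C(d, i) : {poly int})`_k
    = (if k == i then (-1) ^+ k *+ 'C(d, k) else 0) .
  rewrite expr1n mulr1 coefMn.
  have -> : ((-1) ^+ i : {poly int}) = ((-1) ^+ i)%:P.
    by rewrite rmorphXn rmorphN1.
  rewrite coefCM coefXn; case: eqVneq => [->|_]; first by rewrite mulr1.
  by rewrite mulr0 mul0rn.
under eq_bigr do rewrite E.
have [kd|kd] := ltnP k d.+1.
  rewrite (bigD1 (Ordinal kd)) //= eqxx big1 ?addr0 // => i ik.
  by rewrite ifN // eq_sym; apply: contraNneq ik => H; apply/eqP/val_inj.
rewrite big1 => [|i _]; first by rewrite bin_small ?mulr0n.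
by rewrite ifN // gtn_eqF // (leq_trans (ltn_ord i)).
Qed.

Lemma tcoef_gt d k : (d < k)%N -> tcoef (Posz d) k = 0.
Proof. by move=> dk; rewrite tcoefE bin_small ?mulr0n. Qed.

Lemma sum_tcoef (A : comPzRingType) (a : A) d N : (d < N)%N ->
  \sum_(k < N) a ^+ k *~ tcoef (Posz d) k = (1 - a) ^+ d.
Proof.
move=> dN; rewrite exprBn -(big_mkord xpredT (fun k => a ^+ k *~ tcoef (Posz d) k)).
rewrite (big_cat_nat (n := d.+1)) //= [X in _ + X]big_nat_cond.
rewrite [X in _ + X]big1 ?addr0 => [|k /andP[/andP[dk _] _]]; last first.
  by rewrite tcoef_gt ?mulr0z.
rewrite big_mkord; apply: eq_bigr => k _.
rewrite expr1n mulr1 tcoefE -mulrzr rmorphMn rmorphXn rmorphN1 /= mulrC.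
by rewrite -mulrnAl.
Qed.

End TCoef.

(** * Truncated Taylor expansions *)

Section Box.
Variables (n : nat) (T : plumbing_tree n).
Implicit Types (u v w t : 'I_n) (l : 'rV[rat]_n).

Definition vcoef u k : int := tcoef ((valency T u)%:Z - 2) k.

Lemma vcoef_end u k : valency T u = 1%N -> vcoef u k = 1.
Proof. by rewrite /vcoef => ->; rewrite (_ : _ - _ = Negz 0) //= add0n binn. Qed.

Lemma vcoef_inner u : (2 <= valency T u)%N -> vcoef u =1 tcoef (Posz (valency T u - 2)).
Proof. by move=> u2 k; rewrite /vcoef -subzn. Qed.

(** The truncated lattice points: all sums over the lattice are replaced by
    sums over the cube of coefficients less than N, for N large. *)
Definition boxpt N (a : {ffun 'I_n -> 'I_N}) : 'rV[rat]_n :=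
  \sum_u Estar T u *+ a u.

Lemma boxpt_sum N (a : {ffun 'I_n -> 'I_N}) :
  boxpt a = \sum_u (a u)%:R *: Estar T u.
Proof. by apply: eq_bigr => u _; rewrite scaler_nat. Qed.

Lemma cof_boxpt N (a : {ffun 'I_n -> 'I_N}) t : cof T (boxpt a) t = (a t)%:R.
Proof. by rewrite boxpt_sum cof_sum_Estar. Qed.

Lemma boxptE N (a : {ffun 'I_n -> 'I_N}) v :
  boxpt a 0 v = \sum_u (a u)%:R * Estar T u 0 v.
Proof. by rewrite boxpt_sum summxE; apply: eq_bigr => u _; rewrite mxE. Qed.

Lemma boxpt_ge0 N (a : {ffun 'I_n -> 'I_N}) v : 0 <= boxpt a 0 v.
Proof. by rewrite boxptE sumr_ge0 // => u _; rewrite mulr_ge0 ?ler0n ?Estar_ge0. Qed.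

Variable W : 'rV[rat]_n -> Prop.
Local Notation sR := (shiftring W).
(** Translation by E*_u stands for the monomial t^(E*_u). *)
Definition xshift u : sR := shift W (Estar T u).

(** Applying a product of truncated series to a function is summing the
    function against the product of the coefficients. *)
Lemma box_expand (c : 'I_n -> nat -> int) N (f : 'rV[rat]_n -> int) l :
  periodic W f ->
  (\prod_u \sum_(k < N) xshift u ^+ k *~ c u k) f l =
  \sum_(a : {ffun 'I_n -> 'I_N}) (\prod_u c u (a u)) * f (l + boxpt a).
Proof.
move=> fP; rewrite bigA_distr_bigA sop_sum; apply: eq_bigr => a _.
have -> : \prod_u (xshift u ^+ a u *~ c u (a u)) =
          shift W (boxpt a) *~ (\prod_u c u (a u)).
  rewrite -mulrzr rmorph_prod shift_sum -big_split /=.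
  by apply: eq_bigr => u _; rewrite -mulrzr shiftMn.
by rewrite sopMz shiftE.
Qed.

Lemma prod_1sub (A : comPzRingType) (I : finType) (E : {set I}) (y : I -> A) :
  \prod_(i in E) (1 - y i) =
  \sum_(D : {set I} | D \subset E) (-1) ^+ #|D| * \prod_(i in D) y i.
Proof.
rewrite big_mkcond /=.
under eq_bigr => i _.
  rewrite (_ : (if i \in E then _ else _) = (if i \in E then - y i else 0) + 1); last first.
    by case: ifP; rewrite ?add0r // addrC.
  over.
rewrite bigA_distr [RHS]big_mkcond /=; apply: eq_bigr => D _.
rewrite -big_mkcond /=.
case: ifPn => DE.
  rewrite -prodrN; apply: eq_bigr => i iD.
  by rewrite (fintype.subsetP DE).
have /fintype.subsetPn[i iD /negPf iE] := DE.
by rewrite (bigD1 i) //= iE mul0r.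
Qed.

End Box.

(** * Relations between translations by dual vectors *)

Section Relations.
Variables (n : nat) (T : plumbing_tree n).
Implicit Types (u v w t : 'I_n).

(** For the vertices outside P the coordinates are observed, those in P are
    free. *)
Definition periods (P : pred 'I_n) (w : 'rV[rat]_n) : Prop :=
  latticeL w /\ forall t, ~~ P t -> w 0 t = 0.

Lemma Evec_lattice t : latticeL (Evec t : 'rV[rat]_n).
Proof. by move=> s; rewrite !mxE natr_int. Qed.

Lemma Evec_period (P : pred 'I_n) t : P t -> periods P (Evec t).
Proof.
move=> Pt; split; first exact: Evec_lattice.
move=> s Ps; rewrite !mxE eqxx /=; case: eqVneq => // st.
by rewrite st Pt in Ps.
Qed.

Lemma periods_lattice (h l : 'rV[rat]_n) (P : pred 'I_n) (w : 'rV[rat]_n) : periods P w ->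
  `[< latticeL (l + w - h) >] = `[< latticeL (l - h) >].
Proof.
move=> [wL _]; apply/asboolP/asboolP => H t.
  have := H t; rewrite addrAC mxE => Ht.
  by rewrite -[X in X \is a _](addrK (w 0 t)) rpredB.
by have := H t; rewrite addrAC [X in _ -> X \is a _]mxE => Ht; rewrite rpredD.
Qed.

(** The expansion of E_w in the dual basis, with the negative diagonal term
    moved to the other side. *)
Lemma Evec_Estar w k : intmx T w w = - k%:Z ->
  Evec w + \sum_(t | edge T w t) Estar T t = Estar T w *+ k.
Proof.
move=> wk; rewrite {1}(sum_cof T (Evec w)).
have cE t : cof T (Evec w) t = - (intmx T w t)%:~R.
  rewrite cof_intmx (bigD1 w) //= big1 ?addr0 => [|s sw].
    by rewrite !mxE !eqxx mul1r.
  by rewrite !mxE eqxx (negPf sw) mul0r.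
rewrite (bigD1 w) //= cE wk mulrNz opprK scaler_nat -addrA.
rewrite -[RHS]addr0; congr (_ + _).
rewrite [X in _ + X]big_mkcond /= [X in _ + X](bigD1 w) //= edge_irrefl add0r.
rewrite -big_split big1 //= => t tw; rewrite cE intmx_offdiag 1?eq_sym //.
by case: edge; rewrite ?oppr0 ?scale0r ?addr0 // scaleN1r addNr.
Qed.

Lemma xshift_relation (P : pred 'I_n) w : P w ->
  exists k, \prod_(t | edge T w t) xshift T (periods P) t = xshift T (periods P) w ^+ k.
Proof.
move=> Pw; have [k wk] := selfint_neg T w; exists k.+1.
rewrite -shiftMn -(Evec_Estar wk) shiftD shift_period ?mul1r ?shift_sum //.
exact: Evec_period.
Qed.

Lemma valency_gt0 u v : u != v -> (0 < valency T u)%N.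
Proof.
move=> uv; have [p [pP pL pU]] := tree_path T u v.
case: p pP pL {pU} => [|s p] /=; first by move=> _ E; rewrite E eqxx in uv.
by move=> /andP[us _] _; apply/card_gt0P; exists s; rewrite inE.
Qed.

End Relations.

(** * The vanishing sums *)

Section Cancellation.
Variables (n : nat) (T : plumbing_tree n) (h x : 'rV[rat]_n).
Hypothesis x_deep : forall t, (valency T t)%:R - 2 < cof T x t.
Implicit Types (u v w t : 'I_n) (U : {set 'I_n}).

Variables (U : {set 'I_n}) (m : 'I_n).
Hypotheses (mU : m \notin U) (mI : m \in separators T U).

Let mN : m \in nodes T. Proof. by case/separatorsP: mI. Qed.

(** What is left of the products of the s_v after pairing U with U and m. *)
Definition event (l : 'rV[rat]_n) : bool :=
  [&& `[< latticeL (l - h) >], [forall (u | u \in U), l 0 u < x 0 u]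
    & x 0 m <= l 0 m].

Let free : pred 'I_n := fun t => (t \notin U) && (t != m).
Let W := periods free.
Let f l : int := (event l)%:R.
Local Notation sR := (shiftring W).
Local Notation X := (xshift T W).
Local Notation K := (component T U m).

Lemma event_periodic : periodic W f.
Proof.
move=> w Ww l; rewrite /f /event (periods_lattice _ _ Ww); congr (_%:R).
have wE t : ~~ free t -> (l + w) 0 t = l 0 t.
  by move=> Ft; rewrite mxE (Ww.2 t Ft) addr0.
rewrite wE ?negb_and ?eqxx ?orbT //; congr (nat_of_bool [&& _, _ & _]).
by apply: eq_forallb_in => u uU; rewrite wE // negb_and negbK uU.
Qed.

Let ends : {set 'I_n} := [set u in K | valency T u == 1%N]%SET.

Lemma valency_cases t : valency T t = 1%N \/ (2 <= valency T t)%N.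
Proof.
have : (0 < valency T t)%N.
  have [->|tm] := eqVneq t m; last exact: valency_gt0 tm.
  by move: mN; rewrite inE => /(leq_trans _); apply.
by case: (valency T t) => [|[|k]] // _; [left|right].
Qed.

Lemma in_ends u : (u \in ends) = (u \in K) && (valency T u == 1%N).
Proof. by rewrite !inE. Qed.

(** The Taylor coefficients at the vertices of K, and those of the constant 1
    elsewhere; [coef_out] is the complementary factor. *)
Definition coef_in u k : int := if u \in K then vcoef T u k else (k == 0%N)%:R.
Definition coef_out u k : int := if u \in K then (k == 0%N)%:R else vcoef T u k.

Lemma sum_delta (A : comPzRingType) (a : A) N : (0 < N)%N ->
  \sum_(k < N) a ^+ k *~ (nat_of_ord k == 0%N)%:R = 1.
Proof.
by case: N => // N _; rewrite big_ord_recl /= expr0 big1 ?addr0 ?mulr1z.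
Qed.

Lemma coef_split N : (0 < N)%N ->
  \prod_u \sum_(k < N) X u ^+ k *~ vcoef T u k =
  (\prod_u \sum_(k < N) X u ^+ k *~ coef_out u k) *
  (\prod_u \sum_(k < N) X u ^+ k *~ coef_in u k) :> sR.
Proof.
move=> N0; rewrite -[RHS]big_split; apply: eq_bigr => u _ /=.
by rewrite /coef_out /coef_in; case: (u \in K); rewrite (sum_delta (X u) N0) ?mul1r ?mulr1.
Qed.

(** At an inner vertex the Taylor series is a polynomial, completely contained
    in the truncation; at an end it is the geometric series. *)
Lemma coef_in_num N : (n < N)%N ->
  \prod_u \sum_(k < N) X u ^+ k *~ coef_in u k =
  (\prod_u num T X U m u) * \prod_(u in ends) \sum_(k < N) X u ^+ k :> sR.
Proof.
move=> nN; rewrite [X in _ = _ * X]big_mkcond -big_split; apply: eq_bigr => u _ /=.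
rewrite /coef_in /num in_ends; case: (u \in K); last first.
  by rewrite (sum_delta (X u) (leq_ltn_trans (leq0n n) nN)) /= mulr1.
rewrite /=; case: (valency_cases u) => [u1|u2].
  rewrite u1 eqxx expr0 mul1r; apply: eq_bigr => k _.
  by rewrite vcoef_end.
rewrite ifF ?mulr1; last by rewrite gtn_eqF.
under eq_bigr do rewrite vcoef_inner //.
rewrite sum_tcoef // (leq_ltn_trans (leq_subr _ _)) //.
apply: leq_ltn_trans nN; rewrite /valency -[X in (_ <= X)%N](card_ord n).
exact: max_card.
Qed.

Lemma geometric (A : comPzRingType) (a : A) N :
  (1 - a) * \sum_(k < N) a ^+ k = 1 - a ^+ N.
Proof. by rewrite -[1 - a ^+ N]opprB subrX1 -mulNr opprB. Qed.

(** With P the quotient given by [component_dvd], multiplying the truncated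
    geometric series by the 1 - x_u gives the product of the 1 - x_u ^ N over
    the ends u in K. The important point is that P does not depend on N: the
    term with D empty is the Laurent polynomial P, the others are P moved far
    away. *)
Lemma coef_in_poly : exists P : sR, forall N, (n < N)%N ->
  \prod_u \sum_(k < N) X u ^+ k *~ coef_in u k =
  \sum_(D : {set 'I_n} | D \subset ends)
     P * shift W (\sum_(u in D) Estar T u *+ N) *~ ((-1) ^+ #|D|).
Proof.
have XiK u : shift W (- Estar T u) * X u = 1.
  by rewrite -shiftD addNr shift0.
have relX w : w \notin U -> w != m ->
    exists k, \prod_(t | edge T w t) X t = X w ^+ k.
  by move=> wU wm; apply: xshift_relation; rewrite /free wU wm.
have [P PE] := component_dvd XiK relX mU mI.
exists P => N nN; rewrite coef_in_num // PE -mulrA.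
have -> : \prod_u den T X U m u = \prod_(u in ends) (1 - X u).
  by rewrite [RHS]big_mkcond; apply: eq_bigr => u _; rewrite /den in_ends.
rewrite -big_split /=; under eq_bigr do rewrite geometric.
rewrite prod_1sub mulr_sumr; apply: eq_bigr => D _.
rewrite shift_sum -mulrzr rmorphXn rmorphN1 mulrAC -mulrA; congr (_ * _).
by congr (_ * _); apply: eq_bigr => u _; rewrite shiftMn.
Qed.

Lemma coef_out_zero N (a : {ffun 'I_n -> 'I_N}) t : \prod_u coef_out u (a u) != 0 ->
  t \in K -> a t = 0%N :> nat.
Proof.
move=> + tK; rewrite (bigD1 t) //= /coef_out tK.
by case: (eqVneq (nat_of_ord (a t)) 0%N) => // _; rewrite mul0r eqxx.
Qed.

(** The terms of the expansion at infinity of the ends in K: their coefficients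
    at ends are moved from k >= 0 to k - M < 0. Then l - x has negative
    coefficients on all of K and is negative on the part of U adjacent to K, so
    it is negative at m. *)
Lemma flipped_vanish N (a : {ffun 'I_n -> 'I_N}) M (b' : {ffun 'I_n -> 'I_M}) :
  \prod_u coef_out u (a u) != 0 -> \prod_u coef_in u (b' u) != 0 ->
  f (boxpt T a - \sum_(u in ends) Estar T u *+ M + boxpt T b') = 0.
Proof.
move=> aB bK; rewrite /f; case: (boolP (event _)) => // /and3P[_ lU lm].
set l := _ + boxpt T b' in lU lm *.
have bK' t : vcoef T t (b' t) != 0 \/ t \notin K /\ (b' t = 0%N :> nat).
  have : coef_in t (b' t) != 0.
    by apply: contraNneq bK => E; rewrite (bigD1 t) //= E mul0r.
  rewrite /coef_in; case: ifP => tK; first by left.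
  by case: (eqVneq (nat_of_ord (b' t)) 0%N) => // E _; right; rewrite negbT.
have cl t : t \in K -> cof T (l - x) t < 0.
  move=> tK; rewrite cofB cofD cofB !cof_boxpt (coef_out_zero aB tK) sub0r.
  have -> : cof T (\sum_(u in ends) Estar T u *+ M) t =
            if t \in ends then M%:R else 0.
    rewrite (_ : \sum_(u in ends) _ =
       \sum_u (if u \in ends then M%:R else 0) *: Estar T u); last first.
      rewrite big_mkcond; apply: eq_bigr => u _; case: ifP => _.
        by rewrite scaler_nat.
      by rewrite scale0r.
    by rewrite cof_sum_Estar.
  case: (bK' t) => [vN0|[]]; last by rewrite tK.
  have xt := x_deep t; rewrite in_ends tK /=.
  (* At an end the shift by - M makes the coefficient negative, and that of x
     is larger than -1; at the others the coefficient is at most valency t - 2,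
     which is less than that of x. *)
  case: (valency_cases t) => [t1|t2].
    rewrite t1 eqxx; have := ltn_ord (b' t); rewrite -(ler_nat rat) => bM.
    by rewrite t1 in xt; rewrite -natr1 in bM; lra.
  rewrite ifF ?oppr0 ?add0r; last by rewrite gtn_eqF.
  rewrite subr_lt0; apply: le_lt_trans xt.
  rewrite -natrB // ler_nat leqNgt; apply: contra vN0 => bt.
  by rewrite vcoef_inner // tcoef_gt.
have bd t s : t \in K -> edge T t s -> s \notin K -> (l - x) 0 s <= 0.
  move=> tK ts sK; have sU : s \in U.
    by apply/negPn/negP => sU; case/negP: sK; apply: component_edge tK ts sU.
  have := forall_inP lU s sU => ls.
  by rewrite mxE [X in _ + X]mxE subr_le0 ltW.
have := neg_inside cl bd (component_root T U m).
by rewrite mxE [X in _ + X]mxE subr_lt0 ltNge lm.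
Qed.

Lemma event_forward s (l : 'rV[rat]_n) : s \in U -> x 0 s <= l 0 s -> f l = 0.
Proof.
move=> sU ls; rewrite /f; case: (boolP (event l)) => // /and3P[_ /forall_inP H _].
by have := H s sU; rewrite ltNge ls.
Qed.

Lemma event_backward (l : 'rV[rat]_n) : l 0 m < x 0 m -> f l = 0.
Proof. by move=> lm; rewrite /f /event leNgt lm !andbF. Qed.

(** In [coef_in_poly] evaluated at the base point moved by - M E*_u for all
    ends u in K, the term of D = ends is P at the original point, and in all
    others some end pushes the coordinate m below x_m. The left hand side is
    the expansion at infinity, which vanishes. *)
Lemma coef_in_zero P N (a : {ffun 'I_n -> 'I_N}) :
  (forall M, (n < M)%N ->
    \prod_u \sum_(k < M) X u ^+ k *~ coef_in u k =
    \sum_(D : {set 'I_n} | D \subset ends)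
       P * shift W (\sum_(u in D) Estar T u *+ M) *~ ((-1) ^+ #|D|)) ->
  \prod_u coef_out u (a u) != 0 -> (P : sR) f (boxpt T a) = 0.
Proof.
move=> HP aB; have [L LE] := sop_finite P.
have fP := event_periodic.
(* M is so large that a shift by - M at one end alone moves the m-coordinate of
   every translate in P below x_m. *)
have [M [nM HM]] : exists M, (n < M)%N /\ forall c u, c \in L ->
    (boxpt T a + c.2) 0 m - x 0 m + 1 <= M%:R * Estar T u 0 m.
  have [M H] : eventually (fun M => (n < M)%N /\ forall c, c \in L -> forall u,
      (boxpt T a + c.2) 0 m - x 0 m + 1 <= M%:R * Estar T u 0 m).
    apply: eventually_and; first exact: eventually_ge.
    apply: eventually_seq => c _; apply: eventually_fin => u.
    by apply: eventually_arch; apply: Estar_gt0.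
  by exists M; have [? H'] := H M (leqnn M); split=> // c u cL; apply: H'.
pose l0 : 'rV[rat]_n := \sum_(u in ends) Estar T u *+ M.
have E0 : (\prod_u \sum_(k < M) X u ^+ k *~ coef_in u k : sR) f
    (boxpt T a - l0) = 0.
  rewrite box_expand //; apply: big1 => b _.
  have [->|bK] := eqVneq (\prod_u coef_in u (b u)) 0; first by rewrite mul0r.
  by rewrite flipped_vanish ?mulr0.
have E1 (D : {set 'I_n}) : D \subset ends -> D != ends ->
    P f (boxpt T a - l0 + \sum_(u in D) Estar T u *+ M) = 0.
  move=> DE DnE; rewrite LE //; apply: big1_seq => c /andP[_ cL].
  rewrite event_backward ?mulr0 //.
  have [u uE uD] : exists2 u, u \in ends & u \notin D.
    apply/fintype.subsetPn; apply: contra DnE => ED.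
    by rewrite finset.eqEsubset DE.
  have -> : boxpt T a - l0 + \sum_(u in D) Estar T u *+ M + c.2 =
            boxpt T a + c.2 - \sum_(u in ends :\: D) Estar T u *+ M.
    have -> : l0 = \sum_(u in D) Estar T u *+ M
                 + \sum_(u in ends :\: D) Estar T u *+ M.
      by rewrite /l0 (big_setID D) /= (finset.setIidPr DE).
    by rewrite opprD addrA [_ - _ - _]addrAC subrK addrAC.
  set B := boxpt T a + c.2; set S := \sum_(u in _) _.
  have -> : (B - S) 0 m = B 0 m - S 0 m by rewrite mxE [X in _ + X]mxE.
  have -> : S 0 m = \sum_(i in ends :\: D) M%:R * Estar T i 0 m.
    by rewrite summxE; apply: eq_bigr => i _; rewrite -scaler_nat [LHS]mxE.
  rewrite (bigD1 u) ?finset.in_setD ?uD ?uE //=.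
  have Hc : B 0 m - x 0 m + 1 <= M%:R * Estar T u 0 m := HM c u cL.
  have S0 : 0 <= \sum_(i in ends :\: D | i != u) M%:R * Estar T i 0 m.
    by apply: sumr_ge0 => i _; rewrite mulr_ge0 ?ler0n ?Estar_ge0.
  lra.
move: E0; rewrite HP // sop_sum (bigD1 ends) //= [X in _ + X]big1 => [|D /andP[DE DnE]].
  rewrite addr0 sopMz mulrC [P * _]mulrC shift_mull // -/l0 addrNK.
  move/eqP; rewrite mulf_eq0 => /orP[/eqP//|].
  by rewrite signr_eq0.
by rewrite sopMz [P * _]mulrC shift_mull // E1 ?mulr0.
Qed.

(** By [coef_in_poly] the sum is P, applied after the part outside K, plus
    terms in which some x_u ^ N pushes the coordinate of an element of U above
    the bound. P gives 0 by [coef_in_zero]. *)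
Theorem cancellation : eventually (fun N =>
  \sum_(a : {ffun 'I_n -> 'I_N}) (\prod_u vcoef T u (a u)) * f (boxpt T a) = 0).
Proof.
have fP := event_periodic.
have [P HP] := coef_in_poly.
have [L LE] := sop_finite P.
have [s sU] : exists s, s \in U.
  by case/separatorsP: mI => _ [s [_ [sU _ _]]]; exists s.
(* N is so large that a shift by N at one end alone moves the s-coordinate
   above x_s. *)
have : eventually (fun N => (n < N)%N /\ forall c, c \in L -> forall u,
    x 0 s - c.2 0 s <= N%:R * Estar T u 0 s).
  apply: eventually_and; first exact: eventually_ge.
  apply: eventually_seq => c _; apply: eventually_fin => u.
  by apply: eventually_arch; apply: Estar_gt0.
apply: eventually_imp => N [nN HN].
have := box_expand T (vcoef T) N 0 fP; under [in RHS]eq_bigr do rewrite add0r.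
move=> <-; rewrite coef_split ?(leq_ltn_trans _ nN) // shift_mulE.
rewrite box_expand; last exact: sop_periodic.
apply: big1 => a _; rewrite add0r.
have [->|aB] := eqVneq (\prod_u coef_out u (a u)) 0; first by rewrite mul0r.
rewrite HP // sop_sum [X in _ * X]big1 ?mulr0 // => D DE.
rewrite sopMz [P * _]mulrC shift_mull //.
have [->|[u uD]] := set_0Vmem D.
  by rewrite finset.big_set0 addr0 (coef_in_zero HP aB) mulr0.
rewrite LE // big1_seq ?mulr0 // => c /andP[_ cL].
rewrite (event_forward sU) ?mulr0 //.
set S := \sum_(u in _) _.
have -> : (boxpt T a + S + c.2) 0 s = boxpt T a 0 s + S 0 s + c.2 0 s.
  by rewrite mxE [X in X + _]mxE.
have -> : S 0 s = \sum_(i in D) N%:R * Estar T i 0 s.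
  by rewrite summxE; apply: eq_bigr => i _; rewrite -scaler_nat [LHS]mxE.
rewrite (bigD1 u) //=.
have Hc := HN c cL u; have a0 := boxpt_ge0 T a s.
have S0 : 0 <= \sum_(i in D | i != u) N%:R * Estar T i 0 s.
  by apply: sumr_ge0 => i _; rewrite mulr_ge0 ?ler0n ?Estar_ge0.
lra.
Qed.

End Cancellation.

(** * Counting functions as truncated sums *)

Section CountingBox.
Variables (n : nat) (T : plumbing_tree n).
Implicit Types (u v w t : 'I_n) (l y : 'rV[rat]_n).

Lemma pairing_Estarl u y : pairing T (Estar T u) y = - y 0 u.
Proof.
rewrite /pairing /Estar -row_mul mulNmx mulVmx ?intmx_unit //.
rewrite -row_mul mulNmx mul1mx.
have -> : (row u (- y^T)) 0 0 = (- y^T) u 0 by rewrite mxE.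
by rewrite mxE mxE.
Qed.

Lemma latticeL'P l : latticeL' T l <-> forall t, cof T l t \is a Num.int.
Proof.
split=> [H t|H y yL].
  by rewrite rpredN; apply: H; apply: Evec_lattice.
rewrite (sum_cof T l) /pairing !mulmx_suml summxE rpred_sum // => t _.
rewrite -!scalemxAl mxE rpredM //.
have := pairing_Estarl t y; rewrite /pairing => ->.
by rewrite rpredN; apply: yL.
Qed.

Lemma boxpt_latticeL' N (a : {ffun 'I_n -> 'I_N}) : latticeL' T (boxpt T a).
Proof. by apply/latticeL'P => t; rewrite cof_boxpt natr_int. Qed.

Lemma boxpt_inj N : injective (@boxpt n T N).
Proof.
move=> a b ab; apply/ffunP => u; apply/val_inj/eqP => /=.
by rewrite -(eqr_nat rat) -!(cof_boxpt T) ab.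
Qed.

Lemma pcoef_boxpt N (a : {ffun 'I_n -> 'I_N}) :
  pcoef T (boxpt T a) = \prod_u vcoef T u (a u).
Proof. by rewrite boxpt_sum (pcoef_Estar T (fun u => nat_of_ord (a u))). Qed.

Lemma pcoef_support l : pcoef T l != 0 ->
  exists b : 'I_n -> nat, l = \sum_u (b u)%:R *: Estar T u.
Proof.
rewrite /pcoef; case: ifP => [/forallP H _|_]; last by rewrite eqxx.
exists (fun u => Num.truncn (cof T l u)); rewrite {1}(sum_cof T l).
by apply: eq_bigr => u _; rewrite (truncnK (H u)).
Qed.

(** Boolean form of the condition in the counting function. *)
Definition below (I : {set 'I_n}) (x l : 'rV[rat]_n) : bool :=
  [exists (v | v \in I), l 0 v < x 0 v].

Lemma belowP I x l : reflect (~ le_coord (proj I x) (proj I l)) (below I x l).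
Proof.
apply: (iffP exists_inP) => [[v vI lx] /(_ v)|H].
  by rewrite !mxE vI leNgt lx.
apply: contrapT => N; apply: H => v; rewrite !mxE; case: ifP => // vI.
by rewrite leNgt; apply/negP => lx; apply: N; exists v.
Qed.

(** All coordinates of all E*_u are positive, so a bound on one coordinate
    bounds all coefficients. *)
Lemma box_bound (x : 'rV[rat]_n) : eventually (fun N => forall v (b : 'I_n -> nat),
  ((\sum_u (b u)%:R *: Estar T u : 'rV[rat]_n) 0 v < x 0 v) -> forall u, (b u < N)%N).
Proof.
have : eventually (fun N => forall v u, x 0 v <= N%:R * Estar T u 0 v).
  by apply: eventually_fin => v; apply: eventually_fin => u; apply: eventually_arch; apply: Estar_gt0.
apply: eventually_imp => N HN v b lx u; rewrite ltnNge; apply/negP => Nb.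
move: lx; rewrite ltNge => /negP; apply; apply: le_trans (HN v u) _.
rewrite summxE (bigD1 u) //= [X in _ <= X + _]mxE -[X in X <= _]addr0 lerD //.
  by rewrite ler_wpM2r ?Estar_ge0 // ler_nat.
by apply: sumr_ge0 => i _; rewrite mxE mulr_ge0 ?ler0n ?Estar_ge0.
Qed.

Lemma counting_box (h x : 'rV[rat]_n) : eventually (fun N => forall I : {set 'I_n},
  counting T h I x =
  \sum_(a : {ffun 'I_n -> 'I_N}) (\prod_u vcoef T u (a u)) *
     (`[< latticeL (boxpt T a - h) >] && below I x (boxpt T a))%:R).
Proof.
apply: eventually_imp (box_bound x) => N HN I.
pose c (a : {ffun 'I_n -> 'I_N}) :=
  `[< latticeL (boxpt T a - h) >] && below I x (boxpt T a).
pose r := [seq boxpt T a | a <- index_enum {ffun 'I_n -> 'I_N} & c a].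
have rU : uniq r.
  by rewrite map_inj_uniq ?filter_uniq ?index_enum_uniq //; apply: boxpt_inj.
rewrite /counting (@fsbigE _ _ _ _ _ r) //; first last.
- move=> l [lL' lL /belowP lb] lr; apply/eqP; apply: contraNT lr => p0.
  have [b lE] := pcoef_support p0; have [v vI lx] := exists_inP lb.
  have bN u : (b u < N)%N by apply: (HN v); rewrite -lE.
  have lE' : l = boxpt T [ffun u => Ordinal (bN u)].
    by rewrite lE boxpt_sum; apply: eq_bigr => u _; rewrite ffunE.
  apply/mapP; exists [ffun u => Ordinal (bN u)] => //.
  by rewrite mem_filter mem_index_enum andbT /c -lE' lb andbT; apply/asboolP.
- move=> l /= /mapP[a]; rewrite mem_filter => /andP[/andP[/asboolP aL ab] _] ->.
  by split=> //; [apply: boxpt_latticeL'|apply/belowP].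
rewrite big_map big_filter_cond /= big_mkcond [RHS](bigID c) /=.
rewrite [X in _ = _ + X]big1 ?addr0 => [|a /negPf]; last first.
  by rewrite /c => ->; rewrite mulr0.
rewrite -big_mkcond /=.
rewrite (eq_bigl c) => [|a]; last first.
  rewrite andb_idr // => /andP[/asboolP aL ab]; rewrite inE /=.
  by split=> //; [apply: boxpt_latticeL'|apply/belowP].
by apply: eq_bigr => a; rewrite /c => ->; rewrite mulr1 pcoef_boxpt.
Qed.

End CountingBox.

(** * Inclusion-exclusion over sets of nodes *)

Section InclusionExclusion.
Variables (n : nat) (T : plumbing_tree n).
Implicit Types (u v w t : 'I_n) (U I : {set 'I_n}).
Variable s : 'I_n -> bool.
Local Notation sg U := ((-1) ^+ #|U| * \prod_(v in U) (s v)%:R : int).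

Lemma exists_prod I :
  [exists (v | v \in I), s v]%:R = 1 - \prod_(v in I) (1 - (s v)%:R) :> int.
Proof.
case: exists_inP => [[v vI sv]|N].
  by rewrite (bigD1 v) //= sv subrr mul0r subr0.
rewrite big1 ?subrr // => v vI; case: (boolP (s v)) => [sv|]; rewrite ?subr0 //.
by case: N; exists v.
Qed.

Lemma sum_sets1 (F : {set 'I_n} -> int) I :
  \sum_(U : {set 'I_n} | (U \subset I) && (#|U| == 1%N)) F U =
  \sum_(v in I) F [set v]%SET.
Proof.
transitivity (\sum_(v in I) \sum_(U : {set 'I_n} | U == [set v]%SET) F U); last first.
  by apply: eq_bigr => v _; rewrite big_pred1_eq.
rewrite (exchange_big_dep (fun U : {set 'I_n} => (U \subset I) && (#|U| == 1%N))) /=.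
  apply: eq_bigr => U /andP[UI /cards1P[v UE]]; rewrite UE in UI *.
  rewrite (big_pred1 v) // => w /=; rewrite (inj_eq (@finset.set1_inj _)) eq_sym.
  by rewrite finset.sub1set in UI; case: eqVneq => [->|_]; rewrite ?andbF ?UI.
by move=> v U vI /eqP->; rewrite finset.sub1set vI cards1.
Qed.

Lemma sum_sets_split (F : {set 'I_n} -> int) I :
  \sum_(U : {set 'I_n} | U \subset I) F U =
  F finset.set0 + \sum_(v in I) F [set v]%SET
  + \sum_(U : {set 'I_n} | (U \subset I) && (1 < #|U|)%N) F U.
Proof.
rewrite (bigD1 finset.set0) ?finset.sub0set //= -addrA; congr (_ + _).
rewrite (bigID (fun U : {set 'I_n} => #|U| == 1%N)) /= -sum_sets1.
have E (U : {set 'I_n}) : U != finset.set0 = (0 < #|U|)%N.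
  by rewrite -cards_eq0 lt0n.
congr (_ + _); apply: eq_bigl => U; rewrite E -andbA.
  by case: eqP => [->|]; rewrite ?andbF ?andbT.
by congr (_ && _); case: #|U| => [|[|k]].
Qed.

Lemma exists_edge I : I \in orb_edges T ->
  [exists (v | v \in I), s v]%:R = \sum_(v in I) (s v)%:R - sg I :> int.
Proof.
move=> /orb_edgesP[v [w [vw ->]]].
have vw0 := orb_edge_neq vw.
have vN : v \notin [set w]%SET by rewrite inE.
rewrite exists_prod !(big_setU1 _ vN) !big_set1 cards2 vw0.
by case: (s v); case: (s w).
Qed.

(** Double counting of the flags of a node in an orbifold edge. *)
Lemma sum_orb_valency (F : 'I_n -> int) :
  \sum_(I in orb_edges T) \sum_(v in I) F v =
  \sum_(v in nodes T) (orb_valency T v)%:Z * F v.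
Proof.
rewrite (exchange_big_dep (mem (nodes T))) /=; last first.
  move=> I v /orb_edgesP[a [b [ab ->]]]; case/and3P: (ab) => aN bN _.
  by case/finset.set2P => ->.
apply: eq_bigr => v vN; rewrite sumr_const -mulr_natl natz; congr (Posz _ * _).
rewrite /orb_valency -(card_in_imset (f := fun w => [set v; w]%SET)); last first.
  move=> a b; rewrite !inE => va vb /setP/(_ a); rewrite !inE eqxx orbT.
  by move/esym/orP => [/eqP E|/eqP//]; have := orb_edge_neq va; rewrite E eqxx.
apply: eq_card => I; apply/andP/imsetP => [[/orb_edgesP[a [b [ab ->]]]]|[w]].
  case/finset.set2P => ->; first by exists b; rewrite ?inE.
  by exists a; rewrite ?inE 1?orb_edge_sym // finset.setUC.
rewrite inE => vw ->; split; last by rewrite !inE eqxx.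
by apply/orb_edgesP; exists v, w.
Qed.

(** The products are expanded by [prod_1sub]. Here s is arbitrary: the identity
    holds for each lattice point separately. *)
Lemma inclusion_exclusion :
  [exists (v | v \in nodes T), s v]%:R
  - \sum_(I in orb_edges T) [exists (v | v \in I), s v]%:R
  + \sum_(v in nodes T) ((orb_valency T v)%:Z - 1) * (s v)%:R =
  - \sum_(U : {set 'I_n} | (U \subset nodes T) && (1 < #|U|)%N
                           && (U \notin orb_edges T)) sg U :> int.
Proof.
rewrite exists_prod prod_1sub sum_sets_split cards0 expr0 mul1r finset.big_set0.
have -> : \sum_(v in nodes T) sg [set v]%SET = - \sum_(v in nodes T) (s v)%:R.
  rewrite -sumrN; apply: eq_bigr => v _.
  by rewrite cards1 big_set1 expr1 mulN1r.
set S := \sum_(U : {set 'I_n} | (U \subset nodes T) && _) _.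
set S' := \sum_(U : {set 'I_n} | _ && (U \notin orb_edges T)) _.
have -> : S = \sum_(I in orb_edges T) sg I + S'.
  rewrite /S (bigID (mem (orb_edges T))) /=; congr (_ + _).
  apply: eq_bigl => I; apply: andb_idl => /orb_edgesP[a [b [ab ->]]].
  rewrite cards2 (orb_edge_neq ab) andbT; case/and3P: ab => aN bN _.
  by apply/fintype.subsetP => v /finset.set2P[]->.
have -> : \sum_(I in orb_edges T) [exists (v | v \in I), s v]%:R =
    \sum_(v in nodes T) (orb_valency T v)%:Z * (s v)%:R
    - \sum_(I in orb_edges T) sg I :> int.
  by rewrite -sum_orb_valency -sumrB; apply: eq_bigr => I; apply: exists_edge.
have -> : \sum_(v in nodes T) ((orb_valency T v)%:Z - 1) * (s v)%:R =
    \sum_(v in nodes T) (orb_valency T v)%:Z * (s v)%:R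
    - \sum_(v in nodes T) (s v)%:R :> int.
  by rewrite -sumrB; apply: eq_bigr => v _; rewrite mulrBl mul1r.
ring.
Qed.

(** For U without its chosen separator m, the set U and m together have the
    same separators, hence the same m, and opposite sign; the two terms add up
    to the term of U times 1 - s_m. *)
Lemma separator_pairing :
  \sum_(U : {set 'I_n} | (U \subset nodes T) && (1 < #|U|)%N
                           && (U \notin orb_edges T)) sg U =
  \sum_(U : {set 'I_n} | U \subset nodes T)
    oapp (fun m => if m \in U then 0 else sg U * (~~ s m)%:R) 0
         [pick m | m \in separators T U].
Proof.
pose pk U := [pick m | m \in separators T U].
have pkP U m : pk U = Some m -> m \in separators T U.
  by rewrite /pk; case: pickP => // m' H [<-].
have pkN U m : pk U = Some m -> m \in nodes T.
  by move/pkP/separatorsP => [].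
have pkE U m : pk U = Some m -> pk (m |: U)%SET = Some m /\ pk (U :\ m)%SET = Some m.
  by move=> /[dup] /pkP mI; rewrite /pk separators_setU1 // separators_setD1.
rewrite (eq_bigl (fun U : {set 'I_n} => (U \subset nodes T) && (pk U != None))); last first.
  move=> U; rewrite -andbA; case UN: (U \subset nodes T) => //=.
  have -> : (pk U != None) = (separators T U != finset.set0).
    rewrite /pk; case: pickP => [m mI|H]; apply/esym.
      by apply/finset.set0Pn; exists m.
    by apply/negbTE/negPn/eqP/setP => m; rewrite H inE.
  apply/andP/idP => [[U1 UE]|I0].
    by apply: contraNneq UE; apply: separators0_orb_edge.
  split; last by apply: contra I0 => /separators_orb_edge->.
  have [m /separatorsP[_ [a [b [aU bU /and3P[_ _ ab]]]]]] := finset.set0Pn _ I0.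
  apply/card_gt1P; exists a, b; split=> //.
  by apply: contraNneq ab => ->; apply: connect0.
rewrite [RHS](bigID (fun U => pk U != None)) /= [X in _ = _ + X]big1 ?addr0; last first.
  by move=> U /andP[_]; rewrite negbK => /eqP; rewrite /pk => ->.
pose mem_pk U := oapp (fun m => m \in U) false (pk U).
rewrite (bigID mem_pk) [RHS](bigID mem_pk) /=.
rewrite [X in _ = X + _]big1 ?add0r; last first.
  move=> U /andP[_]; rewrite /mem_pk -/(pk U); case: (pk U) => //= m mU.
  by rewrite mU.
(* U and its chosen separator are exchanged; [pkE] keeps the choice the same.
  *)
pose add U := oapp (fun m => (m |: U)%SET) U (pk U).
pose del U := oapp (fun m => (U :\ m)%SET) U (pk U).
rewrite (reindex_onto add del) /=; last first.
  move=> U /andP[/andP[UN]]; rewrite /add /del /mem_pk.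
  case E: (pk U) => [m|//] _ /= mU; rewrite (proj2 (pkE _ _ E)) /=.
  exact: finset.setD1K.
rewrite [X in X + _](eq_bigl (fun U => (U \subset nodes T) && (pk U != None)
    && ~~ mem_pk U)); last first.
  move=> U; rewrite /add /del /mem_pk.
  case E: (pk U) => [m|] /=; last by rewrite E /= !andbF.
  have [E1 E2] := pkE _ _ E; rewrite E1 /= !andbT.
  rewrite finset.subUset finset.sub1set (pkN _ _ E) /= !inE eqxx /= andbT.
  congr (_ && _); apply/eqP/idP => [H|mU]; last by rewrite finset.setU1K.
  by rewrite -H !inE eqxx.
rewrite -big_split /=; apply: eq_bigr => U /andP[/andP[UN]].
rewrite /add /mem_pk -/(pk U); case: (pk U) => [m|//] _ /= mU.
rewrite (negPf mU) big_setU1 //= cardsU1 mU add1n exprS.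
by case: (s m) => /=; ring.
Qed.

End InclusionExclusion.

(** * The counting formula *)

Section CountingFormula.
Variables (n : nat) (T : plumbing_tree n) (h x : 'rV[rat]_n).
Hypothesis x_deep : forall t, (valency T t)%:R - 2 < cof T x t.

(** For each lattice point, [inclusion_exclusion] and [separator_pairing] give
    a sum of indicators of events; exchanging the sums, [cancellation] applies
    for each U. *)
Theorem counting_formula :
  counting T h (nodes T) x =
    \sum_(I in orb_edges T) counting T h I x
    - \sum_(v in nodes T)
        ((orb_valency T v)%:Z - 1) * counting T h [set v]%SET x.
Proof.
have H1 : eventually (fun N => forall U : {set 'I_n}, forall m, m \notin U ->
    m \in separators T U ->
    \sum_(a : {ffun 'I_n -> 'I_N}) (\prod_u vcoef T u (a u)) *
      (event h x U m (boxpt T a))%:R = 0).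
  apply: eventually_fin => U; apply: eventually_fin => m.
  have [mU|mU] := boolP (m \in U); first by exists 0%N.
  have [mI|mI] := boolP (m \in separators T U); last by exists 0%N => N _ _ /negP.
  by apply: eventually_imp (cancellation h x_deep mU mI) => N.
have [N HN] := eventually_and H1 (counting_box T h x).
have {HN}[H H0] := HN N (leqnn N).
apply/eqP; rewrite -subr_eq0 opprB addrA addrAC.
rewrite H0 (eq_bigr _ (fun I _ => H0 I)).
rewrite (eq_bigr _ (fun v _ => congr1 (fun z => _ * z) (H0 [set v]%SET))).
rewrite exchange_big /=.
under [X in _ + X]eq_bigr do rewrite mulr_sumr.
rewrite [X in _ + X]exchange_big /= -sumrB -big_split /=.
pose F (U : {set 'I_n}) (l : 'rV[rat]_n) : int :=
  oapp (fun m => if m \in U then 0 else (-1) ^+ #|U| * (event h x U m l)%:R) 0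
         [pick m | m \in separators T U].
have FE (a : {ffun 'I_n -> 'I_N}) :
   \prod_u vcoef T u (a u) *
      (`[< latticeL (boxpt T a - h) >] && below (nodes T) x (boxpt T a))%:R
   - \sum_(I in orb_edges T) \prod_u vcoef T u (a u) *
      (`[< latticeL (boxpt T a - h) >] && below I x (boxpt T a))%:R
   + \sum_(v in nodes T) ((orb_valency T v)%:Z - 1) * (\prod_u vcoef T u (a u) *
      (`[< latticeL (boxpt T a - h) >] && below [set v]%SET x (boxpt T a))%:R)
   = - \sum_(U : {set 'I_n} | U \subset nodes T)
        \prod_u vcoef T u (a u) * F U (boxpt T a).
  set l := boxpt T a; set p := \prod_u _; set c := `[< _ >].
  pose s v := l 0 v < x 0 v.
  have bE I : (c && below I x l)%:R = c%:R * [exists (v | v \in I), s v]%:R :> int.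
    by rewrite -mulnb natrM.
  have b1 v : below [set v]%SET x l = s v.
    apply/exists_inP/idP => [[w]|sv]; first by rewrite inE => /eqP->.
    by exists v; rewrite ?inE.
  rewrite bE mulrA.
  have -> : \sum_(I in orb_edges T) p * (c && below I x l)%:R =
      p * c%:R * \sum_(I in orb_edges T) [exists (v | v \in I), s v]%:R.
    by rewrite mulr_sumr; apply: eq_bigr => I _; rewrite bE mulrA.
  under [X in _ + X = _]eq_bigr do rewrite b1 -mulnb natrM !mulrA.
  have -> : \sum_(v in nodes T) ((orb_valency T v)%:Z - 1) * p * c%:R * (s v)%:R
     = p * c%:R * \sum_(v in nodes T) ((orb_valency T v)%:Z - 1) * (s v)%:R.
    by rewrite mulr_sumr; apply: eq_bigr => v _; ring.
  rewrite -mulrBr -mulrDr inclusion_exclusion separator_pairing mulrN mulr_sumr.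
  congr (- _); apply: eq_bigr => U _; rewrite -mulrA; congr (_ * _).
  rewrite /F; case: pickP => [m mI|_] /=; last by rewrite mulr0.
  case: ifP => mU; first by rewrite mulr0.
  rewrite -mulrA mulrCA; congr (_ * _).
  have -> : \prod_(v in U) (s v)%:R = [forall (v | v \in U), s v]%:R :> int.
    case: forall_inP => [sU|NsU].
      by rewrite big1 // => v vU; rewrite sU.
    have [v /andP[vU /negPf sv]] : exists v, (v \in U) && ~~ s v.
      apply/existsP; apply: contraT; rewrite negb_exists => /forallP H2; case: NsU.
      by move=> v vU; have := H2 v; rewrite vU /= negbK.
    by rewrite (bigD1 v) //= sv mul0r.
  by rewrite /event -/c leNgt -!natrM !mulnb.
rewrite (eq_bigr _ (fun a _ => FE a)) sumrN oppr_eq0 exchange_big /=; apply/eqP.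
apply: big1 => U UN; rewrite /F; case: pickP => [m mI|_] /=; last first.
  by apply: big1 => a _; rewrite mulr0.
case: (boolP (m \in U)) => mU; first by apply: big1 => a _; rewrite mulr0.
under eq_bigr do rewrite mulrCA.
by rewrite -mulr_sumr H ?mulr0.
Qed.

End CountingFormula.

(** * Iterated differences and the Newton expansion *)

Section Newton.
Variable G : zmodType.
Implicit Types (e x : G) (F : G -> int).

Definition fdiff e F x : int := F (x + e) - F x.

Lemma fdiffC e e' F : fdiff e (fdiff e' F) = fdiff e' (fdiff e F).
Proof. by apply/funext => x; rewrite /fdiff [x + e' + e]addrAC; ring. Qed.

Lemma iter_fdiffC e e' k F :
  iter k (fdiff e) (fdiff e' F) = fdiff e' (iter k (fdiff e) F).
Proof. by elim: k => //= k ->; rewrite fdiffC. Qed.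

Lemma iter_fdiffCC e e' k k' F :
  iter k (fdiff e) (iter k' (fdiff e') F) =
  iter k' (fdiff e') (iter k (fdiff e) F).
Proof. by elim: k' => //= k' <-; rewrite iter_fdiffC. Qed.

Lemma fdiff_zero e F x k : (forall s, F (x + e *+ s) = 0) ->
  forall s, iter k (fdiff e) F (x + e *+ s) = 0.
Proof.
move=> H; elim: k => //= k IHk s.
by rewrite /fdiff -addrA -mulrSr !IHk subrr.
Qed.

Lemma newton e D F x : (forall s, iter D (fdiff e) F (x + e *+ s) = 0) ->
  forall k, F (x + e *+ k) = \sum_(a < D) iter a (fdiff e) F x *+ 'C(k, a).
Proof.
elim: D F => [|D IHD] F H; first by move=> k; rewrite big_ord0; apply: H.
have H' s : iter D (fdiff e) (fdiff e F) (x + e *+ s) = 0.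
  by rewrite -iterSr H.
elim=> [|k IHk].
  by rewrite mulr0n addr0 big_ord_recl bin0 mulr1n big1 ?addr0.
have -> : F (x + e *+ k.+1) = F (x + e *+ k) + fdiff e F (x + e *+ k).
  by rewrite /fdiff [RHS]addrC subrK mulrSr addrA.
rewrite IHk (IHD _ H') !big_ord_recl !bin0 -addrA; congr (_ + _).
rewrite -big_split; apply: eq_bigr => a _ /=.
by rewrite /bump /= add1n -iterSr /= binS mulrnDr.
Qed.

(** Newton expansion in one direction, then in the other one. The two kinds of
    differences commute, so the vanishing in the second direction passes to the
    differences in the first one. *)
Lemma newton2 e e' D D' F x :
  (forall s t, iter D (fdiff e) F (x + e *+ s + e' *+ t) = 0) ->
  (forall s t, iter D' (fdiff e') F (x + e *+ s + e' *+ t) = 0) ->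
  forall k k', F (x + e *+ k + e' *+ k') =
    \sum_(a < D) \sum_(b < D')
      iter b (fdiff e') (iter a (fdiff e) F) x *+ ('C(k, a) * 'C(k', b)).
Proof.
move=> H H' k k'; rewrite addrAC (@newton e D) => [|s]; last by rewrite addrAC; apply: H.
apply: eq_bigr => a _; rewrite (@newton e' D') => [|t].
  rewrite -sumrMnl; apply: eq_bigr => b _.
  by rewrite -mulrnA mulnC.
rewrite iter_fdiffCC -[_ + e' *+ t]addr0 -[0](mulr0n e).
by apply: fdiff_zero => s; rewrite addrAC.
Qed.

End Newton.

(** * Common steps *)

Section CommonMultiples.
Variables (n : nat) (T : plumbing_tree n).

Lemma common_den (I : finType) (q : I -> rat) :
  exists D : nat, (0 < D)%N /\ forall i, D%:R * q i \is a Num.int.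
Proof.
exists (\prod_i `|denq (q i)|)%N; split.
  by apply: prodn_gt0 => i; rewrite absz_gt0 denq_neq0.
move=> i; rewrite (bigD1 i) //= mulnC natrM -mulrA rpredM ?natr_int //.
by rewrite natr_absz ger0_norm ?denq_ge0 // mulrC -numqE intr_int.
Qed.

(** The v-coordinates of the E*_u are positive rational numbers, so suitable
    multiples of them agree. The extra factor in L keeps the class modulo L
    unchanged. *)
Lemma common_step v : exists (c : nat) (d : 'I_n -> nat),
  [/\ (0 < c)%N,
      forall u, (Estar T u *+ d u) 0 v = (Estar T v *+ c) 0 v,
      forall u, latticeL (Estar T u *+ d u) & latticeL (Estar T v *+ c)].
Proof.
have [o [o0 oP]] := common_den (fun p : 'I_n * 'I_n => Estar T p.1 0 p.2).
have /choice[N NP] : forall u, exists k : nat, (0 < k)%N /\ o%:R * Estar T u 0 v = k%:R.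
  move=> u; have := oP (u, v) => /= H.
  have p0 : 0 < o%:R * Estar T u 0 v by rewrite mulr_gt0 ?ltr0n ?Estar_gt0.
  have : o%:R * Estar T u 0 v \is a Num.nat by rewrite natrEint H ltW.
  move=> /natrP[k kE]; exists k; split=> //.
  by rewrite -(ltr0n rat) -kE.
have oL u k : latticeL (Estar T u *+ (o * k)).
  move=> t; rewrite -scaler_nat mxE mulnC natrM -mulrA rpredM ?natr_int //.
  exact: oP (u, t).
(* o clears denominators, and then the numbers N u have the common multiple
   \prod_u N u. *)
exists (o * \prod_u N u)%N, (fun u => o * (N v * \prod_(t | t != u) N t))%N.
split=> //.
- by rewrite muln_gt0 o0 prodn_gt0 // => u; case: (NP u).
move=> u; rewrite -!scaler_nat.
rewrite [LHS]mxE [RHS]mxE [in RHS](bigD1 u) //= !natrM.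
set P := (\prod_(t | t != u) N t)%:R.
transitivity ((N v)%:R * P * (o%:R * Estar T u 0 v)); first by ring.
rewrite (NP u).2.
transitivity ((N u)%:R * P * (o%:R * Estar T v 0 v)); last by ring.
by rewrite (NP v).2; ring.
Qed.

End CommonMultiples.

(** * Differences of counting functions *)

Section Differences.
Variables (n : nat) (T : plumbing_tree n) (h : 'rV[rat]_n).
Implicit Types (u v w t : 'I_n) (J B : {set 'I_n}) (x l : 'rV[rat]_n).

Definition cutoff J x l : int :=
  (`[< latticeL (l - h) >] && below J x l)%:R.

Definition off J : pred 'I_n := fun t => t \notin J.

Lemma cutoff_periodic J x : periodic (periods (off J)) (cutoff J x).
Proof.
move=> w Ww l; rewrite /cutoff (periods_lattice _ _ Ww); congr (nat_of_bool (_ && _))%:R.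
by apply: eq_existsb_in => v vJ; rewrite mxE (Ww.2 v) ?addr0 // /off negbK.
Qed.

Lemma cutoff_shift J x e l : latticeL e -> cutoff J (x + e) (l + e) = cutoff J x l.
Proof.
move=> eL; rewrite /cutoff.
have -> : `[< latticeL (l + e - h) >] = `[< latticeL (l - h) >].
  exact: (@periods_lattice _ h l predT).
congr (nat_of_bool (_ && _))%:R; apply: eq_existsb_in => v vJ.
by rewrite !mxE ltrD2r.
Qed.

Variables (d : 'I_n -> nat) (e : 'rV[rat]_n).
Hypothesis eL : latticeL e.
Hypothesis dL : forall u, latticeL (Estar T u *+ d u).

(** The ends in B, whose series have already been made finite, have the
    coefficients of 1 + z + ... + z^(d u - 1). *)
Definition capped_coef B u k : int := if u \in B then (k < d u)%N%:R else vcoef T u k.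

(** With B empty this is the counting function, as soon as N is large enough.
   *)
Definition box B J N x : int :=
  \sum_(a : {ffun 'I_n -> 'I_N}) (\prod_u capped_coef B u (a u)) * cutoff J x (boxpt T a).

Lemma counting_box0 x J : eventually (fun N => counting T h J x = box finset.set0 J N x).
Proof.
apply: eventually_imp (counting_box T h x) => N HN; rewrite HN.
apply: eq_bigr => a _; congr (_ * _); apply: eq_bigr => u _.
by rewrite /capped_coef inE.
Qed.

(** The difference is multiplication by 1 - y, where y is translation by e. On
    J the vectors e and d u E*_u agree, so y = x_u ^ (d u), and (1 - x_u ^ d)(1
    + ... + x_u ^ (N-1)) = (1 - x_u ^ N)(1 + ... + x_u ^ (d-1)). The factor x_u
    ^ N moves all points beyond the bound. *)
Lemma box_step B J u x : valency T u = 1%N -> u \notin B ->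
  (forall t, t \in J -> (Estar T u *+ d u) 0 t = e 0 t) ->
  eventually (fun N => box B J N (x + e) - box B J N x = box (u |: B)%SET J N (x + e)).
Proof.
move=> u1 uB eJ; pose W := periods (off J); pose X := xshift T W.
have fP := @cutoff_periodic J (x + e).
(* e and d u E*_u differ by a period. *)
have yE : shift W e = X u ^+ d u.
  rewrite -shiftMn -[e](subrK (Estar T u *+ d u)) shiftD.
  rewrite [shift W (e - _)]shift_period ?mul1r //; split.
    move=> t; rewrite mxE [X in _ + X]mxE; apply: rpredB; first exact: eL.
    exact: dL.
  by move=> t; rewrite negbK => tJ; rewrite mxE [X in _ + X]mxE eJ // subrr.
have : eventually (fun N => (d u <= N)%N /\ forall t, (x + e) 0 t <= N%:R * Estar T u 0 t).
  apply: eventually_and; first exact: eventually_ge.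
  by apply: eventually_fin => t; apply: eventually_arch; apply: Estar_gt0.
apply: eventually_imp => N [dN HN].
pose Th B' := \prod_u \sum_(k < N) X u ^+ k *~ capped_coef B' u k.
have boxE B' : box B' J N (x + e) = Th B' (cutoff J (x + e)) 0.
  by rewrite box_expand //; apply: eq_bigr => a _; rewrite add0r.
have boxE' B' : box B' J N x = (shift W e * Th B') (cutoff J (x + e)) 0.
  rewrite shift_mull // add0r box_expand //; apply: eq_bigr => a _.
  by rewrite [e + _]addrC cutoff_shift.
rewrite boxE boxE' -sopN -sopD -[in X in X + _](mul1r (Th B)) -mulNr -mulrDl.
have ThE : (1 - shift W e) * Th B = Th (u |: B)%SET - X u ^+ N * Th (u |: B)%SET.
  rewrite -[X in _ = X - _]mul1r -mulrBl /Th (bigD1 u) //= [in RHS](bigD1 u) //=.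
  rewrite !mulrA; congr (_ * _); last first.
    by apply: eq_bigr => t tu; apply: eq_bigr => k _; rewrite /capped_coef !inE (negPf tu).
  have -> : \sum_(k < N) X u ^+ k *~ capped_coef B u k = \sum_(k < N) X u ^+ k.
    by apply: eq_bigr => k _; rewrite /capped_coef (negPf uB) vcoef_end.
  have -> : \sum_(k < N) X u ^+ k *~ capped_coef (u |: B)%SET u k = \sum_(k < d u) X u ^+ k.
    rewrite (big_ord_widen _ (fun k => X u ^+ k) dN) [RHS]big_mkcond.
    apply: eq_bigr => k _; rewrite /capped_coef !inE eqxx /=.
    by case: ifP; rewrite ?mulr0z ?mulr1z.
  by rewrite yE -!geometric mulrAC.
rewrite ThE sopD sopN boxE -[RHS]subr0; congr (_ - _).
rewrite -shiftMn shift_mull // add0r box_expand // big1 // => a _.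
rewrite /cutoff (_ : below _ _ _ = false) ?andbF ?mulr0 //.
apply/exists_inP => -[t tJ]; rewrite ltNge => /negP; apply.
apply: le_trans (HN t) _.
have -> : (Estar T u *+ N + boxpt T a) 0 t = N%:R * Estar T u 0 t + boxpt T a 0 t.
  by rewrite -scaler_nat mxE [X in X + _]mxE.
by rewrite lerDl boxpt_ge0.
Qed.

Variable Dom : 'rV[rat]_n -> Prop.
Hypothesis DomD : forall x, Dom x -> Dom (x + e).

(** One application of [box_step] for each end in B'. The domain, stable under
    e, is where the given expression of F holds; z records the translation
    accumulated so far. *)
Lemma box_steps (J B B' : {set 'I_n}) (F : 'rV[rat]_n -> int) :
  (forall u, u \in B' -> [/\ valency T u = 1%N, u \notin B &
     forall t, t \in J -> (Estar T u *+ d u) 0 t = e 0 t]) ->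
  forall z, (forall x, Dom x -> eventually (fun N => F x = box B J N (x + z))) ->
  forall x, Dom x ->
    eventually (fun N => iter #|B'| (fdiff e) F x =
                 box (B' :|: B)%SET J N (x + e *+ #|B'| + z)).
Proof.
move=> + z.
have [k kE] : exists k, k = #|B'| by exists #|B'|.
elim: k B' kE => [|k IHk] B' kE HB' HF x xD.
  have -> : B' = finset.set0 by apply/eqP; rewrite -cards_eq0 -kE.
  rewrite cards0 mulr0n addr0 finset.set0U; exact: HF.
have [u uB'] : exists u, u \in B' by apply/card_gt0P; rewrite -kE.
have cE : #|B'| = #|B' :\ u|.+1 by rewrite (cardsD1 u B') uB'.
have kE' : k = #|B' :\ u| by apply/eqP; rewrite -eqSS kE cE.
have HBu t : t \in (B' :\ u)%SET -> [/\ valency T t = 1%N, t \notin B &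
     forall s, s \in J -> (Estar T t *+ d t) 0 s = e 0 s].
  by rewrite !inE => /andP[_]; apply: HB'.
have IH y (yD : Dom y) := IHk _ kE' HBu HF y yD.
have [u1 uB eJ] := HB' u uB'.
have uB2 : u \notin (B' :\ u :|: B)%SET by rewrite !inE eqxx.
have st := box_step (x + e *+ #|B' :\ u| + z) u1 uB2 eJ.
apply: eventually_imp (eventually_and (eventually_and (IH x xD) (IH (x + e) (DomD xD))) st) => N [[H1 H2] H3].
have E y : x + e + y + z = x + y + z + e.
  by rewrite [x + e + y]addrAC [LHS]addrAC.
rewrite cE iterS {1}/fdiff H1 H2 E H3.
by rewrite finset.setUA (finset.setD1K uB') -E mulrS addrA.
Qed.

End Differences.

(** * Vanishing of iterated differences *)

Section Vanishing.
Variables (n : nat) (T : plumbing_tree n) (h : 'rV[rat]_n).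
Hypothesis valency_pos : forall t, (0 < valency T t)%N.
Implicit Types (u v w t : 'I_n) (J B : {set 'I_n}) (x l : 'rV[rat]_n).
Local Notation q u t := (Estar T u 0 t).

Lemma mulrnE u k t : (Estar T u *+ k) 0 t = k%:R * q u t.
Proof. by rewrite -scaler_nat [LHS]mxE. Qed.

Definition ends : {set 'I_n} := [set u | valency T u == 1%N]%SET.

(** A bound for the t-coordinate of the part of a point which does not come
    from the ends with infinite series. *)
Definition inner_bound (d : 'I_n -> nat) t : rat := \sum_u (d u + n)%:R * q u t.

Lemma valency_le t : (valency T t <= n)%N.
Proof. by rewrite /valency -[X in (_ <= X)%N](card_ord n); apply: max_card. Qed.

Lemma capped_coef_bound d B u k : B \subset ends -> capped_coef T d B u k != 0 ->
  u \notin (ends :\: B)%SET -> (k <= d u + n)%N.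
Proof.
move=> BE; rewrite /capped_coef !inE; case: ifP => [uB|uB].
  case: ltnP => // kd _ _; apply: leq_trans (ltnW kd) (leq_addr _ _).
rewrite /= => cN uE; have u2 : (2 <= valency T u)%N.
  by move: (valency_pos u) uE; case: (valency T u) => [|[|]].
rewrite vcoef_inner // in cN; rewrite leqNgt; apply: contra cN => kn.
rewrite tcoef_gt //; apply: leq_ltn_trans kn.
apply: leq_trans (leq_addl _ _); apply: leq_trans (leq_subr _ _) _.
exact: valency_le.
Qed.

Lemma inner_le d B N (a : {ffun 'I_n -> 'I_N}) t : B \subset ends ->
  \prod_u capped_coef T d B u (a u) != 0 ->
  \sum_(u | u \notin (ends :\: B)%SET) (a u)%:R * q u t <= inner_bound d t.
Proof.
move=> BE aN; rewrite /inner_bound big_mkcond; apply: ler_sum => u _.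
case: ifP => uB; last by rewrite mulr_ge0 ?ler0n ?Estar_ge0.
rewrite ler_wpM2r ?Estar_ge0 // ler_nat; apply: capped_coef_bound BE _ _; last by rewrite uB.
by apply: contraNneq aN => E; rewrite (bigD1 u) //= E mul0r.
Qed.

Lemma below1 v x l : below [set v]%SET x l = (l 0 v < x 0 v).
Proof.
by apply/exists_inP/idP => [[w]|lx]; [rewrite inE => /eqP->|exists v; rewrite ?inE].
Qed.

Lemma below2 v w x l :
  below [set v; w]%SET x l = (l 0 v < x 0 v) || (l 0 w < x 0 w).
Proof.
apply/exists_inP/orP => [[t /finset.set2P[]->]|[]]; [by left|by right| |].
  by exists v; rewrite // !inE eqxx.
by exists w; rewrite // !inE eqxx orbT.
Qed.

(** When all ends are finite, all points are below x already, so nothing is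
    added by moving x upwards. *)
Lemma box_ends_const d v N x (e : 'rV[rat]_n) : inner_bound d v < x 0 v -> 0 <= e 0 v ->
  box T h d ends [set v]%SET N (x + e) = box T h d ends [set v]%SET N x.
Proof.
move=> xv e0; apply: eq_bigr => a _.
have [->|aN] := eqVneq (\prod_u capped_coef T d ends u (a u)) 0; first by rewrite !mul0r.
have la : boxpt T a 0 v < x 0 v.
  apply: le_lt_trans xv; apply: le_trans (inner_le v _ aN) => //.
  by rewrite boxptE finset.setDv; rewrite [X in _ <= X](eq_bigl xpredT) // => u; rewrite inE.
congr (_ * _); rewrite /cutoff !below1 la mxE.
by rewrite (lt_le_trans la) // lerDl.
Qed.

Lemma fdiff_vanish (e : 'rV[rat]_n) d v D (Dom : 'rV[rat]_n -> Prop)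
    (F : 'rV[rat]_n -> int) z :
  (forall x, Dom x -> Dom (x + e)) ->
  (forall x, Dom x -> inner_bound d v < (x + z) 0 v) ->
  0 <= e 0 v ->
  (forall x, Dom x -> eventually (fun N =>
     iter D (fdiff e) F x = box T h d ends [set v]%SET N (x + z))) ->
  forall x, Dom x -> iter D.+1 (fdiff e) F x = 0.
Proof.
move=> De Dz e0 H x Dx; have [N HN] := eventually_and (H _ (De _ Dx)) (H _ Dx).
have [H1 H2] := HN N (leqnn N).
by rewrite iterS /fdiff H1 H2 addrAC (@box_ends_const d v N (x + z) e) ?subrr //; apply: Dz.
Qed.

(** On {v} every end can be made finite with the same step, and one more
    difference gives 0. *)
Lemma vanish_single v : exists (c D : nat) (C : rat), (0 < c)%N /\
  forall x, C < x 0 v ->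
    iter D (fdiff (Estar T v *+ c)) (counting T h [set v]%SET) x = 0.
Proof.
have [c [d [c0 dE dL eL]]] := common_step T v.
exists c, #|ends|.+1, (inner_bound d v); split=> //.
set e := Estar T v *+ c.
have e0 : 0 <= e 0 v by rewrite /e mulrnE mulr_ge0 ?ler0n ?Estar_ge0.
pose Dom x := inner_bound d v < x 0 v.
have De x : Dom x -> Dom (x + e).
  by move=> Dx; rewrite /Dom mxE (lt_le_trans Dx) // lerDl.
have key := @box_steps _ T h d e eL dL Dom De [set v]%SET finset.set0 ends
  (counting T h [set v]%SET).
move=> x Dx; apply: (@fdiff_vanish e d v #|ends| Dom _ (e *+ #|ends|)) => //.
  move=> y Dy; rewrite /Dom mxE (lt_le_trans Dy) // lerDl.
  by rewrite /e -mulrnA mulrnE mulr_ge0 ?ler0n ?Estar_ge0.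
move=> y Dy; have := key _ 0 _ y Dy; rewrite finset.setU0 addr0; apply.
  move=> u; rewrite inE => /eqP u1; split; rewrite ?inE // => t.
  by rewrite inE => /eqP->; apply: dE.
by move=> y' _; rewrite addr0; apply: counting_box0.
Qed.

(** The hypothesis on x says that it is deep in the direction of E*_v: the
    first quantity is, up to the positive determinant of [Estar_det], the
    coefficient of E*_v when x is written by E*_v and E*_w on {v, w}.

    The ends that v cuts off from w are made finite first; on {v, w} they are
    proportional to E*_v. The other ends are proportional to E*_w on {v, w}. A
    point l with l_v >= x_v needs a large contribution of these, and as x is
    deep this implies l_w >= x_w. The count is then that of {v}, on which the
    remaining ends can be made finite as well. *)
Lemma vanish_pair v w : orb_edge T v w ->
  exists (c D : nat) (C1 C2 : rat), (0 < c)%N /\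
  forall x, C1 <= x 0 v * q w w - x 0 w * q v w -> C2 < x 0 v ->
    iter D (fdiff (Estar T v *+ c)) (counting T h [set v; w]%SET) x = 0.
Proof.
move=> vw; have vwN := orb_edge_neq vw; case/and3P: (vw) => vN wN _.
have [c [d [c0 dE dL eL]]] := common_step T v.
pose U1 : {set 'I_n} := [set u in ends | sep T v u w]%SET.
exists c, (#|ends :\: U1| + #|U1|).+1, (q w w * inner_bound d v), (inner_bound d v).
split=> //; set e := Estar T v *+ c.
have eE t : e 0 t = c%:R * q v t by rewrite /e mulrnE.
(* Both conditions are stable under e, the first one by [Estar_det]. *)
pose Dom x := q w w * inner_bound d v <= x 0 v * q w w - x 0 w * q v w /\
              inner_bound d v < x 0 v.
have De x : Dom x -> Dom (x + e).
  move=> [D1 D2]; have e0 : 0 <= e 0 v by rewrite eE mulr_ge0 ?ler0n ?Estar_ge0.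
  split; last by rewrite mxE (lt_le_trans D2) // lerDl.
  have xE t : (x + e) 0 t = x 0 t + c%:R * q v t by rewrite mxE eE.
  rewrite !xE; apply: le_trans D1 _.
  rewrite [X in _ <= X](_ : _ = (x 0 v * q w w - x 0 w * q v w)
      + c%:R * (q v v * q w w - q v w * q v w)); last by ring.
  rewrite lerDl mulr_ge0 ?ler0n // subr_ge0 ltW //.
  by have := Estar_det T vwN; rewrite [q w v]Estar_sym.
have Dek x k : Dom x -> Dom (x + e *+ k).
  move=> Dx; elim: k => [|k IHk]; first by rewrite mulr0n addr0.
  by rewrite mulrSr addrA; apply: De.
have U1E : U1 \subset ends by apply/fintype.subsetP => u; rewrite inE => /andP[].
have step1 x : Dom x -> eventually (fun N =>
    iter #|U1| (fdiff e) (counting T h [set v; w]%SET) x =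
    box T h d U1 [set v]%SET N (x + e *+ #|U1|)).
  move=> Dx; have key := @box_steps _ T h d e eL dL Dom De [set v; w]%SET
    finset.set0 U1 (counting T h [set v; w]%SET).
  have := key _ 0 _ x Dx; rewrite finset.setU0 addr0 => /(_ _ _) H.
  have {H} : eventually (fun N =>
      iter #|U1| (fdiff e) (counting T h [set v; w]%SET) x =
      box T h d U1 [set v; w]%SET N (x + e *+ #|U1|)).
    apply: H => [u|y' _]; last by rewrite addr0; apply: counting_box0.
    rewrite !inE => /andP[/eqP u1 uvw]; split; rewrite ?inE // => t.
    case/finset.set2P => ->; first exact: dE.
    have := dE u; rewrite !mulrnE => dEu.
    apply: (@mulfI _ (q v v)); first by rewrite gt_eqF ?Estar_gt0.
    rewrite mulrCA (Estar_cut uvw) mulrA dEu; ring.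
  apply: eventually_imp => N ->; apply: eq_bigr => a _.
  have [->|aN] := eqVneq (\prod_u capped_coef T d U1 u (a u)) 0; first by rewrite !mul0r.
  congr (_ * _); rewrite /cutoff below1 below2; congr ((_ && _)%:R).
  set y := x + _; have [Dy1 Dy2] : Dom y by apply: Dek.
  (* A point not below x at v is not below x at w: r collects the bounded part
     and b the part of the ends with infinite series, proportional to E*_w. *)
  apply: orb_idr; apply: contraTT; rewrite -!leNgt => lv.
  set l := boxpt T a in lv *.
  pose r t := \sum_(u | u \notin (ends :\: U1)%SET) (a u)%:R * q u t.
  pose b t := \sum_(u | u \in (ends :\: U1)%SET) (a u)%:R * q u t.
  have lE t : l 0 t = r t + b t.
    by rewrite /l boxptE (bigID (mem (ends :\: U1)%SET)) /= addrC.
  have bE : q w w * b v = q v w * b w.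
    rewrite /b !mulr_sumr; apply: eq_bigr => u; rewrite !inE => /andP[].
    move=> usep u1; move: usep; rewrite u1 /= => usep.
    have u2 : valency T u != 2%N by rewrite (eqP u1).
    have uv : u != v by apply: contraTneq vN => <-; rewrite inE (eqP u1).
    have uw : u != w by apply: contraTneq wN => <-; rewrite inE (eqP u1).
    case: (chain_sep vw uv uw u2) => [H|/Estar_cut H]; first by rewrite H in usep.
    by rewrite mulrCA H [q v w]Estar_sym; ring.
  have rv : r v <= inner_bound d v by apply: inner_le.
  have rw : 0 <= r w by apply: sumr_ge0 => u _; rewrite mulr_ge0 ?ler0n ?Estar_ge0.
  have qvw : 0 < q v w by apply: Estar_gt0.
  have qww : 0 < q w w by apply: Estar_gt0.
  rewrite -(ler_pM2l qvw) lE mulrDr -bE.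
  have H1 : q w w * r v <= q w w * inner_bound d v by rewrite ler_pM2l.
  have H2 : q w w * y 0 v <= q w w * (r v + b v) by rewrite ler_pM2l // -lE.
  have H3 : 0 <= q v w * r w by rewrite mulr_ge0 // ltW.
  rewrite mulrDr in H2; lra.
have step2 x : Dom x -> eventually (fun N =>
    iter (#|ends :\: U1| + #|U1|) (fdiff e) (counting T h [set v; w]%SET) x =
    box T h d ends [set v]%SET N (x + e *+ (#|ends :\: U1| + #|U1|))).
  move=> Dx; have key := @box_steps _ T h d e eL dL Dom De [set v]%SET
    U1 (ends :\: U1)%SET (iter #|U1| (fdiff e) (counting T h [set v; w]%SET)).
  have := key _ _ step1 x Dx.
  rewrite iterD mulrnDr addrA.
  have -> : (ends :\: U1 :|: U1)%SET = ends.
    by apply/setP => u; rewrite !inE; case: (sep _ _ _ _); rewrite ?andbT ?andbF ?orbF //=; case: eqP.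
  apply=> u /finset.setDP[u1 uN]; split=> //; first by rewrite inE in u1; apply/eqP.
  by move=> t; rewrite inE => /eqP->; apply: dE.
move=> x D1 D2; apply: (@fdiff_vanish e d v _ Dom _ (e *+ (#|ends :\: U1| + #|U1|))) => //.
  by move=> y Dy; case: (Dek _ (#|ends :\: U1| + #|U1|) Dy).
by rewrite eE mulr_ge0 ?ler0n ?Estar_ge0.
Qed.

End Vanishing.

(** * Polynomial functions *)

Section PolynomialFunctions.
Variables (R : realType) (n : nat).
Implicit Types (F : ('I_n -> R) -> R) (y z : 'I_n -> R).

(** Closure properties are easier to state for functions than for multivariate
    polynomials. *)
Definition polyfun F := exists P : mpoly.mpoly n R, forall y, mpoly.meval y P = F y.

Lemma eq_polyfun F F' : F =1 F' -> polyfun F -> polyfun F'.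
Proof. by move=> FF' [P PE]; exists P => y; rewrite PE. Qed.

Lemma polyfun_cst c : polyfun (fun=> c).
Proof. by exists (mpoly.mpolyC n c) => y; rewrite mpoly.mevalC. Qed.

Lemma polyfun_coord v : polyfun (fun y => y v).
Proof. by exists (mpoly.mpolyX R (mpoly.mnm1 v)) => y; rewrite mpoly.mevalXU. Qed.

Lemma polyfunD F F' : polyfun F -> polyfun F' -> polyfun (fun y => F y + F' y).
Proof. by move=> [P PE] [Q QE]; exists (P + Q) => y; rewrite mpoly.mevalD PE QE. Qed.

Lemma polyfunM F F' : polyfun F -> polyfun F' -> polyfun (fun y => F y * F' y).
Proof. by move=> [P PE] [Q QE]; exists (P * Q) => y; rewrite mpoly.mevalM PE QE. Qed.

Lemma polyfun_sum (I : Type) (r : seq I) (P : pred I) (F : I -> ('I_n -> R) -> R) :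
  (forall i, P i -> polyfun (F i)) -> polyfun (fun y => \sum_(i <- r | P i) F i y).
Proof.
move=> H; elim: r => [|i r IHr].
  by apply: eq_polyfun (polyfun_cst 0) => y; rewrite big_nil.
case Pi: (P i).
  apply: eq_polyfun (polyfunD (H i Pi) IHr) => y; by rewrite big_cons Pi.
by apply: eq_polyfun IHr => y; rewrite big_cons Pi.
Qed.

Lemma polyfun_prod (I : Type) (r : seq I) (F : I -> ('I_n -> R) -> R) :
  (forall i, polyfun (F i)) -> polyfun (fun y => \prod_(i <- r) F i y).
Proof.
move=> H; elim: r => [|i r IHr].
  by apply: eq_polyfun (polyfun_cst 1) => y; rewrite big_nil.
by apply: eq_polyfun (polyfunM (H i) IHr) => y; rewrite big_cons.
Qed.

Lemma polyfunB F F' : polyfun F -> polyfun F' -> polyfun (fun y => F y - F' y).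
Proof.
move=> HF HF'; apply: eq_polyfun (polyfunD HF (polyfunM (polyfun_cst (-1)) HF')) => y.
by rewrite mulN1r.
Qed.

(** The binomial coefficient t choose a as a polynomial in t. *)
Definition binf a (t : R) : R := a`!%:R^-1 * \prod_(k < a) (t - k%:R).

Lemma binf_nat a k : binf a k%:R = 'C(k, a)%:R.
Proof.
rewrite /binf; have -> : \prod_(i < a) (k%:R - i%:R) = (k ^_ a)%:R :> R.
  elim: a => [|a IHa]; first by rewrite big_ord0.
  rewrite big_ord_recr /= IHa ffactnSr natrM.
  have [ak|ka] := leqP a k; first by rewrite natrB.
  by rewrite ffact_small // !mul0r.
rewrite -bin_ffact natrM mulrC mulfK //.
by rewrite pnatr_eq0 -lt0n fact_gt0.
Qed.

Lemma polyfun_binf a F : polyfun F -> polyfun (fun y => binf a (F y)).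
Proof.
move=> HF; apply: polyfunM; first exact: polyfun_cst.
by apply: polyfun_prod => k; apply: polyfunB => //; apply: polyfun_cst.
Qed.

(** Restricting to a line through 0 reduces the comparison of two polynomials
    to one variable. *)
Lemma polyfun_line F (w : 'I_n -> R) : polyfun F ->
  exists p : {poly R}, forall t, p.[t] = F (fun v => t * w v).
Proof.
move=> [P PE].
exists (\sum_(m <- mpoly.msupp P) (mpoly.mcoeff m P)%:P *
          \prod_i ((w i)%:P * 'X) ^+ mpoly.fun_of_multinom m i) => t.
rewrite -PE mpoly.mevalE horner_sum; apply: eq_bigr => m _.
rewrite hornerCM horner_prod; congr (_ * _); apply: eq_bigr => i _.
by rewrite horner_exp hornerCM hornerX mulrC.
Qed.

End PolynomialFunctions.

(** * From vanishing differences to polynomials *)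

Section EventuallyPolynomial.
Variables (R : realType) (n : nat) (T : plumbing_tree n) (h : 'rV[rat]_n).
Implicit Types (u v w t : 'I_n) (J : {set 'I_n}) (x : 'rV[rat]_n).
Local Notation q u t := (Estar T u 0 t).

Definition ratv x : 'I_n -> R := fun v => ratr (x 0 v).

(** The points of the cone, without a bound on the coefficients. *)
Definition Epoint (b : 'I_n -> nat) : 'rV[rat]_n := \sum_u (b u)%:R *: Estar T u.

(** F has to be evaluated at projected points, whose other coordinates are 0.
   *)
Definition depends_on J (F : ('I_n -> R) -> R) :=
  forall y z : 'I_n -> R, (forall v, v \in J -> y v = z v) -> F y = F z.

(** Divisibility by D plays the part of the finite index sublattice, the bound
    c0 that of the translated cone. *)
Definition represents J F (D c0 : nat) := (0 < D)%N /\
  forall b : 'I_n -> nat, (forall u, c0 <= b u)%N -> (forall u, D %| b u)%N ->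
    (counting T h J (Epoint b))%:~R = F (ratv (Epoint b)) :> R.

Definition eventually_poly J := exists F,
  [/\ polyfun F, depends_on J F & exists D c0, represents J F D c0].

Lemma EpointE b t : Epoint b 0 t = \sum_u (b u)%:R * q u t.
Proof. by rewrite summxE; apply: eq_bigr => u _; rewrite [LHS]mxE. Qed.

Lemma eq_counting J x (y : 'rV[rat]_n) : (forall t, t \in J -> x 0 t = y 0 t) ->
  counting T h J x = counting T h J y.
Proof.
move=> xy; rewrite /counting (_ : proj J x = proj J y) //.
by apply/rowP => t; rewrite !mxE; case: ifP => // /xy.
Qed.

Lemma linear_Epoint J (c : 'I_n -> rat) b :
  \sum_(t in J) c t * Epoint b 0 t =
  \sum_u (b u)%:R * \sum_(t in J) c t * q u t.
Proof.
under eq_bigr do rewrite EpointE mulr_sumr.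
rewrite exchange_big; apply: eq_bigr => u _; rewrite mulr_sumr.
by apply: eq_bigr => t _; rewrite mulrCA.
Qed.

(** Here k and k' are coordinates with respect to e and e' on J. On deep points
    with divisible coefficients they are large natural numbers, where [newton2]
    expresses the counting function by binomial coefficients of k and k'. *)
Lemma eventually_poly_newton J (e e' : 'rV[rat]_n) (al be : 'I_n -> rat) D D' i0 j0 :
  let k x := \sum_(t in J) al t * x 0 t in
  let k' x := \sum_(t in J) be t * x 0 t in
  (forall x t, t \in J -> x 0 t = k x * e 0 t + k' x * e' 0 t) ->
  (forall u, 0 <= k (Estar T u)) -> (forall u, 0 <= k' (Estar T u)) ->
  eventually (fun c0 => forall b, (forall u, c0 <= b u)%N ->
        i0%:R <= k (Epoint b) /\ j0%:R <= k' (Epoint b)) ->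
  (forall i j, (i0 <= i)%N ->
     iter D (fdiff e) (counting T h J) (e *+ i + e' *+ j) = 0) ->
  (forall i j, (j0 <= j)%N ->
     iter D' (fdiff e') (counting T h J) (e *+ i + e' *+ j) = 0) ->
  eventually_poly J.
Proof.
move=> k k' xE k_ge0 k'_ge0 deep HD HD'.
pose x0 : 'rV[rat]_n := e *+ i0 + e' *+ j0.
pose z a b : int := iter b (fdiff e') (iter a (fdiff e) (counting T h J)) x0.
have x0E (s t : nat) : x0 + e *+ s + e' *+ t = e *+ (i0 + s) + e' *+ (j0 + t).
  by rewrite !mulrnDr /x0 -!addrA; congr (_ + _); rewrite addrCA.
have NT i j : (i0 <= i)%N -> (j0 <= j)%N ->
    counting T h J (e *+ i + e' *+ j) =
    \sum_(a < D) \sum_(b < D') z a b *+ ('C(i - i0, a) * 'C(j - j0, b)).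
  have H (s t : nat) : iter D (fdiff e) (counting T h J) (x0 + e *+ s + e' *+ t) = 0.
    by rewrite x0E HD ?leq_addr.
  have H' (s t : nat) : iter D' (fdiff e') (counting T h J) (x0 + e *+ s + e' *+ t) = 0.
    by rewrite x0E HD' ?leq_addr.
  move=> ii jj; have := newton2 H H' (i - i0) (j - j0).
  by rewrite x0E !subnKC.
pose kR (y : 'I_n -> R) := \sum_(t in J) ratr (al t) * y t.
pose kR' (y : 'I_n -> R) := \sum_(t in J) ratr (be t) * y t.
have pk (c : 'I_n -> rat) : polyfun (fun y : 'I_n -> R => \sum_(t in J) ratr (c t) * y t).
  by apply: polyfun_sum => t _; apply: polyfunM; [apply: polyfun_cst|apply: polyfun_coord].
exists (fun y => \sum_(a < D) \sum_(b < D') (z a b)%:~R *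
   (binf a (kR y - i0%:R) * binf b (kR' y - j0%:R))); split.
- apply: polyfun_sum => a _; apply: polyfun_sum => b _.
  apply: polyfunM; first exact: polyfun_cst.
  by apply: polyfunM; apply: polyfun_binf; apply: polyfunB; rewrite /kR /kR' //; apply: polyfun_cst.
- move=> y y' yy; have E (c : 'I_n -> rat) :
      \sum_(t in J) ratr (c t) * y t = \sum_(t in J) ratr (c t) * y' t.
    by apply: eq_bigr => t tJ; rewrite yy.
  by rewrite /kR /kR' !E.
have [Dn [Dn0 DnP]] := common_den (fun p : bool * 'I_n =>
  if p.1 then k (Estar T p.2) else k' (Estar T p.2)).
have [c0 Hc0] := deep.
exists Dn, c0; split=> // b bc bD.
have [ki kj] := Hc0 c0 (leqnn _) b bc.
have isn (c : 'I_n -> rat) :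
    (forall u, Dn%:R * (\sum_(t in J) c t * q u t) \is a Num.int) ->
    (forall u, 0 <= \sum_(t in J) c t * q u t) ->
    \sum_(t in J) c t * Epoint b 0 t \is a Num.nat.
  move=> Hi Hp; rewrite linear_Epoint natrEint sumr_ge0 ?andbT => [|u _]; last first.
    by rewrite mulr_ge0 ?ler0n.
  apply: rpred_sum => u _; have /dvdnP[s ->] := bD u.
  by rewrite natrM -mulrA rpredM ?natr_int.
have /natrP[i iE] := isn al (fun u => DnP (true, u)) k_ge0.
have /natrP[j jE] := isn be (fun u => DnP (false, u)) k'_ge0.
rewrite -/(k _) in iE; rewrite -/(k' _) in jE.
have ii : (i0 <= i)%N by rewrite -(ler_nat rat) -iE.
have jj : (j0 <= j)%N by rewrite -(ler_nat rat) -jE.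
rewrite (@eq_counting _ _ (e *+ i + e' *+ j)); last first.
  move=> t tJ; rewrite (xE (Epoint b)) // iE jE [RHS]mxE.
  by rewrite !mulmxnE !mulr_natl.
have kRE : kR (ratv (Epoint b)) = i%:R.
  rewrite -(ratr_nat R) -iE /k rmorph_sum; apply: eq_bigr => t _.
  by rewrite rmorphM.
have kRE' : kR' (ratv (Epoint b)) = j%:R.
  rewrite -(ratr_nat R) -jE /k' rmorph_sum; apply: eq_bigr => t _.
  by rewrite rmorphM.
rewrite kRE kRE' -!natrB // NT // rmorph_sum; apply: eq_bigr => a _.
rewrite rmorph_sum; apply: eq_bigr => c _.
by rewrite !binf_nat -natrM mulr_natr rmorphMn.
Qed.

End EventuallyPolynomial.

(** Cramer's rule for the symmetric matrix with entries a, b, b, c. *)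
Lemma cramer (F : fieldType) (a b c k k' x y : F) :
  k != 0 -> k' != 0 -> a * c - b * b != 0 ->
  x = (x * c - y * b) / (k * (a * c - b * b)) * (k * a)
      + (y * a - x * b) / (k' * (a * c - b * b)) * (k' * b).
Proof. by move=> k0 k0' d0; field; rewrite k0 k0' d0. Qed.

(** * Counting functions of nodes and of orbifold edges *)

Section NodesAndEdges.
Variables (R : realType) (n : nat) (T : plumbing_tree n) (h : 'rV[rat]_n).
Implicit Types (u v w t : 'I_n) (J : {set 'I_n}) (x : 'rV[rat]_n).
Local Notation q u t := (Estar T u 0 t).

(** A linear form that is nonnegative on the cone and positive on E*_v is large
    on points with large coefficients. *)
Lemma deep_coordinate J (c : 'I_n -> rat) v i0 :
  (forall u, 0 <= \sum_(t in J) c t * q u t) ->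
  0 < \sum_(t in J) c t * q v t ->
  eventually (fun c0 => forall b, (forall u, c0 <= b u)%N ->
        i0%:R <= \sum_(t in J) c t * Epoint T b 0 t).
Proof.
move=> H0 Hv; apply: eventually_imp (eventually_arch i0%:R Hv) => c0 Hc b bc.
rewrite linear_Epoint (bigD1 v) //= -[X in X <= _]addr0 lerD //.
  by apply: le_trans Hc _; rewrite ler_pM2r // ler_nat.
by apply: sumr_ge0 => u _; rewrite mulr_ge0 ?ler0n.
Qed.

Hypothesis valency_pos : forall t, (0 < valency T t)%N.

(** Only one direction is needed; the second one is 0. *)
Lemma eventually_poly_single v : eventually_poly R T h [set v]%SET.
Proof.
have [c [D [C [c0 HD]]]] := vanish_single h valency_pos v.
have qv : 0 < c%:R * q v v by rewrite mulr_gt0 ?ltr0n ?Estar_gt0.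
have [i0 Hi0] := eventually_arch (C + 1) qv.
have kv (x : 'rV[rat]_n) : \sum_(t in [set v]%SET) (c%:R * q v v)^-1 * x 0 t =
    (c%:R * q v v)^-1 * x 0 v by rewrite big_set1.
apply: (@eventually_poly_newton R n T h [set v]%SET (Estar T v *+ c) 0
  (fun=> (c%:R * q v v)^-1) (fun=> 0) D 1%N i0 0%N).
- move=> x t; rewrite inE => /eqP->; rewrite kv mulmxnE [X in _ + _ * X]mxE mulr0 addr0.
  by rewrite -[q v v *+ c]mulr_natl [RHS]mulrAC mulVf ?mul1r // gt_eqF.
- by move=> u; rewrite kv mulr_ge0 ?Estar_ge0 // invr_ge0 ltW.
- by move=> u; rewrite big1 // => t _; rewrite mul0r.
- have := @deep_coordinate [set v]%SET (fun=> (c%:R * q v v)^-1) v i0.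
  move=> H; apply: eventually_imp (H _ _) => [c1 Hc b bc|u|].
  + by split; [apply: Hc|apply: sumr_ge0 => t _; rewrite mul0r].
  + by rewrite kv mulr_ge0 ?Estar_ge0 // invr_ge0 ltW.
  + by rewrite kv mulr_gt0 ?Estar_gt0 // invr_gt0.
- move=> i j ii; rewrite mul0rn addr0; apply: HD.
  rewrite !mulmxnE -mulr_natl -[q v v *+ c]mulr_natl.
  by have := Hi0 i ii; lra.
- by move=> i j _; rewrite /= /fdiff addr0 subrr.
Qed.

(** The two directions are multiples of E*_v and E*_w, for which [vanish_pair]
    applies with the roles of v and w exchanged. *)
Lemma eventually_poly_pair v w : orb_edge T v w ->
  eventually_poly R T h [set v; w]%SET.
Proof.
move=> vw; have vwN := orb_edge_neq vw.
have [c [D [C1 [C2 [c0 HD]]]]] := vanish_pair h valency_pos vw.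
have wv : orb_edge T w v by rewrite orb_edge_sym.
have [c' [D' [C1' [C2' [c0' HD']]]]] := vanish_pair h valency_pos wv.
rewrite finset.setUC in HD'.
set B := q v w in HD; have Bwv : q w v = B by rewrite Estar_sym.
rewrite Bwv in HD'.
pose det := q v v * q w w - B * B.
have det0 : 0 < det by rewrite subr_gt0 /B -{2}[q v w]Estar_sym Estar_det.
have cR : 0 < c%:R :> rat by rewrite ltr0n.
have cR' : 0 < c'%:R :> rat by rewrite ltr0n.
have detN : det != 0 by rewrite gt_eqF.
have [cN cN'] : c%:R != 0 :> rat /\ c'%:R != 0 :> rat by rewrite !gt_eqF.
pose al t := if t == v then q w w / (c%:R * det) else - B / (c%:R * det).
pose be t := if t == v then - B / (c'%:R * det) else q v v / (c'%:R * det).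
have sum2 (f : 'I_n -> rat) : \sum_(t in [set v; w]%SET) f t = f v + f w.
  by rewrite big_setU1 ?big_set1 ?inE.
have kE (x : 'rV[rat]_n) : \sum_(t in [set v; w]%SET) al t * x 0 t =
    (x 0 v * q w w - x 0 w * B) / (c%:R * det).
  by rewrite sum2 /al eqxx eq_sym (negPf vwN); ring.
have kE' (x : 'rV[rat]_n) : \sum_(t in [set v; w]%SET) be t * x 0 t =
    (x 0 w * q v v - x 0 v * B) / (c'%:R * det).
  by rewrite sum2 /be eqxx eq_sym (negPf vwN); ring.
have k0 u : 0 <= \sum_(t in [set v; w]%SET) al t * q u t.
  rewrite kE; apply: divr_ge0; last by rewrite ltW // mulr_gt0.
  rewrite subr_ge0.
  by have := Estar_ineq T u v w; rewrite Bwv [q w w * _]mulrC.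
have k0' u : 0 <= \sum_(t in [set v; w]%SET) be t * q u t.
  rewrite kE'; apply: divr_ge0; last by rewrite ltW // mulr_gt0.
  rewrite subr_ge0.
  by have := Estar_ineq T u w v; rewrite [q v v * _]mulrC.
have kv : 0 < \sum_(t in [set v; w]%SET) al t * q v t.
  by rewrite kE -/B -/det divr_gt0 ?mulr_gt0.
have kw : 0 < \sum_(t in [set v; w]%SET) be t * q w t.
  by rewrite kE' Bwv [q w w * _]mulrC -/det divr_gt0 ?mulr_gt0.
have [i0 [Hi1 Hi2]] : exists i0, (forall i, (i0 <= i)%N -> C1 <= i%:R * (c%:R * det))
    /\ (forall i, (i0 <= i)%N -> C2 + 1 <= i%:R * (c%:R * q v v)).
  have [i0 H] := eventually_and (eventually_arch C1 (mulr_gt0 cR det0))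
    (eventually_arch (C2 + 1) (mulr_gt0 cR (Estar_gt0 T v v))).
  by exists i0; split=> i /H[].
have [j0 [Hj1 Hj2]] : exists j0, (forall j, (j0 <= j)%N -> C1' <= j%:R * (c'%:R * det))
    /\ (forall j, (j0 <= j)%N -> C2' + 1 <= j%:R * (c'%:R * q w w)).
  have [j0 H] := eventually_and (eventually_arch C1' (mulr_gt0 cR' det0))
    (eventually_arch (C2' + 1) (mulr_gt0 cR' (Estar_gt0 T w w))).
  by exists j0; split=> j /H[].
have pt i j t : (Estar T v *+ c *+ i + Estar T w *+ c' *+ j) 0 t =
    i%:R * (c%:R * q v t) + j%:R * (c'%:R * q w t).
  by rewrite mxE !mulmxnE !mulr_natl.
have B0 : 0 < B by apply: Estar_gt0.
apply: (@eventually_poly_newton R n T h [set v; w]%SET (Estar T v *+ c)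
  (Estar T w *+ c') al be D D' i0 j0) => //.
- move=> x t /finset.set2P[]->; rewrite kE kE' !mulmxnE.
    rewrite -[q v v *+ c]mulr_natl -[q w v *+ c']mulr_natl Bwv.
    exact: cramer.
  rewrite -[q v w *+ c]mulr_natl -[q w w *+ c']mulr_natl -/B addrC.
  have -> : det = q w w * q v v - B * B by rewrite /det mulrC.
  by apply: cramer => //; rewrite mulrC.
- by apply: eventually_imp (eventually_and (deep_coordinate i0 k0 kv) (deep_coordinate j0 k0' kw))
    => c1 [H1 H2] b bc; split; [apply: H1|apply: H2].
- move=> i j ii; apply: HD; rewrite !pt -/B ?Bwv.
    by have := Hi1 i ii; rewrite /det; lra.
  have : 0 <= j%:R * (c'%:R * B) by rewrite !mulr_ge0 ?ler0n // ltW.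
  by have := Hi2 i ii; lra.
- move=> i j jj; apply: HD'; rewrite !pt -/B ?Bwv.
    by have := Hj1 j jj; rewrite /det; lra.
  have : 0 <= i%:R * (c%:R * B) by rewrite !mulr_ge0 ?ler0n // ltW.
  by have := Hj2 j jj; lra.
Qed.

End NodesAndEdges.

(** * Uniqueness of the periodic constant *)

Section Ray.
Variables (R : realType) (n : nat) (T : plumbing_tree n) (h : 'rV[rat]_n).
Implicit Types (u v w t : 'I_n) (J : {set 'I_n}) (x y : 'rV[rat]_n).

Lemma projB J x y : proj J (x - y) = proj J x - proj J y.
Proof. by apply/rowP => t; rewrite !mxE; case: ifP; rewrite ?subr0. Qed.

Lemma projMn J x k : proj J (x *+ k) = proj J x *+ k.
Proof. by apply/rowP => t; rewrite mulmxnE !mxE mulmxnE; case: ifP; rewrite ?mul0rn. Qed.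

Lemma latticeL'Mn x k : latticeL' T x -> latticeL' T (x *+ k).
Proof.
move=> /latticeL'P xL; apply/latticeL'P => t.
by rewrite -scaler_nat cofZ rpredM ?natr_int.
Qed.

Lemma latticeL'B x y : latticeL' T x -> latticeL' T y -> latticeL' T (x - y).
Proof.
move=> /latticeL'P xL /latticeL'P yL; apply/latticeL'P => t.
by rewrite cofB rpredB.
Qed.

(** Two of the multiples have the same representative modulo M. *)
Lemma multiple_in (M L : set 'rV[rat]_n) x : finite_index_sublattice M L ->
  (forall k, L (x *+ k)) -> exists k, (0 < k)%N /\ M (x *+ k).
Proof.
move=> [M0 MB ML [s sP]] xL.
have /choice[r rP] : forall k, exists r, r \in s /\ M (x *+ k - r).
  by move=> k; have [r rs Mr] := sP _ (xL k); exists r.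
have ltr k : (index (r k) s < size s)%N by rewrite index_mem; case: (rP k).
pose g (k : 'I_(size s).+1) := Ordinal (ltr k).
have : ~ injective g.
  by move=> /leq_card; rewrite !card_ord ltnn.
move=> ginj; have [i [j [ij gij]]] : exists i j : 'I_(size s).+1, (i < j)%N /\ g i = g j.
  apply: contrapT => H; apply: ginj => i j gij; apply/eqP/negPn/negP.
  rewrite neq_ltn => /orP[] ij; apply: H; first by exists i, j.
  by exists j, i.
have rij : r i = r j.
  rewrite -(nth_index 0 (proj1 (rP i))) -(nth_index 0 (proj1 (rP j))).
  by have /= -> := congr1 (fun z : 'I__ => nat_of_ord z) gij.
exists (j - i)%N; rewrite subn_gt0 ij; split=> //.
have := MB _ _ (proj2 (rP j)) (proj2 (rP i)).
by rewrite rij opprB addrA subrK mulrnBr // ltnW.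
Qed.

Lemma sublattice_Mn (M L : set 'rV[rat]_n) x k : finite_index_sublattice M L ->
  M x -> M (x *+ k).
Proof.
move=> [M0 MB _ _] Mx; elim: k => [|k IHk]; first by rewrite mulr0n.
have := MB _ _ IHk (MB _ _ M0 Mx).
by rewrite sub0r opprK mulrSr.
Qed.

(** This vector is in the interior of the cone, so its ray enters every
    translate of the cone and of its projections. *)
Definition diag : 'rV[rat]_n := \sum_u Estar T u.

Lemma diag_latticeL' : latticeL' T diag.
Proof.
apply/latticeL'P => t; rewrite /diag.
under eq_bigr do rewrite -[Estar T _]scale1r.
by rewrite cof_sum_Estar.
Qed.

(** All multiples of some point on the ray of the projection of [diag] lie in
    the sublattice on whose cosets the quasipolynomial is polynomial, so that
    only one polynomial is involved, the one which gives the value at 0. *)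
Lemma periodic_constant_ray J (c : R) : is_periodic_constant T h J c ->
  exists (P : mpoly.mpoly n R) (k : nat), [/\ (0 < k)%N, c = mpoly.meval (fun=> 0) P &
    eventually (fun j => (counting T h J (diag *+ (k * j)))%:~R =
      mpoly.meval (@ratv R n (proj J (diag *+ (k * j)))) P)].
Proof.
move=> [Lt [ls [q [HLt [s [a [a0 sE]] lsE] [M [HM Mq]] Hq ->]]]].
have Lt0 : Lt 0 by case: HLt.
have [P PE] := Mq 0 Lt0.
have [k1 [k10 Lt1]] := multiple_in HLt (x := proj J diag)
  (fun k => ex_intro2 _ _ (diag *+ k) (latticeL'Mn k diag_latticeL') (projMn J diag k)).
have [k2 [k20 M2]] := multiple_in HM (fun k => sublattice_Mn k HLt Lt1).
have M0 : M 0 by case: HM.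
exists P, (k1 * k2)%N; split; first by rewrite muln_gt0 k10.
  have := PE 0 M0; rewrite addr0 => ->; apply: mpoly.meval_eq => v.
  by rewrite mxE rmorph0.
have Mj j : M (proj J (diag *+ (k1 * k2 * j))).
  by rewrite projMn !mulrnA; apply: sublattice_Mn HM M2.
have Ltj j : Lt (proj J (diag *+ (k1 * k2 * j))).
  by case: HM => _ _ sub _; apply: sub; apply: Mj.
have : eventually (fun j => forall u, a u <= j%:R * 1).
  by apply: eventually_fin => u; apply: eventually_arch; apply: ltr01.
apply: eventually_imp => j Hj.
rewrite Hq //; first by have := PE _ (Mj j); rewrite add0r.
  exact: latticeL'Mn diag_latticeL'.
exists (\sum_u ((k1 * k2 * j)%:R - a u) *: EstarR T R u).
  exists (fun u => (k1 * k2 * j)%:R - a u); split=> // u.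
  rewrite subr_ge0; apply: le_trans (Hj u) _; rewrite mulr1 ler_nat.
  by rewrite leq_pmull // muln_gt0 k10.
rewrite -lsE sE; apply/rowP => t; rewrite !mxE; case: ifP => tJ; last by rewrite rmorph0 subr0.
rewrite !summxE -sumrN; rewrite mulmxnE /diag summxE rmorphMn rmorph_sum -sumrMnl -big_split.
apply: eq_bigr => u _ /=; rewrite ![(_ *: EstarR T R u) 0 t]mxE.
by rewrite [EstarR T R u 0 t]mxE mulrBl mulr_natl.
Qed.

(** Along a common multiple of the two rays both polynomials agree with the
    counting function at infinitely many points, so they agree on the line, and
    at 0. *)
Lemma periodic_constant_unique J (c c' : R) :
  is_periodic_constant T h J c -> is_periodic_constant T h J c' -> c = c'.
Proof.
move=> /periodic_constant_ray[P [k [k0 -> HP]]] /periodic_constant_ray[P' [k' [k0' -> HP']]].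
pose w := @ratv R n (proj J diag).
have line (Q : mpoly.mpoly n R) : exists p : {poly R},
    forall r : R, p.[r] = mpoly.meval (fun v => r * w v) Q.
  have [p pE] := @polyfun_line R n (fun y : 'I_n -> R => mpoly.meval y Q) w
    (ex_intro _ Q (fun=> erefl)).
  by exists p.
have [[p pE] [p' pE']] := (line P, line P').
have w0 (Q : mpoly.mpoly n R) : mpoly.meval (fun=> 0) Q = mpoly.meval (fun v => 0 * w v) Q.
  by apply: mpoly.meval_eq => v; rewrite mul0r.
rewrite !w0 -pE -pE'; suff -> : p = p' by [].
have wE k1 (Q : mpoly.mpoly n R) :
    mpoly.meval (ratv R (proj J (diag *+ k1))) Q = mpoly.meval (fun v => k1%:R * w v) Q.
  by apply: mpoly.meval_eq => v; rewrite /ratv projMn mulmxnE rmorphMn mulr_natl.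
have [N HN] := eventually_and HP HP'.
have eqp j : (N <= j)%N -> p.[(k * k' * j)%:R] = p'.[(k * k' * j)%:R].
  move=> Nj; rewrite pE pE' -!wE.
  have [H1 _] := HN (k' * j)%N (leq_trans Nj (leq_pmull _ k0')).
  have [_ H2] := HN (k * j)%N (leq_trans Nj (leq_pmull _ k0)).
  by rewrite mulnA in H1; rewrite mulnCA mulnA in H2; rewrite -H1 -H2.
apply/eqP; rewrite -subr_eq0; apply/negPn/negP => pN.
(* As many roots of the difference as its size, one too many. *)
pose rs := [seq (k * k' * (N + i))%:R : R | i <- iota 0 (size (p - p'))].
have := max_poly_roots pN (rs := rs); rewrite size_map size_iota ltnn => H.
suff : false by [].
apply: H; last first.
  rewrite map_inj_uniq ?iota_uniq // => i j /eqP.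
  by rewrite eqr_nat eqn_pmul2l ?muln_gt0 ?k0 // eqn_add2l => /eqP.
apply/allP => r /mapP[i _ ->]; rewrite /root hornerD hornerN eqp ?subrr ?eqxx //.
exact: leq_addr.
Qed.

End Ray.

(** * Existence of the periodic constant *)

Section Existence.
Variables (R : realType) (n : nat) (T : plumbing_tree n) (h : 'rV[rat]_n).
Implicit Types (u v w t : 'I_n) (J : {set 'I_n}) (x y : 'rV[rat]_n).

(** The real version of [cof]. *)
Definition cofR (y : 'rV[R]_n) t : R := - \sum_s y 0 s * (intmx T s t)%:~R.

Lemma cofR_ratr x t : cofR (map_mx ratr x) t = ratr (cof T x t).
Proof.
rewrite /cofR cof_intmx rmorphN rmorph_sum; congr (- _).
by apply: eq_bigr => s _; rewrite mxE rmorphM /= ratr_int.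
Qed.

Lemma cofRD (y z : 'rV[R]_n) t : cofR (y + z) t = cofR y t + cofR z t.
Proof.
rewrite /cofR -opprD -big_split; congr (- _).
by apply: eq_bigr => s _; rewrite mxE mulrDl.
Qed.

Lemma cofR_sum (a : 'I_n -> R) t : cofR (\sum_u a u *: EstarR T R u) t = a t.
Proof.
have E s : (\sum_u a u *: EstarR T R u) 0 s * (intmx T s t)%:~R =
    \sum_u a u * (EstarR T R u 0 s * (intmx T s t)%:~R).
  rewrite summxE mulr_suml; apply: eq_bigr => u _.
  by rewrite [(a u *: EstarR T R u) 0 s]mxE mulrA.
rewrite /cofR (eq_bigr _ (fun s _ => E s)) exchange_big /= -sumrN.
have H u : - \sum_s a u * (EstarR T R u 0 s * (intmx T s t)%:~R) =
    a u * (u == t)%:R.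
  rewrite -mulr_sumr -mulrN; congr (_ * _).
  by have := cofR_ratr (Estar T u) t; rewrite cof_Estar ratr_nat.
rewrite (eq_bigr _ (fun u _ => H u)) (bigD1 t) //= eqxx mulr1 big1 ?addr0 // => u ut.
by rewrite (negPf ut) mulr0.
Qed.

(** A crude bound for the sums of the absolute values of the columns of the
    intersection matrix. *)
Definition weight : nat := \sum_s \sum_t `|intmx T s t|%N.

Lemma cofR_bounded (y : 'rV[R]_n) (B : R) t : 0 <= B ->
  (forall s, `|y 0 s| <= B) -> - (B * weight%:R) <= cofR y t.
Proof.
move=> B0 yB; rewrite /cofR lerN2 /weight natr_sum mulr_sumr; apply: ler_sum => s _.
apply: le_trans (ler_norm _) _; rewrite normrM ler_pM //.
rewrite natr_sum (bigD1 t) //= -intr_norm -abszE -[X in X <= _]addr0 lerD //.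
by apply: sumr_ge0 => i _; apply: ler0n.
Qed.

Lemma proj_ratr J x :
  proj J (map_mx ratr x : 'rV[R]_n) = map_mx ratr (proj J x) :> 'rV[R]_n.
Proof. by apply/rowP => t; rewrite !mxE; case: ifP; rewrite ?rmorph0. Qed.

Lemma latticeL'_lattice x : latticeL x -> latticeL' T x.
Proof.
move=> xL; apply/latticeL'P => t; rewrite cof_intmx rpredN rpred_sum // => s _.
by rewrite rpredM ?intr_int.
Qed.

(** The point of the real cone with the same projection differs from z *+ D by
    a real vector y supported outside J. Subtracting from z *+ D the vector y
    with its coordinates rounded down to multiples of D gives a point of D L'
    with the same projection; by [cofR_bounded] the rounding changes the
    coefficients by at most D * weight. *)
Lemma deep_lift J (D c0 : nat) (z : 'rV[rat]_n) (a : 'I_n -> R) : (0 < D)%N ->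
  latticeL' T z -> (forall u, (c0 + D * weight)%:R <= a u) ->
  proj J (map_mx ratr (z *+ D)) = proj J (\sum_u a u *: EstarR T R u) ->
  exists b : 'I_n -> nat, [/\ forall u, (c0 <= b u)%N, forall u, (D %| b u)%N &
    forall t, t \in J -> Epoint T b 0 t = (z *+ D) 0 t].
Proof.
move=> D0 zL aD zE.
have DR : 0 < D%:R :> R by rewrite ltr0n.
pose y : 'rV[R]_n := map_mx ratr (z *+ D) - \sum_u a u *: EstarR T R u.
have yJ t : t \in J -> y 0 t = 0.
  move=> tJ; have /rowP/(_ t) := zE; rewrite ![proj _ _ _ _]mxE tJ => E.
  by rewrite [LHS]mxE [X in _ + X]mxE E subrr.
(* On J the coordinates of y are 0, so that rounding does not move the
   projection. *)
pose m : 'rV[rat]_n := \row_t (Num.floor (y 0 t / D%:R))%:~R.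
have mL : latticeL m by move=> t; rewrite mxE intr_int.
pose x := (z - m) *+ D.
have xJ t : t \in J -> x 0 t = (z *+ D) 0 t.
  by move=> tJ; rewrite /x !mulmxnE mxE [X in _ + X]mxE [m 0 t]mxE yJ // mul0r floor0 subr0.
have zmL : latticeL' T (z - m) by apply: latticeL'B => //; apply: latticeL'_lattice.
have cofx t : cof T x t = D%:R * cof T (z - m) t by rewrite /x -scaler_nat cofZ.
have cofx_ge t : c0%:R <= cof T x t.
  rewrite -(ler_rat R) -cofR_ratr ratr_nat.
  pose f : 'rV[R]_n := y - map_mx ratr (m *+ D).
  have -> : map_mx ratr x = \sum_u a u *: EstarR T R u + f.
    by rewrite /f /y /x mulrnBl map_mxB addrA [X in _ = X - _]addrC subrK.
  rewrite cofRD cofR_sum.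
  have fB s : `|f 0 s| <= D%:R.
    have -> : f 0 s = y 0 s - D%:R * (Num.floor (y 0 s / D%:R))%:~R.
      rewrite [LHS]mxE [X in _ + X]mxE [X in _ - X]mxE mulmxnE [m 0 s]mxE.
      by rewrite rmorphMn /= ratr_int mulr_natl.
    have := Num.Theory.floor_le (y 0 s / D%:R); rewrite ler_pdivlMr // => H1.
    have := Num.Theory.floorD1_gt (y 0 s / D%:R); rewrite ltr_pdivrMr // => H2.
    rewrite ger0_norm; first by move: H2; rewrite intrD; lra.
    by move: H1; lra.
  have := cofR_bounded t (ltW DR) fB; have := aD t.
  by rewrite natrD natrM; lra.
have /choice[b bE] : forall t, exists b : nat, cof T x t = (D * b)%:R.
  move=> t; have /latticeL'P/(_ t) := zmL => zi.
  have : cof T (z - m) t \is a Num.nat.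
    rewrite natrEint zi /= -(pmulr_rge0 _ (_ : 0 < D%:R)) ?ltr0n // -cofx.
    exact: le_trans (ler0n _ _) (cofx_ge t).
  by move=> /natrP[b bE]; exists b; rewrite cofx bE natrM.
exists (fun t => D * b t)%N; split.
- by move=> u; rewrite -(ler_nat rat) -bE.
- by move=> u; apply: dvdn_mulr.
move=> t tJ; rewrite -xJ //; congr (fun_of_matrix _ 0 t).
by rewrite (sum_cof T x) /Epoint; apply: eq_bigr => u _; rewrite bE.
Qed.

(** Reduce the coefficients on the E*_u modulo D. *)
Lemma sublattice_finite_index J D : (0 < D)%N ->
  finite_index_sublattice [set y | exists2 z, latticeL' T z & y = proj J (z *+ D)]%classic
    (proj J @` latticeL' T)%classic.
Proof.
move=> D0; split.
- exists 0; last by rewrite mul0rn; apply/rowP => t; rewrite !mxE; case: ifP.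
  by apply: latticeL'_lattice => t; rewrite mxE rpred0.
- move=> _ _ [z zL ->] [z' zL' ->]; exists (z - z'); first exact: latticeL'B.
  by rewrite -projB mulrnBl.
- by move=> _ [z zL ->]; exists (z *+ D) => //; apply: latticeL'Mn.
exists [seq proj J (boxpt T a) | a : {ffun 'I_n -> 'I_D}].
move=> _ [x xL <-]; have /latticeL'P xi := xL.
have /choice[k kP] : forall t, exists k : int, cof T x t = k%:~R.
  by move=> t; have /intrP := xi t.
have modlt t : (`|(k t %% D)%Z| < D)%N.
  by rewrite -ltz_nat gez0_abs ?modz_ge0 ?ltz_pmod // -lt0n.
pose a : {ffun 'I_n -> 'I_D} := [ffun t => Ordinal (modlt t)].
exists (proj J (boxpt T a)); first by apply: map_f; rewrite mem_enum.
exists (\sum_u (k u %/ D)%Z%:~R *: Estar T u).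
  by apply/latticeL'P => t; rewrite cof_sum_Estar intr_int.
rewrite -projB; congr proj; rewrite {1}(sum_cof T x) boxpt_sum -sumrB -sumrMnl.
apply: eq_bigr => u _; rewrite -scalerBl -scaler_nat scalerA; congr (_ *: _).
rewrite kP ffunE /= {1}(divz_eq (k u) D) natr_absz ger0_norm ?modz_ge0 -?lt0n //.
by rewrite intrD intrM addrK mulrC.
Qed.

(** The sublattice is the projection of D L', the translate of the cone is
    chosen deep enough for [deep_lift], and the quasipolynomial is one
    polynomial. *)
Lemma represents_periodic_constant J F D c0 : polyfun F -> depends_on J F ->
  represents T h J F D c0 -> is_periodic_constant T h J (F (fun=> 0) : R).
Proof.
move=> [P PE] dF [D0 FE].
pose Lt := [set y | exists2 z, latticeL' T z & y = proj J (z *+ D)]%classic.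
have HLt := sublattice_finite_index J D0.
pose c1 := (c0 + D * weight)%N.
exists Lt, (proj J (\sum_u c1%:R *: EstarR T R u)), (fun y => F (ratv R y)); split.
- exact: HLt.
- by exists (\sum_u c1%:R *: EstarR T R u) => //; exists (fun=> c1%:R); split.
- exists Lt; split.
    case: HLt => Lt0 LtB sub _; split=> //; exists [:: 0] => x Ltx.
    by exists 0; rewrite ?inE // subr0.
  by move=> r _; exists P => y _; rewrite PE.
- move=> x xL [z zL xz] [_ [a [a0 ->]] aE].
  have zE : proj J (map_mx ratr (z *+ D)) =
      proj J (\sum_u (c1%:R + a u) *: EstarR T R u).
    rewrite proj_ratr -xz.
    rewrite -[LHS](subrK (proj J (\sum_u c1%:R *: EstarR T R u))) -aE.
    apply/rowP => t; rewrite mxE ![proj _ _ _ _]mxE; case: ifP => _; last by rewrite addr0.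
    rewrite !summxE -big_split; apply: eq_bigr => u _ /=.
    by rewrite ![(_ *: EstarR T R u) 0 t]mxE addrC mulrDl.
  have [|b [b1 b2 b3]] := deep_lift (c0 := c0) D0 zL _ zE.
    by move=> u; rewrite lerDl.
  have bx t : t \in J -> Epoint T b 0 t = x 0 t.
    move=> tJ; rewrite b3 //; have /rowP/(_ t) := xz.
    by rewrite ![proj _ _ _ _]mxE tJ.
  rewrite -(eq_counting T h bx) FE //; apply: dF => t tJ.
  by rewrite /ratv bx // mxE tJ.
by apply: dF => t _; rewrite /ratv mxE rmorph0.
Qed.

(** The counting formula holds at deep points, so the combination of the
    polynomials represents the counting function of all nodes, for a common
    divisor and a common bound. *)
Lemma represents_nodes (F : {set 'I_n} -> ('I_n -> R) -> R) :
  (forall J, J \in orb_edges T \/ (exists2 v, v \in nodes T & J = [set v]%SET) ->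
     [/\ polyfun (F J), depends_on J (F J) & exists D c0, represents T h J (F J) D c0]) ->
  let FN (y : 'I_n -> R) := \sum_(I in orb_edges T) F I y
    - \sum_(v in nodes T) ((orb_valency T v)%:R - 1) * F [set v]%SET y in
  [/\ polyfun FN, depends_on (nodes T) FN & exists D c0, represents T h (nodes T) FN D c0].
Proof.
move=> H FN.
have HI I : I \in orb_edges T -> _ := fun IE => H I (or_introl IE).
have Hv v : v \in nodes T -> _ := fun vN => H [set v]%SET (or_intror (ex_intro2 _ _ v vN erefl)).
split.
- apply: polyfunB; first by apply: polyfun_sum => I /HI[].
  by apply: polyfun_sum => v /Hv[? _ _]; apply: polyfunM => //; apply: polyfun_cst.
- move=> y z yz; rewrite /FN; congr (_ - _); apply: eq_bigr => I IE.
    have [_ dI _] := HI I IE; apply: dI => v vI; apply: yz.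
    by move/orb_edgesP: IE vI => [a [b [/and3P[aN bN _] ->]]] /finset.set2P[]->.
  have [_ dv _] := Hv I IE; congr (_ * _); apply: dv => v.
  by rewrite inE => /eqP->; apply: yz.
have /choice[D HD] : forall J, exists D, (J \in orb_edges T \/
    (exists2 v, v \in nodes T & J = [set v]%SET)) ->
    exists c0, represents T h J (F J) D c0.
  move=> J; have [HJ|HJ] := pselect (J \in orb_edges T \/
    (exists2 v, v \in nodes T & J = [set v]%SET)); last by exists 0%N => /HJ.
  by have [_ _ [D HD]] := H J HJ; exists D.
have /choice[c0 Hc] : forall J, exists c0, (J \in orb_edges T \/
    (exists2 v, v \in nodes T & J = [set v]%SET)) ->
    represents T h J (F J) (D J) c0.
  move=> J; have [HJ|HJ] := pselect (J \in orb_edges T \/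
    (exists2 v, v \in nodes T & J = [set v]%SET)); last by exists 0%N => /HJ.
  by have [c0 Hc0] := HD J HJ; exists c0.
(* Sets J which do not occur get the divisor 1, to keep the product nonzero. *)
pose D' J := if D J == 0%N then 1%N else D J.
exists (\prod_J D' J)%N, (n + \sum_J c0 J)%N; split.
  by apply: prodn_gt0 => J; rewrite /D'; case: eqP => // /eqP; rewrite lt0n.
move=> b bc bD.
have repr J : (J \in orb_edges T \/ (exists2 v, v \in nodes T & J = [set v]%SET)) ->
    (counting T h J (Epoint T b))%:~R = F J (ratv R (Epoint T b)).
  move=> HJ; have [DJ0 RJ] := Hc J HJ; apply: RJ => u.
    apply: leq_trans (bc u); apply: leq_trans (leq_addl _ _).
    by rewrite (bigD1 J) //= leq_addr.
  apply: dvdn_trans (bD u); rewrite (bigD1 J) //= {1}/D' ifN -?lt0n //.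
  exact: dvdn_mulr.
rewrite counting_formula; last first.
  move=> t; rewrite /Epoint cof_sum_Estar.
  have : (valency T t <= b t)%N.
    by apply: leq_trans (bc t); apply: leq_trans (valency_le T t) (leq_addr _ _).
  by rewrite -(ler_nat rat); lra.
rewrite rmorphB !rmorph_sum; congr (_ - _); apply: eq_bigr => I IE.
  by apply: repr; left.
rewrite rmorphM rmorphB /= rmorph1; congr (_ * _).
by apply: repr; right; exists I.
Qed.

Lemma node_valency_pos v : v \in nodes T -> forall t, (0 < valency T t)%N.
Proof.
move=> vN t; have [->|tv] := eqVneq t v; last exact: valency_gt0 tv.
by move: vN; rewrite inE; apply: leq_trans.
Qed.

Lemma eventually_poly_cases J :
  J \in orb_edges T \/ (exists2 v, v \in nodes T & J = [set v]%SET) ->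
  eventually_poly R T h J.
Proof.
case=> [/orb_edgesP[v [w [vw ->]]]|[v vN ->]].
  case/and3P: (vw) => vN _ _.
  by apply: eventually_poly_pair => //; apply: node_valency_pos vN.
exact: eventually_poly_single (node_valency_pos vN) v.
Qed.

Lemma periodic_constantE J (c : R) : is_periodic_constant T h J c ->
  periodic_constant R T h J = c.
Proof.
move=> Hc; rewrite /periodic_constant; case: xgetP => [c' _ Hc'|]; last by move/(_ c).
exact: periodic_constant_unique Hc' Hc.
Qed.

End Existence.

Theorem corollary21 (R : realType) (n : nat) (T : plumbing_tree n)
    (h : 'rV[rat]_n) (hL' : latticeL' T h) :
  (forall x s : 'rV[rat]_n,
     int_lipman T s ->
     x = \sum_v ((valency T v)%:R - 2) *: Estar T v + s ->
     counting T h (nodes T) x =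
       \sum_(I in orb_edges T) counting T h I x
       - \sum_(v in nodes T)
           ((orb_valency T v)%:Z - 1) * counting T h [set v]%SET x)
  /\
  [/\ has_periodic_constant R T h (nodes T),
      forall I, I \in orb_edges T -> has_periodic_constant R T h I,
      forall v, v \in nodes T -> has_periodic_constant R T h [set v]%SET &
      periodic_constant R T h (nodes T) =
        \sum_(I in orb_edges T) periodic_constant R T h I
        - \sum_(v in nodes T)
            ((orb_valency T v)%:R - 1)
            * periodic_constant R T h [set v]%SET].
Proof.
split.
  move=> x s [a [a0 sE]] xE; apply: counting_formula => t.
  rewrite xE sE -big_split /=.
  under eq_bigr do rewrite -scalerDl.
  by rewrite cof_sum_Estar ltrDl ltr0n a0.
have H J : exists F : ('I_n -> R) -> R,
    J \in orb_edges T \/ (exists2 v, v \in nodes T & J = [set v]%SET) ->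
    [/\ polyfun F, depends_on J F & exists D c0, represents T h J F D c0].
  have [HJ|HJ] := pselect (J \in orb_edges T \/
    (exists2 v, v \in nodes T & J = [set v]%SET)); last by exists (fun=> 0) => /HJ.
  by have [F FP] := eventually_poly_cases R h HJ; exists F.
have /choice[F FP] := H.
have pcF J : J \in orb_edges T \/ (exists2 v, v \in nodes T & J = [set v]%SET) ->
    is_periodic_constant T h J (F J (fun=> 0)).
  by move=> /FP[pF dF [D [c0]]]; apply: represents_periodic_constant.
have pcE I : I \in orb_edges T -> is_periodic_constant T h I (F I (fun=> 0)).
  by move=> IE; apply: pcF; left.
have pcV v : v \in nodes T ->
    is_periodic_constant T h [set v]%SET (F [set v]%SET (fun=> 0)).
  by move=> vN; apply: pcF; right; exists v.
have [pN dN [D [c0 rN]]] := represents_nodes FP.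
have pcN := represents_periodic_constant pN dN rN.
split.
- by eexists; exact: pcN.
- by move=> I /pcE; eexists; eassumption.
- by move=> v /pcV; eexists; eassumption.
rewrite (periodic_constantE pcN); congr (_ - _); apply: eq_bigr => I HI.
  by rewrite (periodic_constantE (pcE I HI)).
by rewrite (periodic_constantE (pcV I HI)).
Qed.
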